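(* Let $m$ be an admissible weight, let $(Y,\|\cdot|Y\|)$ be a Banach space with properties (Y1) and (Y2) with respect to $m$, and let $\mathcal F=\{\psi_x\}_{x\in X}$ be a continuous frame for $\mathcal H$ (as in the context, with $R\in\mathcal A_m$). Suppose that $\mathcal F$ possesses property $D[\delta,m]$ with a corresponding moderate admissible covering $\mathcal U=\mathcal U^\delta=(U_i)_{i\in I}$ of $X$, for some $\delta>0$ such that $$\delta\Big(\|R|\mathcal A_m\|+\max\{C_{m,\mathcal U}\|R|\mathcal A_m\|,\ \|R|\mathcal A_m\|+\delta\}\Big)\le 1,$$ where $C_{m,\mathcal U}$ is the constant with $\sup_{x,y\in U_i}m(x,y)\le C_{m,\mathcal U}$ for all $i\in I$. Choose points $(x_i)_{i\in I}\subset X$ with $x_i\in U_i$. Then $\tilde{\mathcal F}_d:=\{S^{-1}\psi_{x_i}\}_{i\in I}\subset\mathcal H^1_v$ is both an atomic decomposition of $\mathsf{Co}\,Y$ with corresponding sequence space $Y^\natural=Y^\natural(\mathcal U)$ and a Banach frame for $\widetilde{\mathsf{Co}}\,Y$ with corresponding sequence space $Y^\flat=Y^\flat(\mathcal U)$. Moreover, there exists a ''dual frame'' $\{\tilde e_i\}_{i\in I}\subset\mathcal K^1_v$ such that: (a) one has the norm equivalences $$\|f|\widetilde{\mathsf{Co}}\,Y\|\cong\|(\langle f,S^{-1}\psi_{x_i}\rangle)_{i\in I}|Y^\flat\|\quad(f\in\widetilde{\mathsf{Co}}\,Y)\qquad\text{and}\qquad\|f|\mathsf{Co}\,Y\|\cong\|(\langle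 f,\tilde e_i\rangle)_{i\in I}|Y^\natural\|\quad(f\in\mathsf{Co}\,Y);$$ (b) if $f\in\mathsf{Co}\,Y$ then $f=\sum_{i\in I}\langle f,\tilde e_i\rangle S^{-1}\psi_{x_i}$, with unconditional norm convergence in $\mathsf{Co}\,Y$ if the finite sequences are dense in $Y^\natural$, and with unconditional convergence in the weak-$*$ topology induced from $(\mathcal K^1_v)^\urcorner$ otherwise; (c) if the finite sequences are dense in $Y^\flat$, then for all $f\in\widetilde{\mathsf{Co}}\,Y$ one has $f=\sum_{i\in I}\langle f,S^{-1}\psi_{x_i}\rangle\tilde e_i$ with unconditional convergence in the norm of $\widetilde{\mathsf{Co}}\,Y$.
   Context: **Frame.** $\mathcal H$ is a separable Hilbert space (inner product linear in the first slot); $X$ is a locally compact, $\sigma$-compact Hausdorff space with positive Radon measure $\mu$, $\operatorname{supp}\mu=X$. A family $\mathcal F=\{\psi_x\}_{x\in X}\subset\mathcal H$ is a continuous frame if there are $0<C_1,C_2<\infty$ with $C_1\|f\|^2\le\int_X|\langle f,\psi_x\rangle|^2d\mu(x)\le C_2\|f\|^2$ for all $f\in\mathcal H$. Standing: $x\mapsto\psi_x$ is weakly continuous and $\sup_x\|\psi_x\|<\infty$. The frame operator is $Sf=\int_X\langle f,\psi_x\rangle\psi_x\,d\mu(x)$ (weakly), bounded, positive, boundedly invertible. Put $Vf(x)=\langle f,\psi_x\rangle$, $Wf(x)=\langle f,S^{-1}\psi_x\rangle$, $R(x,y)=\langle\psi_y,S^{-1}\psi_x\rangle$. **Kernels.**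 A kernel $K$ on $X\times X$ acts by $K(F)(x)=\int_XF(y)K(x,y)d\mu(y)$. $\mathcal A_1$ is the space of measurable kernels with $\|K|\mathcal A_1\|=\max\{\operatorname{ess\,sup}_x\int|K(x,y)|d\mu(y),\operatorname{ess\,sup}_y\int|K(x,y)|d\mu(x)\}<\infty$. A weight $m:X\times X\to\mathbb R$ is admissible if it is continuous, $1\le m(x,y)\le m(x,z)m(z,y)$, $m(x,y)=m(y,x)$ for all $x,y,z$, and $m(x,x)\le C<\infty$ for all $x$. $\mathcal A_m=\{K: Km\in\mathcal A_1\}$, $\|K|\mathcal A_m\|=\|Km|\mathcal A_1\|$. **Space $Y$.** (Y1) $Y$ is a non-trivial Banach space of functions on $X$, continuously embedded in $L^1_{loc}(X,\mu)$, and solid: $F\in L^1_{loc}$, $G\in Y$, $|F|\le|G|$ a.e. imply $F\in Y$, $\|F|Y\|\le\|G|Y\|$. (Y2) for the admissible weight $m$: $\mathcal A_m(Y)\subset Y$ and $\|K(F)|Y\|\le\|K|\mathcal A_m\|\,\|F|Y\|$ for $K\in\mathcal A_m$, $F\in Y$. Standing: $R\in\mathcal A_m$. **Coorbit spaces.** Fix $z\in X$, $v(x)=m(x,z)$; $L^1_v=\{F:Fv\in L^1\}$. $\mathcal H^1_v=\{f\in\mathcal H: Vf\in L^1_v\}$ with norm $\|Vf|L^1_v\|$, $\mathcal K^1_v=\{f\in\mathcal H:Wf\in L^1_v\}$ with norm $\|Wf|L^1_v\|$. $B^\urcorner$ is the anti-dual (continuous conjugate-linear functionals), $\langle f,g\rangle:=f(g)$.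 One has $\psi_x\in\mathcal K^1_v$, $S^{-1}\psi_x\in\mathcal H^1_v$, and $V$, $W$ extend to $(\mathcal K^1_v)^\urcorner$, $(\mathcal H^1_v)^\urcorner$ by $Vf(x)=f(\psi_x)$, $Wf(x)=f(S^{-1}\psi_x)$. $\mathsf{Co}\,Y=\{f\in(\mathcal K^1_v)^\urcorner:Vf\in Y\}$, $\|f|\mathsf{Co}\,Y\|=\|Vf|Y\|$; $\widetilde{\mathsf{Co}}\,Y=\{f\in(\mathcal H^1_v)^\urcorner:Wf\in Y\}$, $\|f|\widetilde{\mathsf{Co}}\,Y\|=\|Wf|Y\|$. Here $\mathcal H$ is regarded as embedded in both anti-duals. **Coverings.** A family $\mathcal U=(U_i)_{i\in I}$ of (measurable) subsets is an admissible covering of $X$ if each $U_i$ is relatively compact with non-void interior, $X=\bigcup_iU_i$, and $\sup_{j\in I}\#\{i\in I:U_i\cap U_j\ne\emptyset\}\le N<\infty$. It is moderate if also $\mu(U_i)\ge D>0$ for all $i$ and $\mu(U_i)\le\widetilde C\mu(U_j)$ whenever $U_i\cap U_j\neq\emptyset$. ($I$ is countable.) **Property $D[\delta,m]$.** $\mathcal F$ possesses property $D[\delta,m]$ if there is a moderate admissible covering $\mathcal U=\mathcal U^\delta$ with $\sup_{x,y\in U_i}m(x,y)\le C_{m,\mathcal U}$ for all $i$, and such that $\operatorname{osc}_{\mathcal U}(x,y):=\sup_{z\in Q_y}|R(x,y)-R(x,z)|$, $Q_y:=\bigcup_{i:\,y\in U_i}U_i$, satisfies $\|\operatorname{osc}_{\mathcal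 U}|\mathcal A_m\|<\delta$. **Sequence spaces.** $Y^\flat(\mathcal U)=\{(\lambda_i)_{i\in I}:\sum_i|\lambda_i|\chi_{U_i}\in Y\}$ with norm $\|\sum_i|\lambda_i|\chi_{U_i}|Y\|$; $Y^\natural(\mathcal U)=\{(\lambda_i)_{i\in I}:\sum_i|\lambda_i|\mu(U_i)^{-1}\chi_{U_i}\in Y\}$ with norm $\|\sum_i|\lambda_i|\mu(U_i)^{-1}\chi_{U_i}|Y\|$. **Atomic decompositions, Banach frames.** A BK-space is a Banach space of sequences in which convergence implies componentwise convergence. $\{g_i\}_{i\in I}\subset B$ is an atomic decomposition for the Banach space $B$ with sequence space $B^\natural$ (a BK-space on $I$) if there are bounded linear functionals $\lambda_i$ on $B$ such that: $(\lambda_i(f))_i\in B^\natural$ and $\|(\lambda_i(f))_i|B^\natural\|\le C_1\|f|B\|$ for all $f\in B$; if $(\lambda_i)_i\in B^\natural$ then $f=\sum_i\lambda_ig_i\in B$ (unconditional convergence in some suitable topology) and $\|f|B\|\le C_2\|(\lambda_i)_i|B^\natural\|$; and $f=\sum_i\lambda_i(f)g_i$ for all $f\in B$. A family $\{h_i\}_{i\in I}$ of bounded functionals on $B$ (here $h_i(f)=\langle f,h_i\rangle$) is a Banach frame for $B$ with sequence space $B^\flat$ (a BK-space) if there is a bounded linear operator $\Omega:B^\flat\to B$ with $\Omega((h_i(f))_i)=f$ for all $f\in B$, and $(h_i(f))_i\in B^\flat$ with $C_1\|f|B\|\le\|(h_i(f))_i|B^\flat\|\le C_2\|f|B\|$ for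 all $f\in B$. *)

(* Defs.v *)
From HB Require Import structures.
From mathcomp Require Import all_boot all_order all_algebra.
From mathcomp Require Import complex sesquilinear finmap.
From mathcomp Require Import all_classical all_reals all_analysis.
From mathcomp Require Import ess_sup_inf summability.

Set Implicit Arguments.
Unset Strict Implicit.
Unset Printing Implicit Defensive.

Import Order.TTheory GRing.Theory Num.Theory.
Import numFieldNormedType.Exports.

Local Open Scope classical_set_scope.
Local Open Scope complex_scope.
Local Open Scope ring_scope.

Notation normc := Normc.normc.

Notation borel X := (g_sigma_algebraType (@open X)).

Section ComplexIntegration.
Context {R : realType} {d : measure_display} {T : measurableType d}.

Definition cmeasurable (D : set T) (f : T -> R[i]) : Prop :=
  measurable_fun D (fun x => complex.Re (f x)) /\
  measurable_fun D (fun x => complex.Im (f x)).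

Variable mu : {measure set T -> \bar R}.

Definition cintegrable (D : set T) (f : T -> R[i]) : Prop :=
  mu.-integrable D (fun x => (complex.Re (f x))%:E) /\
  mu.-integrable D (fun x => (complex.Im (f x))%:E).

Definition cintegral (D : set T) (f : T -> R[i]) : R[i] :=
  Rintegral mu D (fun x => complex.Re (f x)) +i*
  Rintegral mu D (fun x => complex.Im (f x)).

End ComplexIntegration.

Section Banach.
Context {R : realType}.

(* [B] is a Banach space for the norm [N] (only meaningful on [B]).  [Z] is
   the set of vectors identified with 0: the almost everywhere null functions
   for spaces of classes of functions, [set 0] otherwise. *)
Record is_banach {E : lmodType R[i]} (Z B : set E) (N : E -> R) : Prop := {
  banach_0 : B 0 ;
  banach_lin : forall (a : R[i]) f g, B f -> B g -> B (a *: f + g) ;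
  banach_ge0 : forall f, B f -> 0 <= N f ;
  banach_eq0 : forall f, B f -> (N f = 0 <-> Z f) ;
  banach_normZ : forall (a : R[i]) f, B f -> N (a *: f) = normc a * N f ;
  banach_normD : forall f g, B f -> B g -> N (f + g) <= N f + N g ;
  banach_complete : forall u : nat -> E, (forall n, B (u n)) ->
    (forall eps : R, 0 < eps -> exists n0 : nat, forall p q : nat,
       (n0 <= p)%N -> (n0 <= q)%N -> N (u p - u q) < eps) ->
    exists2 l, B l & (fun n => N (u n - l)) @ \oo --> (0 : R) }.

Definition bk_space {I : countType} (B : set (I -> R[i]))
    (N : (I -> R[i]) -> R) : Prop :=
  is_banach [set 0] B N /\
  forall (u : nat -> (I -> R[i])) l, (forall n, B (u n)) -> B l ->
    (fun n => N (u n - l)) @ \oo --> (0 : R) ->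
    forall i, (fun n => normc (u n i - l i)) @ \oo --> (0 : R).

Definition linear_on {E F : lmodType R[i]} (B : set E) (h : E -> F) : Prop :=
  forall (a : R[i]) f g, B f -> B g -> h (a *: f + g) = a *: h f + h g.

Definition bounded_functional {E : lmodType R[i]} (B : set E) (N : E -> R)
    (h : E -> R[i]) : Prop :=
  linear_on B h /\ exists M : R, forall f, B f -> normc (h f) <= M * N f.

(* The net of finite partial sums of [u] converges to [s] in the topology
   generated by the family of seminorms [P]. *)
Definition unconditional_sum {I : countType} {E : lmodType R[i]}
    (P : set (E -> R)) (u : I -> E) (s : E) : Prop :=
  forall p, P p ->
    (fun J : {fset I} => p (s - \sum_(i <- J) u i)) @ totally --> (0 : R).

Definition unconditional_norm_sum {I : countType} {E : lmodType R[i]}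
    (B : set E) (N : E -> R) (u : I -> E) (s : E) : Prop :=
  [/\ forall i, B (u i), B s & unconditional_sum [set N] u s].

Definition finite_sequences_dense {I : countType} (B : set (I -> R[i]))
    (N : (I -> R[i]) -> R) : Prop :=
  forall c, B c -> forall eps : R, 0 < eps ->
    exists2 c', B c' /\ finite_set [set i | c' i != 0] & N (c - c') < eps.

Definition norm_equivalence {I : countType} {E : lmodType R[i]}
    (B : set E) (N : E -> R) (Bs : set (I -> R[i])) (Ns : (I -> R[i]) -> R)
    (h : I -> E -> R[i]) : Prop :=
  exists C1 C2 : R, [/\ 0 < C1, 0 < C2 & forall f, B f ->
    [/\ Bs (h ^~ f), C1 * N f <= Ns (h ^~ f) & Ns (h ^~ f) <= C2 * N f]].

(* [P] generates the topology in which the series of the decomposition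
   converge unconditionally. *)
Definition atomic_decomposition {I : countType} {E : lmodType R[i]}
    (B : set E) (N : E -> R) (Bs : set (I -> R[i])) (Ns : (I -> R[i]) -> R)
    (P : set (E -> R)) (g : I -> E) : Prop :=
  [/\ is_banach [set 0] B N, bk_space Bs Ns, (forall i, B (g i)) &
  exists lam : I -> E -> R[i],
    [/\ forall i, bounded_functional B N (lam i),
        exists2 C1 : R, 0 < C1 & forall f, B f ->
          Bs (lam ^~ f) /\ Ns (lam ^~ f) <= C1 * N f,
        exists2 C2 : R, 0 < C2 & forall c, Bs c -> exists f,
          [/\ B f, unconditional_sum P (fun i => c i *: g i) f &
              N f <= C2 * Ns c] &
        forall f, B f -> unconditional_sum P (fun i => lam i f *: g i) f]].

Definition banach_frame {I : countType} {E : lmodType R[i]}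
    (B : set E) (N : E -> R) (Bs : set (I -> R[i])) (Ns : (I -> R[i]) -> R)
    (h : I -> E -> R[i]) : Prop :=
  [/\ is_banach [set 0] B N, bk_space Bs Ns,
      forall i, bounded_functional B N (h i),
      norm_equivalence B N Bs Ns h &
  exists Omega : (I -> R[i]) -> E,
    [/\ forall c, Bs c -> B (Omega c), linear_on Bs Omega,
        exists M : R, forall c, Bs c -> N (Omega c) <= M * Ns c &
        forall f, B f -> Omega (h ^~ f) = f]].

End Banach.

Section FunctionSpaces.
Context {R : realType} {X : ptopologicalType}.
Variable mu : {measure set (borel X) -> \bar R}.

Definition sigma_compact (T : topologicalType) : Prop :=
  exists K : nat -> set T, (forall n, compact (K n)) /\ \bigcup_n K n = setT.

Definition radon_measure : Prop :=
  [/\ forall K : set X, compact K -> (mu K < +oo)%E,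
      forall A : set (borel X), measurable A ->
        mu A = ereal_inf [set mu O | O in [set O : set X | open O /\ A `<=` O]]
    & forall O : set X, open O ->
        mu O = ereal_sup [set mu K | K in [set K : set X | compact K /\ K `<=` O]]].

Definition full_support : Prop :=
  forall O : set X, open O -> O !=set0 -> (0 < mu O)%E.

Definition admissible_weight (m : X -> X -> R) : Prop :=
  [/\ continuous (fun p : X * X => m p.1 p.2),
      forall x y, 1 <= m x y,
      forall x y w, m x y <= m x w * m w y,
      forall x y, m x y = m y x &
      exists C : R, forall x, m x x <= C].

Definition L1loc : set (X -> R[i]) :=
  [set F | forall K : set X, compact K -> cintegrable mu K F].

Definition L1w (v : X -> R) : set (X -> R[i]) :=
  [set F | cintegrable mu setT (fun x => F x * (v x)%:C)].

Definition L1w_norm (v : X -> R) (F : X -> R[i]) : R :=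
  Rintegral mu setT (fun x => normc (F x) * v x).

Definition kernel_op (K : X -> X -> R[i]) (F : X -> R[i]) : X -> R[i] :=
  fun x => cintegral mu setT (fun y => F y * K x y).

Definition A1_norm (K : X -> X -> R[i]) : \bar R :=
  maxe (ess_sup mu (fun x => \int[mu]_y (normc (K x y))%:E)%E)
       (ess_sup mu (fun y => \int[mu]_x (normc (K x y))%:E)%E).

(* Joint measurability refers to the product of the Borel sigma-algebras. *)
Definition A1 : set (X -> X -> R[i]) :=
  [set K | cmeasurable setT (fun p : borel X * borel X => K p.1 p.2) /\
           (A1_norm K < +oo)%E].

Definition weighted (m : X -> X -> R) (K : X -> X -> R[i]) : X -> X -> R[i] :=
  fun x y => K x y * (m x y)%:C.

Definition Am (m : X -> X -> R) : set (X -> X -> R[i]) :=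
  [set K | A1 (weighted m K)].

(* Real-valued; only meaningful on [Am m]. *)
Definition Am_norm (m : X -> X -> R) (K : X -> X -> R[i]) : R :=
  fine (A1_norm (weighted m K)).

Variables (Y : set (X -> R[i])) (NY : (X -> R[i]) -> R).

(* Elements of Y are represented by functions, and two functions represent the
   same element iff they agree almost everywhere. *)
Definition Y1 : Prop :=
  [/\ is_banach [set F | {ae mu, forall x, F x = 0}] Y NY,
      exists2 F, Y F & NY F != 0,
      Y `<=` L1loc,
      forall K : set X, compact K -> exists C : R, forall F, Y F ->
        (\int[mu]_(x in K) (normc (F x))%:E <= (C * NY F)%:E)%E &
      forall F G, L1loc F -> Y G ->
        {ae mu, forall x, normc (F x) <= normc (G x)} ->
        Y F /\ NY F <= NY G].

(* The first conjunct says that the defining integral of K F converges. *)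
Definition Y2 (m : X -> X -> R) : Prop :=
  forall K F, Am m K -> Y F ->
    [/\ {ae mu, forall x, cintegrable mu setT (fun y => F y * K x y)},
        Y (kernel_op K F) & NY (kernel_op K F) <= Am_norm m K * NY F].

Context {I : countType}.
Variable U : I -> set X.

Definition admissible_covering : Prop :=
  [/\ forall i, measurable (U i : set (borel X)),
      forall i, precompact (U i),
      forall i, (U i)° !=set0,
      \bigcup_i U i = setT &
      exists N : nat, forall j, ([set i | U i `&` U j !=set0] #<= `I_N)%card].

Definition moderate_covering : Prop :=
  [/\ admissible_covering,
      exists2 D : R, 0 < D & forall i, (D%:E <= mu (U i))%E &
      exists C : R, forall i j, U i `&` U j !=set0 ->
        (mu (U i) <= C%:E * mu (U j))%E].

Definition Qset (y : X) : set X := \bigcup_(i in [set i | U i y]) U i.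

Definition osc (K : X -> X -> R[i]) (x y : X) : R :=
  sup [set normc (K x y - K x w) | w in Qset y].

(* sum_i |c_i| w_i chi_(U_i); for an admissible covering the sum at each point
   has finitely many terms. *)
Definition step_fun (w : I -> R) (c : I -> R[i]) : X -> R[i] :=
  fun x => (\sum_(i \in [set i | U i x]) (normc (c i) * w i))%:C.

Definition Yflat : set (I -> R[i]) := [set c | Y (step_fun (fun=> 1) c)].
Definition Yflat_norm (c : I -> R[i]) : R := NY (step_fun (fun=> 1) c).

Definition Ynat : set (I -> R[i]) :=
  [set c | Y (step_fun (fun i => (fine (mu (U i)))^-1) c)].
Definition Ynat_norm (c : I -> R[i]) : R :=
  NY (step_fun (fun i => (fine (mu (U i)))^-1) c).

End FunctionSpaces.

Section Frames.
Context {R : realType} {H : completeNormedModType R[i]}.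
(* [{dot _ for _}] is linear in the first slot, conjugate-linear in the second. *)
Variable ip : {dot H for (@Num.conj R[i])}.
Context {X : ptopologicalType}.
Variables (mu : {measure set (borel X) -> \bar R}) (psi : X -> H).

Definition separable_hilbert : Prop :=
  (forall f : H, `|f| ^+ 2 = ip f f) /\
  exists2 A : set H, countable A & dense A.

Definition continuous_frame : Prop :=
  [/\ forall f : H, continuous (fun x => ip f (psi x) : R[i]^o),
      exists M : R, forall x, `|psi x| <= M%:C &
      exists C1 C2 : R, [/\ 0 < C1, 0 < C2 & forall f : H,
        (((C1 * normc `|f| ^+ 2)%:E <= \int[mu]_x (normc (ip f (psi x)) ^+ 2)%:E)
         /\ (\int[mu]_x (normc (ip f (psi x)) ^+ 2)%:E
             <= (C2 * normc `|f| ^+ 2)%:E))%E]].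

(* S f is the vector weakly given by \int <f, psi_x> psi_x dmu(x). *)
Definition frame_op (f : H) : H :=
  xget 0 [set h | forall g : H,
    ip h g = cintegral mu setT (fun x => ip f (psi x) * ip (psi x) g)].

Definition frame_op_inv (f : H) : H := xget 0 [set h | frame_op h = f].

Definition frame_kernel (x y : X) : R[i] := ip (psi y) (frame_op_inv (psi x)).

Definition property_D {I : countType} (m : X -> X -> R) (delta : R)
    (U : I -> set X) (Cm : R) : Prop :=
  [/\ moderate_covering mu U,
      forall i x y, U i x -> U i y -> m x y <= Cm,
      Am mu m (fun x y => (osc U frame_kernel x y)%:C) &
      Am_norm mu m (fun x y => (osc U frame_kernel x y)%:C) < delta].

(* V and W, on a vector f of H through the functional < f, . >, and on an
   arbitrary functional. *)
Definition Vext (phi : H -> R[i]) : X -> R[i] := fun x => phi (psi x).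
Definition Wext (phi : H -> R[i]) : X -> R[i] :=
  fun x => phi (frame_op_inv (psi x)).

Variable v : X -> R.

Definition H1v : set H := [set f | L1w mu v (Vext (ip f))].
Definition H1v_norm (f : H) : R := L1w_norm mu v (Vext (ip f)).
Definition K1v : set H := [set f | L1w mu v (Wext (ip f))].
Definition K1v_norm (f : H) : R := L1w_norm mu v (Wext (ip f)).

(* Bounded conjugate-linear functionals on the subspace B of H.  They are
   extended by 0 outside B, so that equality of functionals on B is equality of
   functions on H. *)
Definition antidual (B : set H) (N : H -> R) : set (H -> R[i]) :=
  [set phi | [/\ forall (a : R[i]) f g, B f -> B g ->
                   phi (a *: f + g) = Num.conj a * phi f + phi g,
                 exists M : R, forall f, B f -> normc (phi f) <= M * N f &
                 forall f, ~ B f -> phi f = 0]].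

(* H as a subset of the anti-dual of B. *)
Definition embed (B : set H) (f : H) : H -> R[i] :=
  fun g => if g \in B then ip f g else 0.

(* Seminorms of the weak-* topology of the anti-dual of B. *)
Definition weak_star (B : set H) : set ((H -> R[i]) -> R) :=
  [set p | exists2 h, B h & p = fun phi => normc (phi h)].

Variables (Y : set (X -> R[i])) (NY : (X -> R[i]) -> R).

Definition Co : set (H -> R[i]) :=
  [set phi | antidual K1v K1v_norm phi /\ Y (Vext phi)].
Definition Co_norm (phi : H -> R[i]) : R := NY (Vext phi).

Definition tCo : set (H -> R[i]) :=
  [set phi | antidual H1v H1v_norm phi /\ Y (Wext phi)].
Definition tCo_norm (phi : H -> R[i]) : R := NY (Wext phi).

End Frames.

(* Main.v *)
(* The transform [phi |-> (x |-> phi (psi x))] identifies [Co Y] with the space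
   of the [F] in [Y] that are reproduced by the kernel
   [k x y = <psi_y, S^-1 psi_x>] and bounded by a multiple of [v]; since [k] is
   Hermitian, [tCo Y] is identified with the same space.  Let [iota] be a
   measurable choice of a member of the covering containing each point, [c_i]
   the measure of [iota = i], and [T F = sum_i c_i F(x_i) k(., x_i)].  On
   [U_i] a reproduced [F] oscillates by at most [\int |F(t)| osc(t, .) dt], so
   that [1 - T] has norm at most [|osc| |k| + |osc| (|k| + |osc|) < 1] and [T]
   has an inverse [P], given by a Neumann series.  Then [F = T P F] is the
   atomic decomposition and [F = P T F] the Banach frame expansion.  The same
   holds with the weighted space [L^1_v] in place of [Y]; by symmetry of [T],
   [c_i (P F)(x_i)] is the pairing of [F] with [E_i = P (c_i k(., x_i))], and
   the Riesz theorem for the frame form yields [e_i] in [H] with transform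
   [E_i].  Series over [I] are integrals for the counting measure, so that all
   interchanges of limits reduce to Fubini's theorem. *)

Require Import Defs.
From HB Require Import structures.
From mathcomp Require Import all_boot all_order all_algebra.
From mathcomp Require Import complex sesquilinear finmap.
From mathcomp Require Import all_classical all_reals all_analysis.
From mathcomp Require Import measurable_realfun ess_sup_inf summability ring lra.

Set Implicit Arguments.
Unset Strict Implicit.
Unset Printing Implicit Defensive.

Import Order.TTheory GRing.Theory Num.Theory.
Import numFieldNormedType.Exports.

Local Open Scope classical_set_scope.
Local Open Scope complex_scope.
Local Open Scope ring_scope.

(** * Complex-valued functions and integrals *)

(** The hypotheses on [Y] speak of classes modulo null sets, whereas atoms and coefficients live at
    the points [xs i]. Point values are recovered from solidity: (Y2), applied to multiples of
    products of the indicators of [U j] and [U i], puts these indicators in [Y] with norms at least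
    [1 / (C * v (xs i))], and a reproduced [F] then satisfies [|F x| <= C * v x * NY F]. This
    estimate turns norm convergence of the Neumann series into pointwise convergence, so that [P]
    can be defined by pointwise limits and is one and the same operator on [Y] and on [L^1_v]. The
    space [L^1_v] enters because the correspondence between functionals and transforms is itself a
    consequence of the discretization: continuity and linearity of a functional give access to
    finite combinations of atoms only, and the expansion [F = T P F] in [L^1_v] approximates every
    test vector by such combinations. Both coorbit spaces are treated at once, through an abstract
    transform [W] and a family [a] with [W (a y) x = k x y]. *)

Notation Re := complex.Re.
Notation Im := complex.Im.

Section ComplexNorm.
Context {R : realType}.
Implicit Types (z w : R[i]) (r : R).

Lemma normc_ge0 z : 0 <= normc z.
Proof. by case: z => a b; exact: sqrtr_ge0. Qed.

Lemma normc00 : normc (0 : R[i]) = 0.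
Proof. exact: Normc.normc0. Qed.

Lemma normcM z w : normc (z * w) = normc z * normc w.
Proof. exact: Normc.normcM. Qed.

Lemma normcD z w : normc (z + w) <= normc z + normc w.
Proof. exact: (le_normcD (z : Rcomplex R) w). Qed.

Lemma normcN z : normc (- z) = normc z.
Proof. exact: (@normcN _ (z : Rcomplex R)). Qed.

Lemma normcB z w : normc (z - w) <= normc z + normc w.
Proof. by rewrite -(normcN w) normcD. Qed.

Lemma normcBC z w : normc (z - w) = normc (w - z).
Proof. by rewrite -normcN opprB. Qed.

Lemma normc_triangle z w y : normc (z - y) <= normc (z - w) + normc (w - y).
Proof. by apply: le_trans (normcD _ _); rewrite addrA subrK. Qed.

Lemma normc_real r : normc r%:C = `|r|.
Proof. by rewrite /= expr0n /= addr0 sqrtr_sqr. Qed.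

Lemma normc_ge0_real r : 0 <= r -> normc r%:C = r.
Proof. by move=> r0; rewrite normc_real ger0_norm. Qed.

Lemma normc_eq0 z : normc z = 0 -> z = 0.
Proof. exact: Normc.eq0_normc. Qed.

Lemma normc_conj z : normc (Num.conj z) = normc z.
Proof. by case: z => a b /=; rewrite sqrrN. Qed.

Lemma Re_le_normc z : `|Re z| <= normc z.
Proof. by rewrite -lecR; exact: normc_ge_Re. Qed.

Lemma Im_le_normc z : `|Im z| <= normc z.
Proof. by case: z => a b /=; rewrite -sqrtr_sqr ler_wsqrtr// lerDr sqr_ge0. Qed.

Lemma normc_le_ReIm z : normc z <= `|Re z| + `|Im z|.
Proof.
rewrite {1}(complexE z); apply: le_trans (normcD _ _) _.
rewrite normc_real normcM; apply: lerD => //.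
by rewrite normc_real /= expr0n/= add0r expr1n sqrtr1 mul1r.
Qed.

Lemma real_complexD (a b : R) : (a + b)%:C = a%:C + b%:C :> R[i].
Proof. exact: rmorphD. Qed.

Lemma real_complexB (a b : R) : (a - b)%:C = a%:C - b%:C :> R[i].
Proof. exact: rmorphB. Qed.

Lemma real_complexM (a b : R) : (a * b)%:C = a%:C * b%:C :> R[i].
Proof. exact: rmorphM. Qed.

Lemma conjCM z w : Num.conj (z * w) = Num.conj z * Num.conj w.
Proof. exact: rmorphM. Qed.

Lemma conjCD z w : Num.conj (z + w) = Num.conj z + Num.conj w.
Proof. exact: rmorphD. Qed.

Lemma conjCB z w : Num.conj (z - w) = Num.conj z - Num.conj w.
Proof. exact: rmorphB. Qed.

Lemma conjCC z : Num.conj (Num.conj z) = z.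
Proof. exact: conjcK. Qed.

Lemma conjC_real r : Num.conj (r%:C) = r%:C.
Proof. exact: conjc_real. Qed.

Lemma mul_conj_normc z : z * Num.conj z = (normc z ^+ 2)%:C.
Proof. by case: z => a b /=; rewrite sqr_sqrtr ?addr_ge0 ?sqr_ge0//; simpc; congr (_ +i* _); ring. Qed.

Lemma ReD z w : Re (z + w) = Re z + Re w. Proof. by case: z; case: w. Qed.
Lemma ImD z w : Im (z + w) = Im z + Im w. Proof. by case: z; case: w. Qed.
Lemma ReN z : Re (- z) = - Re z. Proof. by case: z. Qed.
Lemma ImN z : Im (- z) = - Im z. Proof. by case: z. Qed.
Lemma ReM z w : Re (z * w) = Re z * Re w - Im z * Im w.
Proof. by case: z; case: w. Qed.
Lemma ImM z w : Im (z * w) = Re z * Im w + Im z * Re w.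
Proof. by case: z => a b; case: w => c e. Qed.
Lemma Re_conj z : Re (Num.conj z) = Re z. Proof. by case: z. Qed.
Lemma Im_conj z : Im (Num.conj z) = - Im z. Proof. by case: z. Qed.
Lemma complexP z w : Re z = Re w -> Im z = Im w -> z = w.
Proof. by case: z; case: w => /= ? ? ? ? -> ->. Qed.

Lemma Re_sum (J : Type) (s : seq J) (P : pred J) (f : J -> R[i]) :
  Re (\sum_(j <- s | P j) f j) = \sum_(j <- s | P j) Re (f j).
Proof. by elim/big_rec2 : _ => [|j x y _ <-]; rewrite ?ReD. Qed.

Lemma normc_nat n : normc (n%:R : R[i]) = n%:R.
Proof. by rewrite -[n%:R](rmorph_nat (real_complex R)) normc_real normr_nat. Qed.

(** The unimodular factor [conj z / |z|] turns [z] into its modulus, so a bound on real parts that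
    survives all rotations bounds the modulus. This carries real inequalities over to complex
    integrals and Hermitian forms. *)
Lemma normc_le_rotation z (M : R) : 0 <= M ->
  (forall u, normc u = 1 -> Re (u * z) <= M) -> normc z <= M.
Proof.
move=> M0 h; have [z0|z0] := eqVneq (normc z) 0; first by rewrite z0.
have n0 : 0 < normc z by rewrite lt_def z0 normc_ge0.
have := h (((normc z)^-1)%:C * Num.conj z).
rewrite normcM normc_conj normc_ge0_real ?invr_ge0 ?normc_ge0// mulVf// => /(_ erefl).
by rewrite -mulrA (mulrC (Num.conj z)) mul_conj_normc -rmorphM/= expr2 mulrA mulVf// mul1r.
Qed.

End ComplexNorm.

Section ComplexMeasurable.
Context {R : realType} {d : measure_display} {T : measurableType d}.
Implicit Types f g : T -> R[i].
Notation cmeas := (@cmeasurable R d T setT).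

Lemma cmeas_cst (a : R[i]) : cmeas (fun=> a).
Proof. by split; exact: measurable_cst. Qed.

Lemma cmeasD f g : cmeas f -> cmeas g -> cmeas (fun x => f x + g x).
Proof.
move=> [f1 f2] [g1 g2]; split.
  by under eq_fun do rewrite ReD; exact: measurable_funD.
by under eq_fun do rewrite ImD; exact: measurable_funD.
Qed.

Lemma cmeasM f g : cmeas f -> cmeas g -> cmeas (fun x => f x * g x).
Proof.
move=> [f1 f2] [g1 g2]; split.
  by under eq_fun do rewrite ReM; apply: measurable_funB; exact: measurable_funM.
by under eq_fun do rewrite ImM; apply: measurable_funD; exact: measurable_funM.
Qed.

Lemma cmeasN f : cmeas f -> cmeas (fun x => - f x).
Proof.
by move=> mf; under eq_fun do rewrite -mulN1r; apply: cmeasM => //; exact: cmeas_cst.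
Qed.

Lemma cmeasB f g : cmeas f -> cmeas g -> cmeas (fun x => f x - g x).
Proof. by move=> mf mg; apply: cmeasD => //; exact: cmeasN. Qed.

Lemma cmeas_conj f : cmeas f -> cmeas (fun x => Num.conj (f x)).
Proof.
move=> [f1 f2]; split; first by under eq_fun do rewrite Re_conj.
by under eq_fun do rewrite Im_conj; exact: measurableT_comp.
Qed.

Lemma cmeas_real (h : T -> R) : measurable_fun setT h -> cmeas (fun x => (h x)%:C).
Proof. by move=> mh; split => //=; exact: measurable_cst. Qed.

Lemma cmeas_normc f : cmeas f -> measurable_fun setT (fun x => normc (f x)).
Proof.
move=> [f1 f2].
have -> : (fun x => normc (f x)) = (fun x => Num.sqrt ((Re (f x)) ^+ 2 + (Im (f x)) ^+ 2)).
  by apply/funext => x; case: (f x).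
apply: (measurableT_comp (continuous_measurable_fun (@sqrt_continuous R))).
by apply: measurable_funD; exact: measurable_funX.
Qed.

Lemma cmeas_enormc f : cmeas f -> measurable_fun setT (fun x => (normc (f x))%:E).
Proof. by move=> /cmeas_normc; exact: measurableT_comp. Qed.

Lemma cmeas_sum (J : Type) (s : seq J) (P : pred J) (h : J -> T -> R[i]) :
  (forall j, P j -> cmeas (h j)) -> cmeas (fun x => \sum_(j <- s | P j) h j x).
Proof.
move=> mh; elim: s => [|j s ih].
  have -> : (fun x => \sum_(j <- [::] | P j) h j x) = fun=> 0.
    by apply/funext => x; rewrite big_nil.
  exact: cmeas_cst.
have -> : (fun x => \sum_(j <- j :: s | P j) h j x) =
    (fun x => (if P j then h j x else 0) + \sum_(j <- s | P j) h j x).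
  by apply/funext => x; rewrite big_cons; case: ifP; rewrite ?add0r.
apply: cmeasD => //; case Pj: (P j); [exact: mh|exact: cmeas_cst].
Qed.

Lemma normc_cvg_ReIm (u : nat -> R[i]) (l : R[i]) :
  (fun n => normc (u n - l)) @ \oo --> (0 : R) ->
  (fun n => Re (u n)) @ \oo --> Re l /\ (fun n => Im (u n)) @ \oo --> Im l.
Proof.
move=> /cvgrPdist_lt ul; split; apply/cvgrPdist_lt => e e0; near=> n.
  have : `|0 - normc (u n - l)| < e by near: n; exact: ul.
  rewrite sub0r normrN (ger0_norm (normc_ge0 _)) => /(le_lt_trans _); apply.
  by rewrite distrC -ReN -ReD Re_le_normc.
have : `|0 - normc (u n - l)| < e by near: n; exact: ul.
rewrite sub0r normrN (ger0_norm (normc_ge0 _)) => /(le_lt_trans _); apply.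
by rewrite distrC -ImN -ImD Im_le_normc.
Unshelve. all: by end_near. Qed.

Lemma cmeas_cvg (h : nat -> T -> R[i]) f : (forall n, cmeas (h n)) ->
  (forall x, (fun n => normc (h n x - f x)) @ \oo --> (0 : R)) -> cmeas f.
Proof.
move=> mh hf; split.
  apply: (@measurable_fun_cvg _ _ _ setT (fun n x => Re (h n x))).
    by move=> n; exact: (mh n).1.
  by move=> x _; exact: (normc_cvg_ReIm (hf x)).1.
apply: (@measurable_fun_cvg _ _ _ setT (fun n x => Im (h n x))).
  by move=> n; exact: (mh n).2.
by move=> x _; exact: (normc_cvg_ReIm (hf x)).2.
Qed.

End ComplexMeasurable.

Section ComplexIntegral.
Context {R : realType} {d : measure_display} {T : measurableType d}.
Variable mu : {measure set T -> \bar R}.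
Implicit Types f g : T -> R[i].
Notation cmeas := (@cmeasurable R d T setT).
Notation cint := (cintegral mu setT).
Notation cintb := (cintegrable mu setT).

Lemma ge0_le_integralT (f g : T -> \bar R) : measurable_fun setT f ->
  measurable_fun setT g -> (forall x, (0 <= f x)%E) -> (forall x, (f x <= g x)%E) ->
  (\int[mu]_x f x <= \int[mu]_x g x)%E.
Proof.
by move=> mf mg f0 fg; apply: ge0_le_integral.
Qed.

Lemma ge0_integralDT (f g : T -> \bar R) : measurable_fun setT f ->
  measurable_fun setT g -> (forall x, (0 <= f x)%E) -> (forall x, (0 <= g x)%E) ->
  (\int[mu]_x (f x + g x) = \int[mu]_x f x + \int[mu]_x g x)%E.
Proof. by move=> mf mg f0 g0; rewrite ge0_integralD. Qed.

Lemma ge0_integralZT (a : R) (f : T -> \bar R) : 0 <= a ->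
  measurable_fun setT f -> (forall x, (0 <= f x)%E) ->
  (\int[mu]_x (a%:E * f x) = a%:E * \int[mu]_x f x)%E.
Proof. by move=> a0 mf f0; rewrite ge0_integralZl. Qed.

Lemma ge0_integralZTr (c : \bar R) (f : T -> \bar R) : (0 <= c)%E ->
  measurable_fun setT f -> (forall x, (0 <= f x)%E) ->
  (\int[mu]_x (f x * c) = (\int[mu]_x f x) * c)%E.
Proof. by move=> c0 mf f0; rewrite (@ge0_integralZr _ _ _ mu setT measurableT f). Qed.

Lemma ge0_integral_RD (f g : T -> R) : measurable_fun setT f ->
  measurable_fun setT g -> (forall x, 0 <= f x) -> (forall x, 0 <= g x) ->
  (\int[mu]_x (f x + g x)%:E = \int[mu]_x (f x)%:E + \int[mu]_x (g x)%:E)%E.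
Proof.
move=> mf mg f0 g0; under eq_integral do rewrite EFinD.
by rewrite ge0_integralDT//; exact/measurable_EFinP.
Qed.

Lemma ge0_integral_RZ (a : R) (f : T -> R) : 0 <= a ->
  measurable_fun setT f -> (forall x, 0 <= f x) ->
  (\int[mu]_x (a * f x)%:E = a%:E * \int[mu]_x (f x)%:E)%E.
Proof.
move=> a0 mf f0; under eq_integral do rewrite EFinM.
by rewrite ge0_integralZT//; exact/measurable_EFinP.
Qed.

Lemma le_integral_R (f g : T -> R) : measurable_fun setT f ->
  measurable_fun setT g -> (forall x, 0 <= f x) -> (forall x, f x <= g x) ->
  (\int[mu]_x (f x)%:E <= \int[mu]_x (g x)%:E)%E.
Proof.
move=> mf mg f0 fg.
by apply: ge0_le_integralT => //; [exact/measurable_EFinP|exact/measurable_EFinP].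
Qed.

Lemma cintegrableP f :
  cintb f <-> cmeas f /\ (\int[mu]_x (normc (f x))%:E < +oo)%E.
Proof.
have mN (h : T -> R) : measurable_fun setT h ->
    measurable_fun setT (fun x => (`|h x|)%:E).
  by move=> mh; apply/measurable_EFinP; exact: (measurableT_comp (@normr_measurable R setT)).
split=> [[/integrableP[m1 i1] /integrableP[m2 i2]]|[mf i]].
  move/measurable_EFinP in m1; move/measurable_EFinP in m2.
  have mf : cmeas f by split.
  split=> //.
  apply: (@le_lt_trans _ _ (\int[mu]_x ((`|Re (f x)|)%:E + (`|Im (f x)|)%:E))%E).
    apply: ge0_le_integralT.
    - exact: cmeas_enormc.
    - by apply: emeasurable_funD; exact: mN.
    - by move=> x; rewrite lee_fin normc_ge0.
    - by move=> x; rewrite -EFinD lee_fin normc_le_ReIm.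
  rewrite ge0_integralD//; [by rewrite lte_add_pinfty|exact: mN|exact: mN].
have [m1 m2] := mf.
split; apply/integrableP; split; try exact/measurable_EFinP.
  apply: le_lt_trans i; apply: ge0_le_integralT.
  - exact: mN.
  - exact: cmeas_enormc.
  - by move=> x; rewrite lee_fin normr_ge0.
  - by move=> x; rewrite lee_fin Re_le_normc.
apply: le_lt_trans i; apply: ge0_le_integralT.
- exact: mN.
- exact: cmeas_enormc.
- by move=> x; rewrite lee_fin normr_ge0.
- by move=> x; rewrite lee_fin Im_le_normc.
Qed.

Lemma cintegrable_meas f : cintb f -> cmeas f.
Proof. by move/cintegrableP => []. Qed.

Lemma cintegrable_lty f : cintb f -> (\int[mu]_x (normc (f x))%:E < +oo)%E.
Proof. by move/cintegrableP => []. Qed.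

Lemma integral_normc_ge0 f : (0 <= \int[mu]_x (normc (f x))%:E)%E.
Proof. by apply: integral_ge0 => x _; rewrite lee_fin normc_ge0. Qed.

Lemma le_cintegrable f (g : T -> \bar R) : cmeas f -> measurable_fun setT g ->
  (forall x, ((normc (f x))%:E <= g x)%E) -> (\int[mu]_x g x < +oo)%E -> cintb f.
Proof.
move=> mf mg fg gi; apply/cintegrableP; split => //; apply: le_lt_trans gi.
apply: ge0_le_integralT => //; first exact: cmeas_enormc.
by move=> x; rewrite lee_fin normc_ge0.
Qed.

Lemma cintegrableD f g : cintb f -> cintb g -> cintb (fun x => f x + g x).
Proof.
move=> [f1 f2] [g1 g2]; split.
  by under eq_fun do rewrite ReD EFinD; exact: integrableD.
by under eq_fun do rewrite ImD EFinD; exact: integrableD.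
Qed.

Lemma cintegrableZ (a : R[i]) f : cintb f -> cintb (fun x => a * f x).
Proof.
move=> /cintegrableP[mf fi]; apply/cintegrableP; split.
  by apply: cmeasM => //; exact: cmeas_cst.
under eq_integral do rewrite normcM EFinM.
rewrite ge0_integralZl//.
- by rewrite lte_mul_pinfty// ?lee_fin ?normc_ge0.
- exact: cmeas_enormc.
- by move=> x _; rewrite lee_fin normc_ge0.
- by rewrite lee_fin normc_ge0.
Qed.

Lemma cintegrableN f : cintb f -> cintb (fun x => - f x).
Proof. by move=> fi; under eq_fun do rewrite -mulN1r; exact: cintegrableZ. Qed.

Lemma cintegrableB f g : cintb f -> cintb g -> cintb (fun x => f x - g x).
Proof. by move=> fi gi; apply: cintegrableD => //; exact: cintegrableN. Qed.

Lemma cintegrable_conj f : cintb f -> cintb (fun x => Num.conj (f x)).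
Proof.
move=> /cintegrableP[mf fi]; apply/cintegrableP; split; first exact: cmeas_conj.
by under eq_integral do rewrite normc_conj.
Qed.

Lemma cintegralD f g : cintb f -> cintb g ->
  cint (fun x => f x + g x) = cint f + cint g.
Proof.
move=> [f1 f2] [g1 g2]; apply: complexP; rewrite ?ReD ?ImD /=.
  by rewrite -RintegralD//; congr Rintegral; apply/funext => x; rewrite ReD.
by rewrite -RintegralD//; congr Rintegral; apply/funext => x; rewrite ImD.
Qed.

Lemma cintegralZ (a : R[i]) f : cintb f -> cint (fun x => a * f x) = a * cint f.
Proof.
move=> [f1 f2]; apply: complexP; rewrite ?ReM ?ImM /=.
  rewrite -!RintegralZl// -RintegralB//; last 2 first.
  - exact: (integrableZl measurableT (Re a) f1).
  - exact: (integrableZl measurableT (Im a) f2).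
  by congr Rintegral; apply/funext => x; rewrite ReM.
rewrite -!RintegralZl// -RintegralD//; last 2 first.
- exact: (integrableZl measurableT (Re a) f2).
- exact: (integrableZl measurableT (Im a) f1).
by congr Rintegral; apply/funext => x; rewrite ImM.
Qed.

Lemma cintegralN f : cintb f -> cint (fun x => - f x) = - cint f.
Proof.
move=> fi; rewrite -mulN1r -cintegralZ//; congr cintegral.
by apply/funext => x; rewrite mulN1r.
Qed.

Lemma cintegralB f g : cintb f -> cintb g ->
  cint (fun x => f x - g x) = cint f - cint g.
Proof.
by move=> fi gi; rewrite cintegralD//; [rewrite cintegralN|exact: cintegrableN].
Qed.

Lemma cintegral_conj f : cintb f ->
  cint (fun x => Num.conj (f x)) = Num.conj (cint f).
Proof.
move=> [f1 f2]; apply: complexP; rewrite ?Re_conj ?Im_conj /=.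
  by congr Rintegral; apply/funext => x; rewrite Re_conj.
rewrite -mulN1r -RintegralZl//; congr Rintegral; apply/funext => x.
by rewrite Im_conj mulN1r.
Qed.

Lemma normc_cintegral f : cintb f ->
  ((normc (cint f))%:E <= \int[mu]_x (normc (f x))%:E)%E.
Proof.
move=> fi; have ifin : (\int[mu]_x (normc (f x))%:E)%E \is a fin_num.
  by rewrite ge0_fin_numE ?integral_normc_ge0//; exact: cintegrable_lty.
rewrite -(fineK ifin) lee_fin; apply: normc_le_rotation.
  by rewrite fine_ge0// integral_normc_ge0.
(* The rotation goes under the integral; what is left is the real part of an integral, where
   monotonicity applies. *)
move=> u u1; rewrite -cintegralZ//=.
have ufi := cintegrableZ u fi.
apply: le_Rintegral => //; first exact: ufi.1.
  apply/integrableP; split; first exact: cmeas_enormc (cintegrable_meas fi).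
  apply: le_lt_trans (cintegrable_lty fi); rewrite le_eqVlt; apply/orP; left.
  by apply/eqP; apply: eq_integral => x _ /=; rewrite ger0_norm ?normc_ge0.
move=> x _; apply: le_trans (ler_norm _) _; apply: le_trans (Re_le_normc _) _.
by rewrite normcM u1 mul1r.
Qed.

Lemma cintegral_le f (M : R) : cintb f -> (\int[mu]_x (normc (f x))%:E <= M%:E)%E ->
  normc (cint f) <= M.
Proof. by move=> fi fM; rewrite -lee_fin; exact: le_trans (normc_cintegral fi) fM. Qed.

Lemma cintegrable0 : cintb (fun=> 0).
Proof. by split; exact: integrable0. Qed.

Lemma cintegral0 : cint (fun=> 0) = 0.
Proof.
rewrite -[RHS](mul0r (cint (fun=> 0))) -(cintegralZ 0 cintegrable0).
by congr cintegral; apply/funext => x; rewrite mul0r.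
Qed.

End ComplexIntegral.

(** * Fubini's theorem for measures that are sigma-finite by hypothesis *)

Section SigmaFiniteFubini.
Context {R : realType} {d1 d2 : measure_display}
  {T1 : measurableType d1} {T2 : measurableType d2}.
Variables (m1 : {measure set T1 -> \bar R}) (m2 : {measure set T2 -> \bar R}).
Hypotheses (s1 : sigma_finite setT m1) (s2 : sigma_finite setT m2).

(** Sigma-finiteness is a hypothesis on the measure; packing its proof builds the structure for
    which Fubini's theorem is stated. *)
Let M1 : {sigma_finite_measure set T1 -> \bar R} :=
  HB.pack (Measure.sort m1) (Measure.class m1)
    (isSFinite.Build _ _ _ (Measure.sort m1) (sfinite_measure_sigma_finite s1))
    (isSigmaFinite.Build _ _ _ (Measure.sort m1) s1).
Let M2 : {sigma_finite_measure set T2 -> \bar R} :=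
  HB.pack (Measure.sort m2) (Measure.class m2)
    (isSFinite.Build _ _ _ (Measure.sort m2) (sfinite_measure_sigma_finite s2))
    (isSigmaFinite.Build _ _ _ (Measure.sort m2) s2).

Lemma sigma_finite_tonelli (f : T1 * T2 -> \bar R) : measurable_fun setT f ->
  (forall p, (0 <= f p)%E) ->
  (\int[m1]_x \int[m2]_y f (x, y) = \int[m2]_y \int[m1]_x f (x, y))%E.
Proof. by move=> mf f0; exact: (@fubini_tonelli _ _ _ _ _ M1 M2 f). Qed.

Lemma measurable_fun_section_integral (f : T1 * T2 -> \bar R) :
  measurable_fun setT f -> (forall p, (0 <= f p)%E) ->
  measurable_fun setT (fun x => \int[m2]_y f (x, y))%E.
Proof.
by move=> mf f0; exact: (@measurable_fun_fubini_tonelli_F _ _ _ _ _ M2 f).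
Qed.

(** The integral is the difference of the integrals of the positive and negative parts, whether
    finite or not, so Tonelli's measurability statement applies to each part. *)
Lemma measurable_section_Rintegral (f : T1 * T2 -> R) : measurable_fun setT f ->
  measurable_fun setT (fun x => Rintegral m2 setT (fun y => f (x, y))).
Proof.
move=> mf; rewrite /Rintegral; apply: (measurableT_comp (fine_measurable _)) => //.
under eq_fun do rewrite integralE.
have /measurable_EFinP mf' := mf.
apply: emeasurable_funB.
  have /measurable_fun_section_integral/(_ (fun p => funepos_ge0 _ p)) := measurable_funepos mf'.
  by congr measurable_fun; apply/funext => x; apply: eq_integral => y _; rewrite !funeposE.
have /measurable_fun_section_integral/(_ (fun p => funeneg_ge0 _ p)) := measurable_funeneg mf'.
by congr measurable_fun; apply/funext => x; apply: eq_integral => y _; rewrite !funenegE.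
Qed.

Lemma cmeas_section_cintegral (f : T1 -> T2 -> R[i]) :
  cmeasurable setT (fun p : T1 * T2 => f p.1 p.2) ->
  cmeasurable setT (fun x => cintegral m2 setT (f x)).
Proof.
move=> [f1 f2]; split.
  exact: (@measurable_section_Rintegral (fun p => Re (f p.1 p.2))).
exact: (@measurable_section_Rintegral (fun p => Im (f p.1 p.2))).
Qed.

(** Integrability of every section makes every inner integral finite, so [fine] can be undone at
    each point and the extended-real Fubini theorem transfers to [Rintegral]. *)
Lemma sigma_finite_Rfubini (f : T1 -> T2 -> R) :
  measurable_fun setT (fun p : T1 * T2 => f p.1 p.2) ->
  (\int[m1]_x \int[m2]_y (`|f x y|)%:E < +oo)%E ->
  (forall x, m2.-integrable setT (fun y => (f x y)%:E)) ->
  (forall y, m1.-integrable setT (fun x => (f x y)%:E)) ->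
  Rintegral m1 setT (fun x => Rintegral m2 setT (f x)) =
  Rintegral m2 setT (fun y => Rintegral m1 setT (f ^~ y)).
Proof.
move=> mf fi f1 f2; rewrite {1 3}/Rintegral; congr fine.
have fub := @Fubini _ _ _ _ _ M1 M2 (fun p => (f p.1 p.2)%:E).
transitivity (\int[m1]_x \int[m2]_y (f x y)%:E)%E.
  apply: eq_integral => x _; rewrite /Rintegral fineK//.
  exact: integrable_fin_num.
rewrite [LHS]fub.
  by apply: eq_integral => y _; rewrite /Rintegral fineK//; exact: integrable_fin_num.
apply/integrable12ltyP => //; exact/measurable_EFinP.
Qed.

Lemma sigma_finite_cfubini (f : T1 -> T2 -> R[i]) :
  cmeasurable setT (fun p : T1 * T2 => f p.1 p.2) ->
  (\int[m1]_x \int[m2]_y (normc (f x y))%:E < +oo)%E ->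
  (forall x, cintegrable m2 setT (f x)) ->
  (forall y, cintegrable m1 setT (f ^~ y)) ->
  cintegral m1 setT (fun x => cintegral m2 setT (f x)) =
  cintegral m2 setT (fun y => cintegral m1 setT (f ^~ y)).
Proof.
move=> mf fi f1 f2; have [mf1 mf2] := mf.
have dom (h : R[i] -> R) : (forall z, `|h z| <= normc z) ->
    measurable_fun setT (fun p : T1 * T2 => h (f p.1 p.2)) ->
    (\int[m1]_x \int[m2]_y (`|h (f x y)|)%:E < +oo)%E.
  move=> hz mh; apply: le_lt_trans fi.
  have mN : measurable_fun setT (fun p : T1 * T2 => (`|h (f p.1 p.2)|)%:E).
    by apply/measurable_EFinP; exact: (measurableT_comp (@normr_measurable R setT)).
  apply: ge0_le_integralT.
  - by apply: (measurable_fun_section_integral mN) => p; rewrite lee_fin.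
  - by apply: (measurable_fun_section_integral (cmeas_enormc mf)) => p; rewrite lee_fin normc_ge0.
  - by move=> x; apply: integral_ge0 => y _; rewrite lee_fin.
  - move=> x; apply: ge0_le_integralT.
    + exact: (measurableT_comp mN (pair1_measurable x)).
    + exact: cmeas_enormc (cintegrable_meas (f1 x)).
    + by [].
    + by move=> y; rewrite lee_fin.
apply: complexP => /=.
  apply: sigma_finite_Rfubini; first exact: mf1.
  - exact: dom (@Re_le_normc R) mf1.
  - by move=> x; exact: (f1 x).1.
  - by move=> y; exact: (f2 y).1.
apply: sigma_finite_Rfubini; first exact: mf2.
- exact: dom (@Im_le_normc R) mf2.
- by move=> x; exact: (f1 x).2.
- by move=> y; exact: (f2 y).2.
Qed.

End SigmaFiniteFubini.

(* The index set with the discrete sigma-algebra; measurable types are pointed,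
   hence the point [i0]. *)
Definition discr (I : countType) (i0 : I) : Type := I.

Section Discr.
Variables (I : countType) (i0 : I).
HB.instance Definition _ := Countable.on (discr i0).
HB.instance Definition _ := isPointed.Build (discr i0) i0.
HB.instance Definition _ := @isMeasurable.Build default_measure_display
  (discr i0) discrete_measurable discrete_measurable0
  discrete_measurableC discrete_measurableU.
End Discr.

#[local] Existing Instance totally_filter.

(** * Series over a countable set as integrals for the counting measure *)

Section Counting.
Context {R : realType} {I : countType} (i0 : I).
Notation II := (discr i0).

Definition cnt : {measure set II -> \bar R} := @counting II R.

Arguments cnt : simpl never.

Lemma measurable_fun_discr {d} {T : measurableType d} (f : II -> T) :
  measurable_fun setT f.
Proof. by []. Qed.

Lemma cmeasurable_discr (f : II -> R[i]) : cmeasurable setT f.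
Proof. by split; exact: measurable_fun_discr. Qed.

(** The preimage of a measurable set is a countable union, over [i], of measurable rectangles whose
    first side is the singleton of [i]. *)
Lemma measurable_fun_discr_prod {d d'} {T : measurableType d} {T' : measurableType d'}
    (f : II -> T -> T') : (forall i, measurable_fun setT (f i)) ->
  measurable_fun setT (fun p : II * T => f p.1 p.2).
Proof.
move=> mf _ B mB; rewrite setTI.
have -> : (fun p : II * T => f p.1 p.2) @^-1` B =
    \bigcup_(i in [set: I]) ([set i : II] `*` (f i @^-1` B)).
  apply/seteqP; split => [[i x] /= Bx|[i x] [j _ [/= -> //]]].
  by exists i.
apply: countable_bigcupT_measurable => [|i]; first exact: countableP.
apply: measurableX => //.
by rewrite -[X in measurable X]setTI; exact: mf.
Qed.

Lemma cmeasurable_discr_prod {d} {T : measurableType d} (f : II -> T -> R[i]) :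
  (forall i, cmeasurable setT (f i)) ->
  cmeasurable setT (fun p : II * T => f p.1 p.2).
Proof.
move=> mf; split.
  by apply: (measurable_fun_discr_prod (f := fun i x => Re (f i x))) => i; exact: (mf i).1.
by apply: (measurable_fun_discr_prod (f := fun i x => Im (f i x))) => i; exact: (mf i).2.
Qed.

Lemma finite_pickle_lt n : finite_set [set i : I | (choice.pickle i < n)%N].
Proof.
have : finite_set (@choice.pickle I @^-1` `I_n).
  by apply: finite_preimage => // i j _ _; exact: (pcan_inj choice.pickleK).
by apply: sub_finite_set.
Qed.

Lemma cnt_finite_set (A : set I) : finite_set A ->
  cnt A = ((#|` fset_set A|)%:R)%:E.
Proof. by move=> fA; rewrite -[LHS]/(@counting II R A) /counting asboolT. Qed.

Lemma sigma_finite_cnt : sigma_finite setT cnt.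
Proof.
exists (fun n => [set i : I | (choice.pickle i < n)%N]).
  by apply/seteqP; split => // i _; exists (choice.pickle i).+1 => //=.
move=> n; split => //; rewrite cnt_finite_set ?ltry//.
exact: finite_pickle_lt.
Qed.

Lemma cnt_single_indic (j : I) :
  (\int[cnt]_i (\1_[set j] i : R)%:E = 1)%E.
Proof.
rewrite integral_indic// setIT cnt_finite_set//.
by rewrite fset_set1 cardfs1.
Qed.

Lemma cintegrable_cnt_single (j : I) (a : R[i]) :
  cintegrable cnt setT (fun i => if i == j then a else 0).
Proof.
apply/cintegrableP; split; first exact: cmeasurable_discr.
rewrite (_ : integral _ _ _ =
    (\int[cnt]_i ((normc a)%:E * (\1_[set j] i : R)%:E))%E); last first.
  apply: eq_integral => i _; rewrite indicE /= in_set1.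
  by case: eqVneq => _; rewrite ?mule1 ?mule0 ?normc00.
rewrite ge0_integralZl//; first by rewrite cnt_single_indic mule1 ltry.
by rewrite lee_fin normc_ge0.
Qed.

Lemma cintegral_cnt_single (j : I) (a : R[i]) :
  cintegral cnt setT (fun i => if i == j then a else 0) = a.
Proof.
have -> : (fun i : II => if i == j then a else 0) =
    (fun i => a * (if i == j then 1 else 0)).
  by apply/funext => i; case: ifP; rewrite ?mulr1 ?mulr0.
rewrite cintegralZ; last exact: cintegrable_cnt_single.
suff -> : cintegral cnt setT (fun i => if i == j then 1 else 0) = 1 :> R[i].
  by rewrite mulr1.
apply: complexP => /=; rewrite /Rintegral.
  rewrite -[RHS]/(fine 1%:E) -(cnt_single_indic j); congr fine; apply: eq_integral => i _.
  by rewrite indicE /= in_set1; case: eqVneq.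
by rewrite integral0_eq// => i _; case: eqVneq.
Qed.

Lemma sum_pick (V : nmodType) (s : seq I) (F : I -> V) (i : I) : uniq s ->
  \sum_(j <- s) (if i == j then F j else 0) = if i \in s then F i else 0.
Proof.
elim: s => [|j s ih /= /andP[js us]]; first by rewrite big_nil.
rewrite big_cons inE ih//; case: eqVneq => [->|_] /=; last by rewrite add0r.
by rewrite (negbTE js) addr0.
Qed.

Lemma cintegrable_cnt_fset (J : {fset I}) (a : I -> R[i]) :
  cintegrable cnt setT (fun i => if i \in J then a i else 0).
Proof.
under eq_fun do rewrite -(sum_pick a _ (fset_uniq J)).
elim: (enum_fset J) => [|j s ih].
  under eq_fun do rewrite big_nil; exact: cintegrable0.
under eq_fun do rewrite big_cons.
by apply: cintegrableD => //; exact: cintegrable_cnt_single.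
Qed.

Lemma cintegral_cnt_fset (J : {fset I}) (a : I -> R[i]) :
  cintegral cnt setT (fun i => if i \in J then a i else 0) = \sum_(i <- J) a i.
Proof.
under [X in cintegral _ _ X]eq_fun do rewrite -(sum_pick a _ (fset_uniq J)).
have ind (s : seq I) :
    cintegrable cnt setT (fun i => \sum_(j <- s) (if i == j then a j else 0)) /\
    cintegral cnt setT (fun i => \sum_(j <- s) (if i == j then a j else 0)) =
    \sum_(i <- s) a i.
  elim: s => [|j s [ih1 ih2]].
    rewrite big_nil; under eq_fun do rewrite big_nil.
    by split; [exact: cintegrable0|exact: cintegral0].
  rewrite big_cons; under eq_fun do rewrite big_cons.
  split; first by apply: cintegrableD => //; exact: cintegrable_cnt_single.
  rewrite cintegralD//; last exact: cintegrable_cnt_single.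
  by rewrite cintegral_cnt_single ih2.
exact: (ind (enum_fset J)).2.
Qed.

Lemma integral_cnt_fset (J : {fset I}) (g : I -> R) : (forall i, 0 <= g i) ->
  (\int[cnt]_i (if i \in J then g i else 0)%:E = (\sum_(i <- J) g i)%:E)%E.
Proof.
move=> g0; have gi := cintegrable_cnt_fset J (fun i => (g i)%:C).
have := cintegral_cnt_fset J (fun i => (g i)%:C).
move=> /(congr1 (@complex.Re R)); rewrite Re_sum /= /Rintegral => <-.
rewrite fineK; last exact: integrable_fin_num gi.1.
by apply: eq_integral => i _; case: ifP.
Qed.

(** Dominated convergence along the exhaustion of [I] by the finite sets [pickle i < n] makes one
    tail small. Tails decrease as [J] grows, so that one finite set serves for every larger [J]. *)
Lemma integral_cnt_tail (b : I -> R) (e : R) : (forall i, 0 <= b i) ->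
  (\int[cnt]_i (b i)%:E < +oo)%E -> 0 < e ->
  exists J0 : {fset I}, forall J, (J0 `<=` J)%fset ->
    (\int[cnt]_i (if i \in J then 0 else b i)%:E <= e%:E)%E.
Proof.
move=> b0 bi e0.
pose f_ n (i : II) : \bar R := (if (choice.pickle (i : I) < n)%N then 0 else b i)%:E.
have f_cvg : {ae cnt, forall i, setT i -> f_ ^~ i @ \oo --> cst 0%E i}.
  apply: aeW => i _; apply: cvg_near_cst; exists (choice.pickle (i : I)).+1 => // n /= hn.
  by rewrite /f_ hn.
have b_int : cnt.-integrable setT (fun i => (b i)%:E).
  apply/integrableP; split; first exact: measurable_fun_discr.
  by under eq_integral do rewrite gee0_abs ?lee_fin//.
have f_b : {ae cnt, forall i n, setT i -> (`|f_ n i| <= (b i)%:E)%E}.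
  apply: aeW => i n _; rewrite /f_; case: ifP => _; rewrite ?abse0 ?lee_fin//.
  by rewrite ger0_norm.
have [_ _] := @dominated_convergence _ _ R cnt setT measurableT f_ (cst 0%E) (fun i => (b i)%:E)
  (fun n => measurable_fun_discr (f_ n)) (measurable_fun_discr _) f_cvg b_int f_b.
rewrite integral0 => /fine_cvgP[[N1 _ fin]] /cvgrPdist_le/(_ e e0)[N2 _ hN].
pose N := maxn N1 N2.
exists (fset_set [set i : I | (choice.pickle i < N)%N]) => J hJ.
apply: (@le_trans _ _ (\int[cnt]_i f_ N i)%E).
  apply: ge0_le_integralT; try exact: measurable_fun_discr.
    by move=> i; case: ifP; rewrite lee_fin.
  move=> i; rewrite /f_; case: ifPn => [_|iJ]; first by case: ifP; rewrite lee_fin.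
  case: ifPn => // iN; exfalso; move/negP: iJ; apply; apply/(fsubsetP hJ).
  by rewrite in_fset_set ?inE//; exact: finite_pickle_lt.
have := hN N (leq_maxr _ _); rewrite /= sub0r normrN ger0_norm; last first.
  by rewrite fine_ge0// integral_ge0// => i _; rewrite /f_; case: ifP; rewrite lee_fin.
by rewrite -lee_fin fineK//; exact: (fin N (leq_maxl _ _)).
Qed.

Lemma cintegral_cnt_sub_sum (a : I -> R[i]) (J : {fset I}) :
  (\int[cnt]_i (normc (a i))%:E < +oo)%E ->
  ((normc (cintegral cnt setT a - \sum_(i <- J) a i))%:E <=
    \int[cnt]_i (if i \in J then 0 else normc (a i))%:E)%E.
Proof.
move=> ai; have ia : cintegrable cnt setT a.
  by apply/cintegrableP; split => //; exact: cmeasurable_discr.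
rewrite -cintegral_cnt_fset -cintegralB//; last exact: cintegrable_cnt_fset.
apply: le_trans (normc_cintegral _) _.
  by apply: cintegrableB => //; exact: cintegrable_cnt_fset.
apply: ge0_le_integralT; try exact: measurable_fun_discr.
  by move=> i; rewrite lee_fin normc_ge0.
by move=> i; case: ifP; rewrite ?subrr ?subr0 ?normc00.
Qed.

Lemma totally_cvg0 (p : {fset I} -> R) : (forall J, 0 <= p J) ->
  (forall e, 0 < e -> exists J0 : {fset I}, forall J, (J0 `<=` J)%fset -> p J <= e) ->
  p @ totally --> (0 : R).
Proof.
move=> p0 h; apply/cvgrPdist_le => e /h[J0 hJ0].
by exists J0 => // J /= /hJ0; rewrite sub0r normrN ger0_norm.
Qed.

Lemma cnt_summable_totally (a : I -> R[i]) :
  (\int[cnt]_i (normc (a i))%:E < +oo)%E ->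
  (fun J : {fset I} => normc (cintegral cnt setT a - \sum_(i <- J) a i)) @ totally
    --> (0 : R).
Proof.
move=> ai; apply: totally_cvg0 => [J|e e0]; first exact: normc_ge0.
have [J0 hJ0] := integral_cnt_tail (fun i => normc_ge0 (a i)) ai e0.
exists J0 => J /hJ0 h; rewrite -lee_fin; apply: le_trans h.
exact: cintegral_cnt_sub_sum.
Qed.

End Counting.
Arguments cnt : simpl never.

(** * Kernels and reproduced functions *)

Section AlmostEverywhere.
Context {R : realType} {d : measure_display} {T : measurableType d}.
Variable mu : {measure set T -> \bar R}.

Lemma ae_impl (P Q : T -> Prop) : (forall x, P x -> Q x) ->
  {ae mu, forall x, P x} -> {ae mu, forall x, Q x}.
Proof. by move=> PQ; apply: filterS. Qed.

Lemma ae_and (P Q : T -> Prop) : {ae mu, forall x, P x} -> {ae mu, forall x, Q x} ->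
  {ae mu, forall x, P x /\ Q x}.
Proof. by move=> aP aQ; apply: filterS2 aP aQ. Qed.

End AlmostEverywhere.

Section Kernels.
Context {R : realType} {X : ptopologicalType}.
Variable mu : {measure set (borel X) -> \bar R}.

(** For a nonnegative kernel, the two halves of the condition that its [A_m] norm is at most [c],
    with the essential suprema spelled out as almost everywhere bounds. *)
Definition kernel_bound (m K : X -> X -> R) (c : R) : Prop :=
  {ae mu, forall x, (\int[mu]_y (K x y * m x y)%:E <= c%:E)%E} /\
  {ae mu, forall y, (\int[mu]_x (K x y * m x y)%:E <= c%:E)%E}.

Definition jointly_measurable (K : X -> X -> R) : Prop :=
  measurable_fun setT (fun p : borel X * borel X => K p.1 p.2).

Lemma jointly_measurable_transpose K :
  jointly_measurable K -> jointly_measurable (fun x y => K y x).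
Proof.
move=> mK; exact: (measurableT_comp mK (@measurable_swap _ _ (borel X) (borel X))).
Qed.

Lemma jointly_measurablel K x : jointly_measurable K ->
  measurable_fun setT (K x : borel X -> R).
Proof. by move=> mK; exact: (measurableT_comp mK (@pair1_measurable _ _ (borel X) (borel X) x)). Qed.

Lemma jointly_measurabler K y : jointly_measurable K ->
  measurable_fun setT ((fun x => K x y) : borel X -> R).
Proof. by move=> mK; exact: (measurableT_comp mK (@pair2_measurable _ _ (borel X) (borel X) y)). Qed.

Lemma kernel_bound_transpose (m K : X -> X -> R) c : (forall x y, m x y = m y x) ->
  kernel_bound m K c -> kernel_bound m (fun x y => K y x) c.
Proof.
move=> ms [h1 h2]; split.
  by apply: ae_impl h2 => x; under eq_integral do rewrite ms.
by apply: ae_impl h1 => x; under eq_integral do rewrite ms.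
Qed.

(* [k] is the reproducing kernel, [o] its oscillation; [nk] and [no] bound
   their norms. *)
Record discretization {I : countType} (k : X -> X -> R[i]) (o m : X -> X -> R)
    (z : X) (U : I -> set X) (xs : I -> X) (D Cm nk no : R) (N : nat) : Prop := {
  dz_sigma : sigma_finite setT mu;
  dz_k_meas : cmeasurable setT (fun p : borel X * borel X => k p.1 p.2);
  dz_k_herm : forall x y, k y x = Num.conj (k x y);
  dz_k_bnd : exists2 B : R, 0 <= B & forall x y, normc (k x y) <= B;
  dz_k_rep : forall x y, k x y = cintegral mu setT (fun t => k t y * k x t);
  dz_o_meas : jointly_measurable o;
  dz_o_ge0 : forall x y, 0 <= o x y;
  dz_o_osc : forall i x y w, U i y -> U i w -> normc (k x y - k x w) <= o x y;
  dz_m_meas : jointly_measurable m;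
  dz_m_ge1 : forall x y, 1 <= m x y;
  dz_m_sub : forall x y w, m x y <= m x w * m w y;
  dz_m_sym : forall x y, m x y = m y x;
  dz_U_meas : forall i, measurable (U i : set (borel X));
  dz_U_cov : forall x, exists i, U i x;
  dz_U_fin : forall i, (mu (U i) < +oo)%E;
  dz_D_gt0 : 0 < D;
  dz_U_ge : forall i, (D%:E <= mu (U i))%E;
  dz_U_card : forall x, ([set i | U i x] #<= `I_N)%card;
  dz_Cm : forall i x y, U i x -> U i y -> m x y <= Cm;
  dz_xs : forall i, U i (xs i);
  dz_nk : kernel_bound m (fun x y => normc (k x y)) nk;
  dz_no : kernel_bound m o no }.

End Kernels.

Section Discretization.
Context {R : realType} {X : ptopologicalType} {I : countType} (i0 : I).
Variable mu : {measure set (borel X) -> \bar R}.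
Variables (k : X -> X -> R[i]) (o m : X -> X -> R) (z : X) (U : I -> set X)
  (xs : I -> X) (D Cm nk no : R) (N : nat).
Hypothesis S : discretization mu k o m z U xs D Cm nk no N.

Local Notation v := (fun x => m x z).
Local Notation cmeas F := (cmeasurable setT (F : borel X -> R[i])).
Local Notation muR i := (fine (mu (U i))).

Lemma m_ge0 x y : 0 <= m x y.
Proof. exact: le_trans ler01 (dz_m_ge1 S x y). Qed.

Lemma m_gt0 x y : 0 < m x y.
Proof. exact: lt_le_trans ltr01 (dz_m_ge1 S x y). Qed.

Lemma v_sub x y : v y <= v x * m x y.
Proof. by rewrite mulrC (dz_m_sym S x y); exact: (dz_m_sub S). Qed.

Lemma v_meas : measurable_fun setT (v : borel X -> R).
Proof. exact: jointly_measurabler (dz_m_meas S). Qed.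

Lemma normk_meas : jointly_measurable (fun x y => normc (k x y)).
Proof. exact: cmeas_normc (dz_k_meas S). Qed.

Lemma k_measl x : cmeas (k x).
Proof.
have [h1 h2] := dz_k_meas S; split.
  exact: (@jointly_measurablel _ _ (fun x y => Re (k x y))).
exact: (@jointly_measurablel _ _ (fun x y => Im (k x y))).
Qed.

Lemma k_measr y : cmeas (k^~ y).
Proof.
have -> : k^~ y = (fun x => Num.conj (k y x)) by apply/funext => x; exact: (dz_k_herm S).
by apply: cmeas_conj; exact: k_measl.
Qed.

Lemma normk_sym x y : normc (k x y) = normc (k y x).
Proof. by rewrite (dz_k_herm S y x) normc_conj. Qed.

(** Hermitian symmetry moves the oscillation estimate from the second variable of [k] to the first.
    The bounding function stays [o x y], so it now acts with its variables exchanged. *)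
Lemma normk_osc i x y w : U i y -> U i w -> normc (k y x - k w x) <= o x y.
Proof.
move=> iy iw; apply: le_trans (dz_o_osc S x iy iw).
by rewrite (dz_k_herm S x y) (dz_k_herm S x w) -rmorphB normc_conj.
Qed.

Lemma muR_gt0 i : 0 < muR i.
Proof.
apply: lt_le_trans (dz_D_gt0 S) _; rewrite -lee_fin fineK ?(dz_U_ge S)//.
by rewrite ge0_fin_numE// (dz_U_fin S).
Qed.

Lemma muRE i : mu (U i) = (muR i)%:E.
Proof. by rewrite fineK// ge0_fin_numE// (dz_U_fin S). Qed.

Lemma Cm_ge1 : 1 <= Cm.
Proof. by have := dz_Cm S (dz_xs S i0) (dz_xs S i0); apply: le_trans; exact: (dz_m_ge1 S). Qed.

Lemma Cm_ge0 : 0 <= Cm. Proof. exact: le_trans ler01 Cm_ge1. Qed.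

Lemma v_cover i x y : U i x -> U i y -> v x <= Cm * v y.
Proof.
move=> ix iy; apply: le_trans (dz_m_sub S x z y) _.
by rewrite ler_wpM2r ?m_ge0//; exact: (dz_Cm S ix iy).
Qed.

(** [mu (U i)] is positive, so [U i] cannot lie in a null set. Almost everywhere information is
    turned into information at a point in this way. *)
Lemma ae_exists_U (P : X -> Prop) i : {ae mu, forall x, P x} -> exists2 x, U i x & P x.
Proof.
move=> aP; apply: contrapT => h.
have : mu (U i) = 0%E.
  apply: measure_negligible; first exact: (dz_U_meas S).
  apply: negligibleS aP => x ix Px; apply: h; exists x => //.
by rewrite muRE => /eqP; rewrite eqe gt_eqF// muR_gt0.
Qed.

(* The bound on [k] holds for almost every [x] only; it extends to every [x]
   because some point of the [U i] containing [x] satisfies it. *)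
Lemma kernel_integral_bound : exists2 Ck : R, 0 <= Ck &
  forall x, (\int[mu]_y (normc (k x y) * m x y)%:E <= Ck%:E)%E.
Proof.
have ae2 : {ae mu, forall x,
    (\int[mu]_y (normc (k y x) * m y x)%:E <= nk%:E)%E /\
    (\int[mu]_y (o y x * m y x)%:E <= no%:E)%E}.
  exact: ae_and (dz_nk S).2 (dz_no S).2.
have key x : (\int[mu]_y (normc (k x y) * m x y)%:E <= (Cm * (nk + no))%:E)%E.
  have [i ix] := dz_U_cov S x.
  have [w iw [h1 h2]] := ae_exists_U i ae2.
  have mk := jointly_measurablel w normk_meas.
  have mkr := jointly_measurabler w normk_meas.
  have mor := jointly_measurabler w (dz_o_meas S).
  have mmr := jointly_measurabler w (dz_m_meas S).
  rewrite EFinM; apply: (@le_trans _ _ (\int[mu]_y (Cm * (normc (k y w) * m y w + o y w * m y w))%:E)%E).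
    apply: le_integral_R.
    - by apply: measurable_funM;
        [exact: jointly_measurablel normk_meas|exact: jointly_measurablel (dz_m_meas S)].
    - by apply: measurable_funM => //; apply: measurable_funD; exact: measurable_funM.
    - by move=> y; rewrite mulr_ge0 ?normc_ge0 ?m_ge0.
    - move=> y; rewrite -mulrDl (dz_m_sym S x y) mulrCA.
      apply: ler_pM; rewrite ?normc_ge0 ?m_ge0//.
        rewrite normk_sym; apply: le_trans (lerD (lexx _) (dz_o_osc S y iw ix)).
        by rewrite normcBC addrC -{1}(subrK (k y w) (k y x)) normcD.
      apply: le_trans (dz_m_sub S y x w) _; rewrite mulrC ler_wpM2r ?m_ge0//.
      exact: (dz_Cm S iw ix).
  have f0 y : 0 <= normc (k y w) * m y w by rewrite mulr_ge0 ?normc_ge0 ?m_ge0.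
  have g0 y : 0 <= o y w * m y w by rewrite mulr_ge0 ?(dz_o_ge0 S) ?m_ge0.
  rewrite ge0_integral_RZ ?Cm_ge0//; last 2 first.
  - by apply: measurable_funD; exact: measurable_funM.
  - by move=> y; rewrite addr_ge0.
  rewrite ge0_integral_RD//; try exact: measurable_funM.
  by rewrite EFinD lee_wpmul2l ?lee_fin ?Cm_ge0// leeD.
exists (Cm * (nk + no)) => //; rewrite -lee_fin; apply: le_trans (key z).
by apply: integral_ge0 => y _; rewrite lee_fin mulr_ge0 ?normc_ge0 ?m_ge0.
Qed.

End Discretization.

Section Reproduced.
Context {R : realType} {X : ptopologicalType}.
Variables (mu : {measure set (borel X) -> \bar R}) (k : X -> X -> R[i])
  (m : X -> X -> R) (z : X).

(* The range of the correspondence operators: the reproduced functions that are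
   bounded by the weight [v = m _ z]. *)
Record reproduced (F : X -> R[i]) : Prop := {
  rp_meas : cmeasurable setT (F : borel X -> R[i]);
  rp_bnd : exists2 C, 0 <= C & forall x, normc (F x) <= C * m x z;
  rp_eq : forall x, F x = cintegral mu setT (fun y => F y * k x y) }.

Definition wint (F : X -> R[i]) : \bar R := (\int[mu]_x (normc (F x) * m x z)%:E)%E.

End Reproduced.

Section Reproduction.
Context {R : realType} {X : ptopologicalType} {I : countType} (i0 : I).
Variable mu : {measure set (borel X) -> \bar R}.
Variables (k : X -> X -> R[i]) (o m : X -> X -> R) (z : X) (U : I -> set X)
  (xs : I -> X) (D Cm nk no : R) (N : nat).
Hypothesis S : discretization mu k o m z U xs D Cm nk no N.
Variable Ck : R.
Hypothesis hCk : 0 <= Ck /\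
  forall x, (\int[mu]_y (normc (k x y) * m x y)%:E <= Ck%:E)%E.

Local Notation v := (fun x => m x z).
Local Notation cint := (cintegral mu setT).
Local Notation cmeas F := (cmeasurable setT (F : borel X -> R[i])).
Local Notation smu := (dz_sigma S).
Local Notation Minf := (reproduced mu k m z).
Local Notation wint := (wint mu m z).

Lemma v_ge0 x : 0 <= v x. Proof. exact: (m_ge0 S). Qed.

Lemma normk_meask x : measurable_fun setT ((fun y => normc (k x y)) : borel X -> R).
Proof. exact: cmeas_normc (k_measl S x). Qed.

Lemma wint_ge0 F : (0 <= wint F)%E.
Proof. by apply: integral_ge0 => x _; rewrite lee_fin mulr_ge0 ?normc_ge0 ?v_ge0. Qed.

Lemma wint_meas F : cmeas F ->
  measurable_fun setT ((fun x => normc (F x) * v x) : borel X -> R).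
Proof. by move=> mF; apply: measurable_funM; [exact: cmeas_normc|exact: v_meas S]. Qed.

(** The inequality [v y <= v x * m x y] trades the growth of [F] for the weight in the kernel bound.
    Hence the reproducing integral converges at every point as soon as [F] is bounded by a multiple
    of [v]. *)
Lemma wbound_integral F C x : cmeas F -> 0 <= C -> (forall y, normc (F y) <= C * v y) ->
  (\int[mu]_y (normc (F y) * normc (k x y))%:E <= (C * Ck * v x)%:E)%E.
Proof.
move=> mF C0 FC.
apply: (@le_trans _ _ (\int[mu]_y ((C * v x) * (normc (k x y) * m x y))%:E)%E).
  apply: le_integral_R.
  - by apply: measurable_funM; [exact: cmeas_normc|exact: normk_meask].
  - apply: measurable_funM => //; apply: measurable_funM; first exact: normk_meask.
    exact: jointly_measurablel (dz_m_meas S).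
  - by move=> y; rewrite mulr_ge0 ?normc_ge0.
  - move=> y; rewrite mulrC (mulrCA (C * _)); apply: ler_wpM2l; first exact: normc_ge0.
    apply: le_trans (FC y) _; rewrite -mulrA; apply: ler_wpM2l => //.
    exact: (v_sub S).
rewrite ge0_integral_RZ ?mulr_ge0 ?v_ge0//.
- rewrite mulrAC [X in (_ <= X)%E]EFinM; apply: lee_wpmul2l; last exact: hCk.2.
  by rewrite lee_fin mulr_ge0 ?v_ge0.
- apply: measurable_funM; first exact: normk_meask.
  exact: jointly_measurablel (dz_m_meas S).
- by move=> y; rewrite mulr_ge0 ?normc_ge0// (m_ge0 S).
Qed.

Lemma wbound_cintegrable F x : cmeas F ->
  (exists2 C, 0 <= C & forall y, normc (F y) <= C * v y) ->
  cintegrable mu setT (fun y => F y * k x y).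
Proof.
move=> mF [C C0 FC]; apply/cintegrableP; split.
  by apply: cmeasM => //; exact: k_measl S _.
under eq_integral do rewrite normcM.
by apply: le_lt_trans (wbound_integral x mF C0 FC) _; rewrite ltry.
Qed.

Lemma wbound_cint_le F C x : cmeas F -> 0 <= C -> (forall y, normc (F y) <= C * v y) ->
  normc (cint (fun y => F y * k x y)) <= C * Ck * v x.
Proof.
move=> mF C0 FC; apply: cintegral_le; first by apply: wbound_cintegrable => //; exists C.
by under eq_integral do rewrite normcM; exact: wbound_integral.
Qed.

Lemma reproduced_cintegrable F x : Minf F -> cintegrable mu setT (fun y => F y * k x y).
Proof. by move=> [mF bF _]; exact: wbound_cintegrable. Qed.

Lemma reproduced_lin (a : R[i]) F G : Minf F -> Minf G -> Minf (fun x => a * F x + G x).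
Proof.
move=> MF MG; have [mF [C C0 FC] rF] := MF; have [mG [C' C'0 GC] rG] := MG; split.
- by apply: cmeasD => //; apply: cmeasM => //; exact: cmeas_cst.
- exists (normc a * C + C'); first by rewrite addr_ge0// mulr_ge0 ?normc_ge0.
  move=> x; apply: le_trans (normcD _ _) _; rewrite mulrDl lerD// normcM -mulrA.
  by rewrite ler_wpM2l ?normc_ge0.
- move=> x; rewrite {1}rF {1}rG -cintegralZ; last exact: reproduced_cintegrable.
  rewrite -cintegralD; last 2 first.
  + by apply: cintegrableZ; exact: reproduced_cintegrable.
  + exact: reproduced_cintegrable.
  by congr cintegral; apply/funext => y; rewrite mulrDl mulrA.
Qed.

Lemma reproduced_kernel y : Minf (k^~ y).
Proof.
split; first exact: k_measr S y.
  have [B B0 hB] := dz_k_bnd S; exists B => // x; apply: le_trans (hB _ _) _.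
  by rewrite ler_peMr// (dz_m_ge1 S).
by move=> x; exact: (dz_k_rep S).
Qed.

(** Since [v x <= v y * m y x], the kernel functions, which are the transforms of the atoms, lie in
    [L^1_v] with norms that grow at most like [v]. *)
Lemma wint_kernel y : (wint (k^~ y) <= (Ck * v y)%:E)%E.
Proof.
apply: (@le_trans _ _ (\int[mu]_x (v y * (normc (k y x) * m y x))%:E)%E).
  apply: le_integral_R.
  - exact: wint_meas (k_measr S y).
  - apply: measurable_funM => //; apply: measurable_funM; first exact: normk_meask.
    exact: jointly_measurablel (dz_m_meas S).
  - by move=> x; rewrite mulr_ge0 ?normc_ge0 ?v_ge0.
  - move=> x; rewrite (normk_sym S) mulrCA ler_wpM2l ?normc_ge0//; exact: (v_sub S).
rewrite ge0_integral_RZ ?v_ge0//.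
- by rewrite mulrC [X in (_ <= X)%E]EFinM lee_wpmul2l ?lee_fin ?v_ge0 ?hCk.2.
- apply: measurable_funM; first exact: normk_meask.
  exact: jointly_measurablel (dz_m_meas S).
- by move=> x; rewrite mulr_ge0 ?normc_ge0// (m_ge0 S).
Qed.

(** The transpose of the kernel [o] applied to [|F|]. It is kept in the extended reals, since [o] is
    controlled almost everywhere only and the integral may be infinite at some points. *)
Definition osc_int (F : X -> R[i]) (y : X) : \bar R :=
  (\int[mu]_t (normc (F t) * o t y)%:E)%E.

Lemma osc_int_ge0 F y : (0 <= osc_int F y)%E.
Proof.
by apply: integral_ge0 => t _; rewrite lee_fin mulr_ge0 ?normc_ge0 ?(dz_o_ge0 S).
Qed.

Lemma fst_meas (f : X -> R) : measurable_fun setT (f : borel X -> R) ->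
  jointly_measurable (fun x y => f x).
Proof. by move=> mf; exact: (measurableT_comp mf (@measurable_fst _ _ (borel X) (borel X))). Qed.

Lemma osc_int_meas F : cmeas F -> measurable_fun setT (osc_int F : borel X -> \bar R).
Proof.
move=> mF.
have mp : measurable_fun setT (fun p : borel X * borel X => (normc (F p.2) * o p.2 p.1)%:E).
  apply/measurable_EFinP; apply: measurable_funM.
    exact: (jointly_measurable_transpose (fst_meas (cmeas_normc mF))).
  exact: (jointly_measurable_transpose (dz_o_meas S)).
apply: (measurable_fun_section_integral smu mp) => p.
by rewrite lee_fin mulr_ge0 ?normc_ge0 ?(dz_o_ge0 S).
Qed.

Lemma reproduced_osc F i y w : Minf F -> U i y -> U i w ->
  ((normc (F w - F y))%:E <= osc_int F y)%E.
Proof.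
move=> MF iy iw; rewrite (rp_eq MF w) (rp_eq MF y) -cintegralB; try exact: reproduced_cintegrable.
apply: le_trans (normc_cintegral _) _.
  by apply: cintegrableB; exact: reproduced_cintegrable.
have mF := rp_meas MF.
apply: le_integral_R.
- by apply: cmeas_normc; apply: cmeasB; apply: cmeasM => //; exact: (k_measl S).
- by apply: measurable_funM; [exact: cmeas_normc|exact: jointly_measurabler (dz_o_meas S)].
- by move=> t; rewrite normc_ge0.
- move=> t; rewrite -mulrBr normcM ler_wpM2l ?normc_ge0//.
  by rewrite normcBC; exact: (normk_osc S t iy iw).
Qed.

Lemma reproduced_osc_le F i y w : Minf F -> U i y -> U i w ->
  ((normc (F w))%:E <= (normc (F y))%:E + osc_int F y)%E.
Proof.
move=> MF iy iw; apply: le_trans (leeD (lexx _) (reproduced_osc MF iy iw)).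
by rewrite -EFinD lee_fin addrC -{1}(subrK (F y) (F w)) normcD.
Qed.

(** Schur's test on [L^1_v]: after Tonelli, [v y <= v t * m t y] leaves the inner integral of
    [K t y * m t y], which is at most [c] for almost every [t]. *)
Lemma weighted_kernel_integral (K : X -> X -> R) (g : X -> R) c :
  jointly_measurable K -> (forall x y, 0 <= K x y) ->
  {ae mu, forall t, (\int[mu]_y (K t y * m t y)%:E <= c%:E)%E} -> 0 <= c ->
  measurable_fun setT (g : borel X -> R) -> (forall x, 0 <= g x) ->
  (\int[mu]_y ((\int[mu]_t (g t * K t y)%:E) * (v y)%:E) <=
   c%:E * \int[mu]_t (g t * v t)%:E)%E.
Proof.
move=> mK K0 Kc c0 mg g0.
have mgK : jointly_measurable (fun t y => g t * K t y).
  by apply: measurable_funM => //; exact: fst_meas.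
have mgKv : jointly_measurable (fun t y => g t * K t y * v y).
  apply: measurable_funM => //.
  exact: (jointly_measurable_transpose (fst_meas (v_meas S))).
rewrite [X in (X <= _)%E](_ : _ = \int[mu]_y \int[mu]_t (g t * K t y * v y)%:E)%E; last first.
  apply: eq_integral => y _; rewrite -ge0_integralZTr ?lee_fin ?v_ge0//.
    by apply/measurable_EFinP; exact: (jointly_measurabler y mgK).
  by move=> t; rewrite lee_fin mulr_ge0.
rewrite -(@sigma_finite_tonelli _ _ _ (borel X) (borel X) mu mu smu smu
  (fun p => (g p.1 * K p.1 p.2 * v p.2)%:E)); last 2 first.
- exact/measurable_EFinP.
- by move=> p; rewrite lee_fin mulr_ge0 ?v_ge0// mulr_ge0.
have mv := v_meas S.
have mgv : measurable_fun setT ((fun t => g t * v t) : borel X -> R) by exact: measurable_funM.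
have mKm : jointly_measurable (fun t y => K t y * m t y).
  by apply: measurable_funM => //; exact: (dz_m_meas S).
rewrite -ge0_integral_RZ//; last by move=> x; rewrite mulr_ge0 ?v_ge0.
apply: (@ae_ge0_le_integral _ _ _ mu setT) => //.
- by move=> t _; apply: integral_ge0 => y _; rewrite lee_fin mulr_ge0 ?v_ge0// mulr_ge0.
- apply: (@measurable_fun_section_integral _ _ _ (borel X) (borel X) mu smu
    (fun p => (g p.1 * K p.1 p.2 * v p.2)%:E)); first exact/measurable_EFinP.
  by move=> p; rewrite lee_fin mulr_ge0 ?v_ge0// mulr_ge0.
- by move=> t _; rewrite lee_fin mulr_ge0// mulr_ge0 ?v_ge0.
- by apply/measurable_EFinP; exact: measurable_funM.
apply: ae_impl Kc => t Kt _.
apply: (@le_trans _ _ (\int[mu]_y ((g t * v t) * (K t y * m t y))%:E)%E).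
  apply: le_integral_R.
  - exact: (jointly_measurablel t mgKv).
  - by apply: measurable_funM => //; exact: (jointly_measurablel t mKm).
  - by move=> y; rewrite mulr_ge0 ?v_ge0// mulr_ge0.
  - move=> y; rewrite mulrACA -!mulrA; apply: ler_wpM2l => //.
    apply: ler_wpM2l => //; exact: (v_sub S).
rewrite ge0_integral_RZ//.
- rewrite [X in (_ <= X)%E]EFinM muleC; apply: lee_wpmul2r => //.
  by rewrite lee_fin mulr_ge0 ?v_ge0.
- by rewrite mulr_ge0 ?v_ge0.
- exact: (jointly_measurablel t mKm).
- by move=> y; rewrite mulr_ge0// (m_ge0 S).
Qed.

End Reproduction.

(** * Synthesis and sampling along a covering *)

Section Covering.
Context {R : realType} {X : ptopologicalType} {I : countType} (i0 : I).
Variable mu : {measure set (borel X) -> \bar R}.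
Variables (k : X -> X -> R[i]) (o m : X -> X -> R) (z : X) (U : I -> set X)
  (xs : I -> X) (D Cm nk no : R) (N : nat).
Hypothesis S : discretization mu k o m z U xs D Cm nk no N.
Variable Ck : R.
Hypothesis hCk : 0 <= Ck /\
  forall x, (\int[mu]_y (normc (k x y) * m x y)%:E <= Ck%:E)%E.

Local Notation v := (fun x => m x z).
Local Notation cnt := (@cnt R I i0).
Local Notation smu := (dz_sigma S).
Local Notation muR i := (fine (mu (U i))).
Local Notation Minf := (reproduced mu k m z).
Local Notation wint := (wint mu m z).
Local Notation osc_int := (osc_int mu o).

Lemma finite_U y : finite_set [set i | U i y].
Proof. by apply: (card_le_finite (dz_U_card S y)); exact: finite_II. Qed.

Lemma indicUE i y : (\1_(U i) y : R) = if i \in fset_set [set i | U i y] then 1 else 0.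
Proof.
rewrite in_fset_set; last exact: finite_U.
rewrite indicE; have [iy|iy] := pselect (U i y); first by rewrite !mem_set.
by rewrite !memNset.
Qed.

Lemma cnt_cover y : (\int[cnt]_i (\1_(U i) y)%:E <= (N%:R : R)%:E)%E.
Proof.
under eq_integral do rewrite indicUE.
rewrite integral_cnt_fset// lee_fin big_const_seq count_predT iter_addr addr0 ler_nat.
by apply: geq_card_fset_set; exact: dz_U_card S y.
Qed.

Lemma indicU_meas i : measurable_fun setT (\1_(U i) : borel X -> R).
Proof. exact: measurable_indic (dz_U_meas S i). Qed.

Lemma mu_indicU i : mu (U i) = (\int[mu]_y (\1_(U i) y)%:E)%E.
Proof. by rewrite integral_indic ?setIT//; exact: (dz_U_meas S). Qed.

Lemma no_ge0 : 0 <= no.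
Proof.
have [x _] := ae_exists_U S i0 (dz_no S).1; rewrite -lee_fin; apply: le_trans.
by apply: integral_ge0 => y _; rewrite lee_fin mulr_ge0 ?(dz_o_ge0 S) ?(m_ge0 S).
Qed.

Lemma nk_ge0 : 0 <= nk.
Proof.
have [x _] := ae_exists_U S i0 (dz_nk S).1; rewrite -lee_fin; apply: le_trans.
by apply: integral_ge0 => y _; rewrite lee_fin mulr_ge0 ?normc_ge0 ?(m_ge0 S).
Qed.

Definition sampling_const : R := N%:R * (Cm * (1 + no)).

Lemma sampling_const_ge0 : 0 <= sampling_const.
Proof. by rewrite !mulr_ge0 ?ler0n ?(Cm_ge0 i0 S)// addr_ge0// no_ge0. Qed.

(** Write [muR i] as an integral over [U i]. For [y] in [U i], the sample at [xs i] is at most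
    [|G y|] plus the oscillation bound at [y], and [v (xs i) <= Cm * v y]. After Tonelli each [y] is
    counted at most [N] times; this explains the factors [N], [Cm] and [1 + no]. *)
Lemma sample_sum G : Minf G ->
  (\int[cnt]_i (muR i * v (xs i) * normc (G (xs i)))%:E <= sampling_const%:E * wint G)%E.
Proof.
move=> MG; have mG := rp_meas MG.
pose h y := ((normc (G y))%:E + osc_int G y)%E.
have h0 y : (0 <= h y)%E by rewrite adde_ge0 ?lee_fin ?normc_ge0// (osc_int_ge0 S).
have mh : measurable_fun setT (h : borel X -> \bar R).
  by apply: emeasurable_funD; [exact: cmeas_enormc|exact: (osc_int_meas S)].
have mv := v_meas S.
have v0 y : 0 <= m y z by exact: (m_ge0 S).
have mhv : measurable_fun setT ((fun y => h y * (v y)%:E)%E : borel X -> \bar R).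
  by apply: emeasurable_funM => //; exact/measurable_EFinP.
pose f (i : I) (y : X) : \bar R := ((\1_(U i) y)%:E * (Cm%:E * (h y * (v y)%:E)))%E.
have hv0 y : (0 <= h y * (v y)%:E)%E by rewrite mule_ge0// lee_fin.
have Chv0 y : (0 <= Cm%:E * (h y * (v y)%:E))%E.
  by rewrite mule_ge0// lee_fin (Cm_ge0 i0 S).
have f0 i y : (0 <= f i y)%E by rewrite mule_ge0.
have mChv : measurable_fun setT ((fun y => Cm%:E * (h y * (v y)%:E))%E : borel X -> \bar R).
  exact: emeasurable_funM.
have mf i : measurable_fun setT (f i : borel X -> \bar R).
  by apply: emeasurable_funM => //; apply/measurable_EFinP; exact: indicU_meas.
apply: (@le_trans _ _ (\int[cnt]_i \int[mu]_y f i y)%E).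
  apply: ge0_le_integralT; try exact: measurable_fun_discr.
    by move=> i; rewrite lee_fin !mulr_ge0 ?normc_ge0 ?(m_ge0 S)// ltW// (muR_gt0 S).
  move=> i; rewrite -mulrA EFinM -(muRE S) mu_indicU.
  rewrite -ge0_integralZTr ?lee_fin ?mulr_ge0 ?normc_ge0//; last first.
    by apply/measurable_EFinP; exact: indicU_meas.
  apply: ge0_le_integralT => //.
  - by apply: emeasurable_funM => //; apply/measurable_EFinP; exact: indicU_meas.
  - by move=> y; rewrite mule_ge0 ?lee_fin ?mulr_ge0 ?normc_ge0.
  - move=> y; rewrite /f indicE; case: (boolP (y \in U i)) => [/set_mem iy|_]; last by rewrite !mul0e.
    rewrite !mul1e mulrC EFinM muleCA; apply: lee_pmul; rewrite ?lee_fin ?normc_ge0//.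
      exact: (reproduced_osc_le S hCk MG iy (dz_xs S i)).
    exact: (v_cover S (dz_xs S i) iy).
rewrite (@sigma_finite_tonelli _ _ _ (discr i0) (borel X) cnt mu (sigma_finite_cnt i0) smu
  (fun p => f p.1 p.2)) => //; last first.
  exact: (@measurable_fun_discr_prod I i0 _ _ (borel X) _ f mf).
apply: (@le_trans _ _ (\int[mu]_y ((N%:R * Cm)%:E * (h y * (v y)%:E)))%E).
  apply: ge0_le_integralT.
  - apply: (@measurable_fun_section_integral _ _ _ (borel X) (discr i0) cnt (sigma_finite_cnt i0)
      (fun p => f p.2 p.1)) => //.
    exact: (measurableT_comp (@measurable_fun_discr_prod I i0 _ _ (borel X) _ f mf)
      (@measurable_swap _ _ (borel X) (discr i0))).
  - exact: emeasurable_funM.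
  - by move=> y; apply: integral_ge0.
  - move=> y; rewrite /f /= ge0_integralZTr//.
    by rewrite EFinM -muleA lee_wpmul2r//; exact: cnt_cover.
have NC0 : 0 <= N%:R * Cm by rewrite mulr_ge0 ?ler0n ?(Cm_ge0 i0 S).
rewrite ge0_integralZT//.
have -> : sampling_const = N%:R * Cm * (1 + no) by rewrite /sampling_const mulrA.
rewrite [X in (_ <= X * _)%E]EFinM -muleA lee_wpmul2l ?lee_fin//.
under eq_integral do rewrite /h ge0_muleDl ?lee_fin ?normc_ge0 ?(osc_int_ge0 S)//.
rewrite ge0_integralDT//; last 4 first.
- by apply/measurable_EFinP; exact: (wint_meas S).
- by apply: emeasurable_funM; [exact: (osc_int_meas S)|exact/measurable_EFinP].
- by move=> y; rewrite lee_fin mulr_ge0 ?normc_ge0.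
- by move=> y; rewrite mule_ge0 ?lee_fin// (osc_int_ge0 S).
rewrite EFinD ge0_muleDl ?lee_fin ?no_ge0// mul1e leeD//.
apply: (weighted_kernel_integral S (dz_o_meas S) (dz_o_ge0 S) (dz_no S).1 no_ge0).
  exact: cmeas_normc.
by move=> y; exact: normc_ge0.
Qed.

End Covering.

Section Synthesis.
Context {R : realType} {X : ptopologicalType} {I : countType} (i0 : I).
Variable mu : {measure set (borel X) -> \bar R}.
Variables (k : X -> X -> R[i]) (o m : X -> X -> R) (z : X) (U : I -> set X)
  (xs : I -> X) (D Cm nk no : R) (N : nat).
Hypothesis S : discretization mu k o m z U xs D Cm nk no N.
Variable Ck : R.
Hypothesis hCk : 0 <= Ck /\
  forall x, (\int[mu]_y (normc (k x y) * m x y)%:E <= Ck%:E)%E.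

Local Notation v := (fun x => m x z).
Local Notation cint := (cintegral mu setT).
Local Notation cmeas F := (cmeasurable setT (F : borel X -> R[i])).
Local Notation cnt := (@cnt R I i0).
Local Notation smu := (dz_sigma S).
Local Notation muR i := (fine (mu (U i))).
Local Notation Minf := (reproduced mu k m z).
Local Notation wint := (wint mu m z).
Local Notation Cs := (sampling_const Cm no N).

(** The growth condition dual to [sample_sum]: such coefficients are absolutely summable against the
    samples of any reproduced function in [L^1_v]. Taking kernel functions for these, [synth]
    converges absolutely at every point. *)
Definition coef_bound (C : R) (c : I -> R[i]) : Prop :=
  0 <= C /\ forall i, normc (c i) <= C * (muR i * v (xs i)).

Definition synth (c : I -> R[i]) (x : X) : R[i] :=
  cintegral cnt setT (fun i => c i * k x (xs i)).

Lemma coef_sum C c G : coef_bound C c -> Minf G ->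
  (\int[cnt]_i (normc (c i) * normc (G (xs i)))%:E <= (C * Cs)%:E * wint G)%E.
Proof.
move=> [C0 hc] MG.
have w0 i : 0 <= muR i * v (xs i) * normc (G (xs i)).
  by rewrite !mulr_ge0 ?normc_ge0 ?(m_ge0 S)// ltW// (muR_gt0 S).
apply: (@le_trans _ _ (\int[cnt]_i (C * (muR i * v (xs i) * normc (G (xs i))))%:E)%E).
  apply: le_integral_R; try exact: measurable_fun_discr.
    by move=> i; rewrite mulr_ge0 ?normc_ge0.
  by move=> i; rewrite mulrA ler_wpM2r ?normc_ge0.
rewrite ge0_integral_RZ// EFinM -muleA lee_wpmul2l ?lee_fin//.
exact: (sample_sum i0 S hCk MG).
Qed.

Lemma coef_sum_kernel C c x : coef_bound C c ->
  (\int[cnt]_i (normc (c i) * normc (k x (xs i)))%:E <= (C * Cs * Ck * v x)%:E)%E.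
Proof.
move=> hc; under eq_integral do rewrite (normk_sym S).
apply: le_trans (coef_sum hc (reproduced_kernel S x)) _.
rewrite -mulrA (EFinM (C * Cs)) lee_wpmul2l ?lee_fin ?(wint_kernel S hCk)//.
by rewrite mulr_ge0 ?(sampling_const_ge0 i0 S)//; case: hc.
Qed.

Lemma coef_const_ge0 C c : coef_bound C c -> 0 <= C * Cs * Ck.
Proof.
move=> [C0 _]; have [Ck0 _] := hCk; apply: mulr_ge0 => //; apply: mulr_ge0 => //.
exact: (sampling_const_ge0 i0 S).
Qed.

Lemma synth_cintegrable C c x : coef_bound C c ->
  cintegrable cnt setT (fun i => c i * k x (xs i)).
Proof.
move=> hc; apply/cintegrableP; split; first exact: cmeasurable_discr.
under eq_integral do rewrite normcM.
by apply: le_lt_trans (coef_sum_kernel x hc) _; rewrite ltry.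
Qed.

Lemma synth_le C c x : coef_bound C c -> normc (synth c x) <= C * Cs * Ck * v x.
Proof.
move=> hc; apply: cintegral_le; first exact: synth_cintegrable hc.
by under eq_integral do rewrite normcM; exact: coef_sum_kernel.
Qed.

Lemma synth_meas c : cmeas (synth c).
Proof.
apply: (@cmeas_section_cintegral _ _ _ (borel X) (discr i0) cnt (sigma_finite_cnt i0)
  (fun x i => c i * k x (xs i))).
have mf : cmeasurable setT (fun p : discr i0 * borel X => c p.1 * k p.2 (xs p.1)).
  apply: (@cmeasurable_discr_prod R I i0 _ (borel X) (fun i x => c i * k x (xs i))) => i.
  by apply: cmeasM; [exact: cmeas_cst|exact: (k_measr S)].
by split; [exact: (measurableT_comp mf.1 (@measurable_swap _ _ (borel X) (discr i0)))|
           exact: (measurableT_comp mf.2 (@measurable_swap _ _ (borel X) (discr i0)))].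
Qed.

(** Synthesis is adjoint to sampling: integrating term by term, the pairing of [k y (xs i)] with [G]
    is the conjugate of [G (xs i)], by the reproducing formula and Hermitian symmetry. The symmetry
    of [frame_sum] rests on this. *)
Lemma synth_pairing C c G : coef_bound C c -> Minf G -> (wint G < +oo)%E ->
  cint (fun y => synth c y * Num.conj (G y)) =
  cintegral cnt setT (fun i => c i * Num.conj (G (xs i))).
Proof.
move=> hc MG Gi; have mG := rp_meas MG.
pose f (i : I) (y : X) := c i * k y (xs i) * Num.conj (G y).
have mf i : cmeas (f i).
  by apply: cmeasM; [apply: cmeasM; [exact: cmeas_cst|exact: (k_measr S)]|exact: cmeas_conj].
have mF : cmeasurable setT (fun p : discr i0 * borel X => f p.1 p.2).
  exact: (@cmeasurable_discr_prod R I i0 _ (borel X) f).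
have C0 := coef_const_ge0 hc.
have f2 y : cintegrable cnt setT (f ^~ y).
  have /(cintegrableZ (Num.conj (G y))) := synth_cintegrable y hc.
  by under eq_fun do rewrite mulrC.
have f1 i : cintegrable mu setT (f i).
  have [B B0 hB] := dz_k_bnd S.
  apply: (@le_cintegrable _ _ (borel X) mu (f i) (fun y => (normc (c i) * B * (normc (G y) * v y))%:E)) => //.
  - apply/measurable_EFinP; apply: measurable_funM => //; exact: (wint_meas S).
  - move=> y; rewrite lee_fin !normcM normc_conj; apply: ler_pM; rewrite ?mulr_ge0 ?normc_ge0//.
      by rewrite ler_wpM2l ?normc_ge0.
    by rewrite ler_peMr ?normc_ge0// (dz_m_ge1 S).
  - rewrite ge0_integral_RZ; first by rewrite lte_mul_pinfty// lee_fin mulr_ge0 ?normc_ge0.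
    + by rewrite mulr_ge0 ?normc_ge0.
    + exact: (wint_meas S).
    + by move=> y; rewrite mulr_ge0 ?normc_ge0 ?(m_ge0 S).
transitivity (cintegral mu setT (fun y => cintegral cnt setT (f ^~ y))).
  congr cintegral; apply/funext => y; rewrite mulrC -cintegralZ; last exact: synth_cintegrable hc.
  by congr cintegral; apply/funext => i; rewrite mulrC.
rewrite -(@sigma_finite_cfubini _ _ _ (discr i0) (borel X) cnt mu (sigma_finite_cnt i0) smu f)//.
  congr cintegral; apply/funext => i; rewrite (rp_eq MG (xs i)).
  rewrite -cintegral_conj; last exact: (reproduced_cintegrable S hCk).
  rewrite -cintegralZ; last by apply: cintegrable_conj; exact: (reproduced_cintegrable S hCk).
  congr cintegral; apply/funext => y; rewrite conjCM -(dz_k_herm S).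
  by rewrite /f -mulrA (mulrC (k _ _)).
have mFn : measurable_fun setT (fun p : discr i0 * borel X => (normc (f p.1 p.2))%:E).
  exact: cmeas_enormc mF.
rewrite (@sigma_finite_tonelli _ _ _ (discr i0) (borel X) cnt mu (sigma_finite_cnt i0) smu
  (fun p => (normc (f p.1 p.2))%:E))//; last by move=> p; rewrite lee_fin normc_ge0.
apply: (@le_lt_trans _ _ (\int[mu]_y (C * Cs * Ck * (normc (G y) * v y))%:E)%E); last first.
  rewrite ge0_integral_RZ//; first by rewrite lte_mul_pinfty.
    exact: (wint_meas S).
  by move=> y; rewrite mulr_ge0 ?normc_ge0 ?(m_ge0 S).
apply: ge0_le_integralT.
- apply: (@measurable_fun_section_integral _ _ _ (borel X) (discr i0) cnt (sigma_finite_cnt i0)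
    (fun p => (normc (f p.2 p.1))%:E)).
    exact: (measurableT_comp mFn (@measurable_swap _ _ (borel X) (discr i0))).
  by move=> p; rewrite lee_fin normc_ge0.
- by apply/measurable_EFinP; apply: measurable_funM => //; exact: (wint_meas S).
- by move=> y; apply: integral_ge0 => i _; rewrite lee_fin normc_ge0.
- move=> y /=.
  rewrite (_ : integral _ _ _ =
      (\int[cnt]_i (normc (G y) * (normc (c i) * normc (k y (xs i))))%:E)%E); last first.
    by apply: eq_integral => i _; rewrite /f !normcM normc_conj mulrC.
  rewrite ge0_integral_RZ ?normc_ge0//; last by move=> i; rewrite mulr_ge0 ?normc_ge0.
  rewrite mulrCA EFinM lee_wpmul2l ?lee_fin ?normc_ge0//.
  exact: coef_sum_kernel.
Qed.

(** With [G] the kernel function at [x], the pairing formula becomes the reproducing formula for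
    [synth c] at [x]. *)
Lemma synth_reproduced C c : coef_bound C c -> Minf (synth c).
Proof.
move=> hc; split; first exact: synth_meas.
  exists (C * Cs * Ck); last by move=> x; exact: synth_le.
  exact: coef_const_ge0 hc.
move=> x; transitivity (cintegral cnt setT (fun i => c i * Num.conj (k (xs i) x))).
  by congr cintegral; apply/funext => i; rewrite (dz_k_herm S (xs i) x).
rewrite -(synth_pairing hc (reproduced_kernel S x)).
  by congr cintegral; apply/funext => y; rewrite (dz_k_herm S y x).
by apply: le_lt_trans (wint_kernel S hCk x) _; rewrite ltry.
Qed.

End Synthesis.

Section FunctionSpace.
Context {R : realType} {X : ptopologicalType}.
Variables (mu : {measure set (borel X) -> \bar R}) (k : X -> X -> R[i])
  (m : X -> X -> R) (z : X).

(* What the discretization argument uses of the solid space [Y]; the weighted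
   space of integrable functions is the other instance. *)
Record function_space (B : set (X -> R[i])) (NB : (X -> R[i]) -> R) : Prop := {
  fs_0 : B (fun=> 0);
  fs_lin : forall a f g, B f -> B g -> B (fun x => a * f x + g x);
  fs_ge0 : forall f, B f -> 0 <= NB f;
  fs_normZ : forall a f, B f -> NB (fun x => a * f x) = normc a * NB f;
  fs_normD : forall f g, B f -> B g -> NB (fun x => f x + g x) <= NB f + NB g;
  fs_meas : forall f, B f -> cmeasurable setT (f : borel X -> R[i]);
  fs_dom : forall F0 F1 F2 (K1 K2 : X -> X -> R) c1 c2 F, B F0 -> B F1 -> B F2 ->
    jointly_measurable K1 -> (forall x y, 0 <= K1 x y) -> kernel_bound mu m K1 c1 ->
    jointly_measurable K2 -> (forall x y, 0 <= K2 x y) -> kernel_bound mu m K2 c2 ->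
    cmeasurable setT (F : borel X -> R[i]) ->
    (forall x, ((normc (F x))%:E <= (normc (F0 x))%:E +
      (\int[mu]_y (normc (F1 y) * K1 x y)%:E +
       \int[mu]_y (normc (F2 y) * K2 x y)%:E))%E) ->
    B F /\ NB F <= NB F0 + (c1 * NB F1 + c2 * NB F2);
  fs_complete : forall (u : nat -> X -> R[i]) F, (forall n, B (u n)) ->
    (forall eps : R, 0 < eps -> exists n0 : nat, forall p q : nat,
       (n0 <= p)%N -> (n0 <= q)%N -> NB (fun x => u p x - u q x) < eps) ->
    (forall x, (fun n => normc (u n x - F x)) @ \oo --> (0 : R)) ->
    B F /\ (fun n => NB (fun x => u n x - F x)) @ \oo --> (0 : R);
  fs_pointwise : exists2 C, 0 <= C & forall F, reproduced mu k m z F -> B F ->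
    forall x, normc (F x) <= C * m x z * NB F }.

End FunctionSpace.

Section StepFunctions.
Context {R : realType} {X : ptopologicalType} {I : countType} (i0 : I).
Variable mu : {measure set (borel X) -> \bar R}.
Variables (k : X -> X -> R[i]) (o m : X -> X -> R) (z : X) (U : I -> set X)
  (xs : I -> X) (D Cm nk no : R) (N : nat).
Hypothesis S : discretization mu k o m z U xs D Cm nk no N.

Local Notation cmeas F := (cmeasurable setT (F : borel X -> R[i])).
Local Notation cnt := (@cnt R I i0).
Local Notation step := (step_fun U).

(** As counting integrals, step functions come under Tonelli's theorem; their measurability and
    their interchange with integrals over [X] follow. *)
Lemma step_sum (w : I -> R) c y : (forall i, 0 <= w i) ->
  ((normc (step w c y))%:E = \int[cnt]_i (normc (c i) * w i * \1_(U i) y)%:E)%E.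
Proof.
move=> w0; rewrite /step_fun fsbig_finite; last exact: finite_U S y.
have s0 : 0 <= \sum_(i <- fset_set [set i | U i y]) (normc (c i) * w i).
  by apply: sumr_ge0 => i _; rewrite mulr_ge0 ?normc_ge0.
rewrite normc_ge0_real// -(integral_cnt_fset i0); last first.
  by move=> i; rewrite mulr_ge0 ?normc_ge0.
apply: eq_integral => i _; rewrite (indicUE S).
by case: ifP; rewrite ?mulr1 ?mulr0.
Qed.

Lemma step_ge0 (w : I -> R) c y : (forall i, 0 <= w i) -> (normc (step w c y))%:C = step w c y.
Proof.
move=> w0; rewrite /step_fun fsbig_finite; last exact: finite_U S y.
rewrite normc_ge0_real//.
by apply: sumr_ge0 => i _; rewrite mulr_ge0 ?normc_ge0.
Qed.

Lemma cover_family_meas (a : I -> R) :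
  measurable_fun setT (fun p : borel X * discr i0 => (a p.2 * \1_(U p.2) p.1)%:E).
Proof.
have mf : measurable_fun setT (fun p : discr i0 * borel X => (a p.1 * \1_(U p.1) p.2)%:E).
  apply: (@measurable_fun_discr_prod I i0 _ _ (borel X) _
    (fun i y => (a i * \1_(U i) y)%:E)) => i.
  by apply/measurable_EFinP; apply: measurable_funM => //; exact: (indicU_meas S).
exact: (measurableT_comp mf (@measurable_swap _ _ (borel X) (discr i0))).
Qed.

Lemma step_meas (w : I -> R) c : (forall i, 0 <= w i) -> cmeas (step w c).
Proof.
move=> w0; have -> : step w c = (fun y =>
    (fine (\int[cnt]_i (normc (c i) * w i * \1_(U i) y)%:E)%E)%:C).
  by apply/funext => y; rewrite -step_sum//= step_ge0.
apply: cmeas_real; apply: (measurableT_comp (fine_measurable _)) => //.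
apply: (@measurable_fun_section_integral _ _ _ (borel X) (discr i0) cnt (sigma_finite_cnt i0)
  (fun p => (normc (c p.2) * w p.2 * \1_(U p.2) p.1)%:E)).
  exact: (cover_family_meas (fun i => normc (c i) * w i)).
by move=> p; rewrite lee_fin !mulr_ge0 ?normc_ge0.
Qed.

(** The index with the least code is taken, so the cell of [i] is [U i] without the earlier covering
    sets, a measurable set; an arbitrary choice of indices would not ensure measurability. *)
Lemma cover_index : exists iota : X -> I, (forall y, U (iota y) y) /\
  forall i, measurable ([set y | iota y = i] : set (borel X)).
Proof.
have h y : exists i, U i y /\ forall j, U j y -> (choice.pickle i <= choice.pickle j)%N.
  have [j0 Uj0] := dz_U_cov S y.
  have ex : exists n, `[< exists2 i, choice.pickle i = n & U i y >].
    by exists (choice.pickle j0); apply/asboolP; exists j0.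
  case: (ex_minnP ex) => n /asboolP[i <- iy] hn; exists i; split => // j jy.
  by apply: hn; apply/asboolP; exists j.
have [iota hi] := choice h.
exists iota; split=> [y|i]; first by case: (hi y).
pose V j := if (choice.pickle j < choice.pickle i)%N then U j else set0.
have -> : [set y | iota y = i] = U i `&` ~` (\bigcup_(j in [set: I]) V j).
  apply/seteqP; split => y /=.
    move=> iE; split; first by rewrite -iE; case: (hi y).
    move=> [j _]; rewrite /V; case: ifPn => // ji jy.
    by have := (hi y).2 j jy; rewrite iE leqNgt ji.
  move=> [iy nV]; apply: (pcan_inj choice.pickleK); apply/eqP; rewrite eqn_leq.
  rewrite (hi y).2//= leqNgt; apply/negP => lt; apply: nV; exists (iota y) => //.
  by rewrite /V lt; exact: (hi y).1.
apply: measurableI; first exact: (dz_U_meas S).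
apply: measurableC; apply: countable_bigcupT_measurable; first exact: countableP.
by move=> j; rewrite /V; case: ifP => // _; exact: (dz_U_meas S).
Qed.

End StepFunctions.

Section Cells.
Context {R : realType} {X : ptopologicalType} {I : countType} (i0 : I).
Variable mu : {measure set (borel X) -> \bar R}.
Variables (k : X -> X -> R[i]) (o m : X -> X -> R) (z : X) (U : I -> set X)
  (xs : I -> X) (D Cm nk no : R) (N : nat).
Hypothesis S : discretization mu k o m z U xs D Cm nk no N.

Local Notation cint := (cintegral mu setT).
Local Notation cmeas F := (cmeasurable setT (F : borel X -> R[i])).
Local Notation cnt := (@cnt R I i0).
Local Notation smu := (dz_sigma S).
Local Notation muR i := (fine (mu (U i))).
Variable iota : X -> I.
Hypothesis hi : (forall y, U (iota y) y) /\
  forall i, measurable ([set y | iota y = i] : set (borel X)).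
Local Notation V i := ([set y | iota y = i]).

Definition cell_mass (i : I) : R := fine (mu (V i)).
Local Notation cw := cell_mass.

Lemma cellE i : mu (V i) = (cw i)%:E.
Proof.
rewrite fineK// ge0_fin_numE//; apply: le_lt_trans (dz_U_fin S i).
apply: le_measure; rewrite ?inE; [exact: hi.2|exact: (dz_U_meas S)|].
by move=> y /= <-; exact: hi.1.
Qed.

Lemma cell_mass_ge0 i : 0 <= cw i.
Proof. exact: fine_ge0. Qed.

Lemma cell_mass_le i : cw i <= muR i.
Proof.
rewrite -lee_fin -cellE -(muRE S).
apply: le_measure; rewrite ?inE; [exact: hi.2|exact: (dz_U_meas S)|].
by move=> y /= <-; exact: hi.1.
Qed.

Lemma cell_indic i : (\int[mu]_y (\1_(V i) y : R)%:E = (cw i)%:E)%E.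
Proof. by rewrite integral_indic ?setIT ?cellE//; exact: hi.2. Qed.

Lemma iota_meas : measurable_fun setT (iota : borel X -> discr i0).
Proof.
move=> _ A _; rewrite setTI.
have -> : iota @^-1` A = \bigcup_(i in [set: I]) (if i \in A then V i else set0).
  apply/seteqP; split => y /=.
    by move=> Ay; exists (iota y) => //; rewrite mem_set.
  by move=> [i _]; case: (boolP (i \in A)) => // /set_mem Ai /= ->.
apply: countable_bigcupT_measurable; first exact: countableP.
by move=> i; case: ifP => // _; exact: hi.2.
Qed.

Lemma iota_comp_meas (h : I -> R[i]) : cmeas (h \o iota).
Proof.
by split; apply: (measurableT_comp (f := (fun i => _ (h i)) : discr i0 -> R) _ iota_meas);
  exact: measurable_fun_discr.
Qed.

Lemma iota_integral (g : I -> R) : (forall i, 0 <= g i) ->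
  (\int[mu]_y (g (iota y))%:E = \int[cnt]_i (cw i * g i)%:E)%E.
Proof.
move=> g0; pose f (i : I) (y : X) := (g i * \1_(V i) y)%:E : \bar R.
have mI i : measurable_fun setT (\1_(V i) : borel X -> R).
  by apply: measurable_indic; exact: hi.2.
have f0 i y : (0 <= f i y)%E by rewrite lee_fin mulr_ge0.
transitivity (\int[mu]_y \int[cnt]_i f i y)%E.
  apply: eq_integral => y _.
  transitivity (\int[cnt]_i (if i \in [fset (iota y)]%fset then g i else 0)%:E)%E.
    by rewrite integral_cnt_fset// big_seq_fset1.
  apply: eq_integral => i _; rewrite /f indicE inE.
  case: eqVneq => [->|ni]; first by rewrite mem_set// mulr1.
  by rewrite memNset ?mulr0// => /= /esym /eqP; rewrite (negbTE ni).
rewrite -(@sigma_finite_tonelli _ _ _ (discr i0) (borel X) cnt mu (sigma_finite_cnt i0) smu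
  (fun p => f p.1 p.2))//; last first.
  apply: (@measurable_fun_discr_prod I i0 _ _ (borel X) _ f) => i.
  by apply/measurable_EFinP; apply: measurable_funM.
apply: eq_integral => i _; rewrite /f /= ge0_integral_RZ//.
by rewrite cell_indic mulrC.
Qed.

(** The function [h \o iota] is the series of the [h i] times the indicators of the cells, and
    Fubini integrates it term by term. *)
Lemma iota_cintegral (h : I -> R[i]) :
  (\int[cnt]_i (cw i * normc (h i))%:E < +oo)%E ->
  cintegrable mu setT (fun y => h (iota y)) /\
  cint (fun y => h (iota y)) = cintegral cnt setT (fun i => (cw i)%:C * h i).
Proof.
move=> hfin; split.
  apply/cintegrableP; split; first exact: iota_comp_meas.
  by rewrite (iota_integral (g := fun i => normc (h i)))// => i; exact: normc_ge0.
pose f (i : I) (y : X) := if i == iota y then h i else 0.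
have fE i y : f i y = (\1_(V i) y : R)%:C * h i.
  rewrite /f indicE; case: eqVneq => [->|ni]; first by rewrite mem_set// mul1r.
  by rewrite memNset ?mul0r// => /= /esym /eqP; rewrite (negbTE ni).
have mI i : measurable_fun setT (\1_(V i) : borel X -> R).
  by apply: measurable_indic; exact: hi.2.
have iI i : cintegrable mu setT (fun y => (\1_(V i) y : R)%:C).
  apply/cintegrableP; split; first exact: cmeas_real.
  rewrite (_ : integral _ _ _ = (cw i)%:E) ?ltry//.
  by rewrite -cell_indic; apply: eq_integral => y _; rewrite normc_ge0_real.
have f1 i : cintegrable mu setT (f i).
  have -> : f i = (fun y => h i * (\1_(V i) y : R)%:C) by apply/funext => y; rewrite fE mulrC.
  exact: cintegrableZ.
have fE2 y : f ^~ y = (fun i => if i == iota y then h (iota y) else 0).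
  by apply/funext => i; rewrite /f; case: eqVneq => [->|].
have f2 y : cintegrable cnt setT (f ^~ y) by rewrite fE2; exact: cintegrable_cnt_single.
have If i : cint (f i) = (cw i)%:C * h i.
  have -> : f i = (fun y => h i * (\1_(V i) y : R)%:C) by apply/funext => y; rewrite fE mulrC.
  rewrite cintegralZ// mulrC; congr (_ * _); apply: complexP => /=.
    by rewrite /Rintegral cell_indic.
  by rewrite /Rintegral integral0_eq.
transitivity (cint (fun y => cintegral cnt setT (f ^~ y))).
  by congr cintegral; apply/funext => y; rewrite fE2 cintegral_cnt_single.
rewrite -(@sigma_finite_cfubini _ _ _ (discr i0) (borel X) cnt mu (sigma_finite_cnt i0) smu f)//.
- by congr cintegral; apply/funext => i; exact: If.
- apply: (@cmeasurable_discr_prod R I i0 _ (borel X) f) => i.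
  exact: cintegrable_meas (f1 i).
- rewrite (_ : integral _ _ _ = \int[cnt]_i (cw i * normc (h i))%:E)%E//.
  apply: eq_integral => i _.
  rewrite (_ : integral _ _ _ = \int[mu]_y (normc (h i) * \1_(V i) y)%:E)%E; last first.
    by apply: eq_integral => y _; rewrite fE normcM normc_ge0_real// mulrC.
  rewrite ge0_integral_RZ ?normc_ge0//.
  by rewrite cell_indic mulrC.
Qed.

End Cells.

Section Domination.
Context {R : realType} {X : ptopologicalType} {I : countType} (i0 : I).
Variable mu : {measure set (borel X) -> \bar R}.
Variables (k : X -> X -> R[i]) (o m : X -> X -> R) (z : X) (U : I -> set X)
  (xs : I -> X) (D Cm nk no : R) (N : nat).
Hypothesis S : discretization mu k o m z U xs D Cm nk no N.
Variable Ck : R.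
Hypothesis hCk : 0 <= Ck /\
  forall x, (\int[mu]_y (normc (k x y) * m x y)%:E <= Ck%:E)%E.

Local Notation cmeas F := (cmeasurable setT (F : borel X -> R[i])).
Local Notation cnt := (@cnt R I i0).
Local Notation smu := (dz_sigma S).
Local Notation muR i := (fine (mu (U i))).
Local Notation Minf := (reproduced mu k m z).
Local Notation osc_int := (osc_int mu o).
Local Notation synth := (synth i0 k xs).
Local Notation coef_bound := (coef_bound mu m z U xs).
Local Notation step := (step_fun U).
Variables (B : set (X -> R[i])) (NB : (X -> R[i]) -> R).
Hypothesis hB : function_space mu k m z B NB.

Lemma space_norm0 : NB (fun=> 0) = 0.
Proof.
by have := fs_normZ hB 0 (fs_0 hB); rewrite normc00 !mul0r.
Qed.

Lemma spaceZ a F : B F -> B (fun x => a * F x).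
Proof.
move=> BF; have := fs_lin hB a BF (fs_0 hB).
by congr B; apply/funext => x; rewrite addr0.
Qed.

Lemma spaceD F G : B F -> B G -> B (fun x => F x + G x).
Proof.
move=> BF BG; have := fs_lin hB 1 BF BG.
by congr B; apply/funext => x; rewrite mul1r.
Qed.

Lemma spaceN F : B F -> B (fun x => - F x).
Proof.
by move=> /(spaceZ (-1)); congr B; apply/funext => x; rewrite mulN1r.
Qed.

Lemma spaceB F G : B F -> B G -> B (fun x => F x - G x).
Proof. by move=> BF /spaceN BG; exact: spaceD. Qed.

Lemma space_normN F : B F -> NB (fun x => - F x) = NB F.
Proof.
move=> BF; have := fs_normZ hB (-1) BF; rewrite normcN Normc.normc1 mul1r => <-.
by congr NB; apply/funext => x; rewrite mulN1r.
Qed.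

Lemma space_dist_triangle F G H : B F -> B G -> B H ->
  NB (fun x => F x - H x) <= NB (fun x => F x - G x) + NB (fun x => G x - H x).
Proof.
move=> BF BG BH; apply: le_trans (fs_normD hB (spaceB BF BG) (spaceB BG BH)).
by rewrite le_eqVlt; apply/orP; left; apply/eqP; congr NB; apply/funext => x; rewrite addrA subrK.
Qed.

Lemma o_bound : kernel_bound mu m o no. Proof. exact: dz_no S. Qed.

Lemma oT_bound : kernel_bound mu m (fun x y => o y x) no.
Proof. by apply: kernel_bound_transpose; [exact: dz_m_sym S|exact: o_bound]. Qed.

Lemma oT_meas : jointly_measurable (fun x y => o y x).
Proof. exact: jointly_measurable_transpose (dz_o_meas S). Qed.

(* The two shapes of domination that occur: by [|F0| + o^*|F1|] and by
   [|k||F1| + o'|F2|] with [o'] either [o] or its transpose. *)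
Lemma dominated_osc F0 F1 F : B F0 -> B F1 -> cmeas F ->
  (forall x, ((normc (F x))%:E <= (normc (F0 x))%:E + osc_int F1 x)%E) ->
  B F /\ NB F <= NB F0 + no * NB F1.
Proof.
move=> B0 B1 mF h.
have [|BF] := fs_dom hB B0 B1 (fs_0 hB) oT_meas (fun x y => dz_o_ge0 S y x) oT_bound
  oT_meas (fun x y => dz_o_ge0 S y x) oT_bound mF.
  move=> x; apply: le_trans (h x) _; rewrite leeD2l// leeDl//.
  by apply: integral_ge0 => y _; rewrite lee_fin mulr_ge0 ?normc_ge0 ?(dz_o_ge0 S).
by rewrite space_norm0 mulr0 addr0.
Qed.

Lemma dominated_kernel F1 F2 F (o' : X -> X -> R) : B F1 -> B F2 ->
  jointly_measurable o' -> (forall x y, 0 <= o' x y) -> kernel_bound mu m o' no ->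
  cmeas F ->
  (forall x, ((normc (F x))%:E <= \int[mu]_y (normc (F1 y) * normc (k x y))%:E +
       \int[mu]_y (normc (F2 y) * o' x y)%:E)%E) ->
  B F /\ NB F <= nk * NB F1 + no * NB F2.
Proof.
move=> B1 B2 mo o0 ob mF h.
have [|BF] := fs_dom hB (fs_0 hB) B1 B2 (normk_meas S) (fun x y => normc_ge0 (k x y)) (dz_nk S)
  mo o0 ob mF.
  by move=> x; rewrite normc00 add0e.
by rewrite space_norm0 add0r.
Qed.

Lemma solid F0 F : B F0 -> cmeas F -> (forall x, normc (F x) <= normc (F0 x)) ->
  B F /\ NB F <= NB F0.
Proof.
move=> B0 mF h; have [|BF] := dominated_osc B0 (fs_0 hB) mF.
  move=> x; apply: (@le_trans _ _ (normc (F0 x))%:E); first by rewrite lee_fin.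
  by rewrite leeDl// (osc_int_ge0 S).
by rewrite space_norm0 mulr0 addr0.
Qed.

(** For [y] in [U i] one has [|k x (xs i)| <= |k x y| + o x y]. Averaging over [U i] replaces the
    series by the kernel [|k| + o] applied to the step function with heights [|c i| / muR i]; this
    is where the weight of [Y^natural] comes from. *)
Lemma synth_space C c : coef_bound C c -> B (step (fun i => (muR i)^-1) c) ->
  B (synth c) /\ NB (synth c) <= (nk + no) * NB (step (fun i => (muR i)^-1) c).
Proof.
move=> hc Bs; set s := step _ c in Bs *.
have w0 i : 0 <= (muR i)^-1 by rewrite invr_ge0 ltW// (muR_gt0 S).
rewrite mulrDl; apply: (dominated_kernel Bs Bs (dz_o_meas S) (dz_o_ge0 S) o_bound).
  exact: (synth_meas i0 S).
move=> x.
apply: le_trans (normc_cintegral (synth_cintegrable i0 S hCk x hc)) _.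
have mko : measurable_fun setT ((fun y => normc (k x y) + o x y) : borel X -> R).
  by apply: measurable_funD; [exact: (normk_meask S)|exact: jointly_measurablel (dz_o_meas S)].
have ko0 y : 0 <= normc (k x y) + o x y by rewrite addr_ge0 ?normc_ge0 ?(dz_o_ge0 S).
pose a i := normc (c i) * (muR i)^-1.
have a0 i : 0 <= a i by rewrite mulr_ge0 ?normc_ge0.
pose f (i : I) (y : X) : \bar R := (a i * \1_(U i) y * (normc (k x y) + o x y))%:E.
have aU0 i y : 0 <= a i * \1_(U i) y by apply: mulr_ge0.
have f0 i y : (0 <= f i y)%E by rewrite lee_fin; apply: mulr_ge0.
have mfR i : measurable_fun setT
    ((fun y => a i * \1_(U i) y * (normc (k x y) + o x y)) : borel X -> R).
  apply: measurable_funM => //; apply: measurable_funM => //.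
  exact: (indicU_meas S).
have mf i : measurable_fun setT (f i : borel X -> \bar R) by exact/measurable_EFinP.
apply: (@le_trans _ _ (\int[cnt]_i \int[mu]_y f i y)%E).
  apply: ge0_le_integralT; try exact: measurable_fun_discr.
    by move=> i; rewrite lee_fin normc_ge0.
  move=> i; rewrite normcM.
  have -> : (normc (c i) * normc (k x (xs i)))%:E =
      (\int[mu]_y (a i * normc (k x (xs i)) * \1_(U i) y)%:E)%E.
    rewrite ge0_integral_RZ ?mulr_ge0 ?normc_ge0//; last exact: (indicU_meas S).
    rewrite -(mu_indicU S) (muRE S) -EFinM /a mulrAC; congr EFin.
    by rewrite mulfVK// gt_eqF// (muR_gt0 S).
  apply: le_integral_R.
  - by apply: measurable_funM => //; exact: (indicU_meas S).
  - exact: mfR.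
  - by move=> y; rewrite !mulr_ge0 ?normc_ge0.
  - move=> y; rewrite mulrAC indicE; case: (boolP (y \in U i)) => [/set_mem iy|_]; last first.
      by rewrite mulr0 !mul0r.
    rewrite mulr1 ler_wpM2l//.
    apply: le_trans (lerD (lexx _) (dz_o_osc S x iy (dz_xs S i))).
    by rewrite normcBC addrC -{1}(subrK (k x y) (k x (xs i))) normcD.
rewrite (@sigma_finite_tonelli _ _ _ (discr i0) (borel X) cnt mu (sigma_finite_cnt i0) smu
  (fun p => f p.1 p.2))//; last exact: (@measurable_fun_discr_prod I i0 _ _ (borel X) _ f).
have ms : measurable_fun setT ((fun y => normc (s y)) : borel X -> R).
  by apply: cmeas_normc; exact: (fs_meas hB).
rewrite -ge0_integral_RD//; last 4 first.
- by apply: measurable_funM => //; exact: (normk_meask S).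
- by apply: measurable_funM => //; exact: jointly_measurablel (dz_o_meas S).
- by move=> y; rewrite mulr_ge0 ?normc_ge0.
- by move=> y; rewrite mulr_ge0 ?normc_ge0 ?(dz_o_ge0 S).
rewrite le_eqVlt; apply/orP; left; apply/eqP; apply: eq_integral => y _.
rewrite -mulrDr EFinM (step_sum i0 S)// -ge0_integralZTr ?lee_fin//.
by move=> i; rewrite lee_fin; exact: aU0.
Qed.

Lemma sampling_space F : Minf F -> B F ->
  B (step (fun=> 1) (fun i => F (xs i))) /\
  NB (step (fun=> 1) (fun i => F (xs i))) <= N%:R * (1 + no) * NB F.
Proof.
move=> MF BF; set s := step _ _.
(* At most [N] sets contain a given point, each contributing at most [|F|] plus the oscillation
   bound; the factor [N] is absorbed into the dominating function [N * F]. *)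
have BNF := spaceZ N%:R BF.
have [||Bs hs] := @dominated_osc _ _ s BNF BNF.
- exact: (step_meas i0 S).
- move=> y; rewrite (step_sum i0 S)//.
  have c0 : (0 <= (normc (F y))%:E + osc_int F y)%E.
    by rewrite adde_ge0 ?lee_fin ?normc_ge0// (osc_int_ge0 S).
  apply: (@le_trans _ _ (\int[cnt]_i ((\1_(U i) y)%:E * ((normc (F y))%:E + osc_int F y)))%E).
    apply: ge0_le_integralT; try exact: measurable_fun_discr.
      by move=> i; rewrite lee_fin !mulr_ge0 ?normc_ge0.
    move=> i; rewrite mulr1 mulrC EFinM indicE.
    case: (boolP (y \in U i)) => [/set_mem iy|_]; last by rewrite !mul0e.
    by rewrite !mul1e; exact: (reproduced_osc_le S hCk MF iy (dz_xs S i)).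
  rewrite ge0_integralZTr//.
  apply: le_trans (lee_wpmul2r c0 (cnt_cover i0 S y)) _.
  rewrite ge0_muleDr ?lee_fin ?normc_ge0 ?(osc_int_ge0 S)// -EFinM.
  rewrite normcM normc_nat leeD2l// /osc_int -ge0_integral_RZ//; last 2 first.
  - apply: measurable_funM; first exact: cmeas_normc (fs_meas hB BF).
    exact: jointly_measurabler (dz_o_meas S).
  - by move=> x; rewrite mulr_ge0 ?normc_ge0 ?(dz_o_ge0 S).
  rewrite le_eqVlt; apply/orP; left; apply/eqP; apply: eq_integral => x _.
  by rewrite normcM normc_nat mulrA.
split=> //; apply: le_trans hs _.
by rewrite !(fs_normZ hB)// normc_nat -{1}[N%:R * NB F]mul1r -mulrDl mulrCA mulrA.
Qed.

End Domination.

(** * Inversion of the discretized reproducing formula *)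

Section GeometricLimit.
Context {R : realType}.
Implicit Types (u : nat -> R[i]) (l : R[i]).

(** The distance [d] is left abstract so as to cover both the norm of a function space and the
    modulus at a fixed point. *)
Lemma geometric_dist (d : nat -> nat -> R) (C q : R) : 0 <= C -> 0 <= q < 1 ->
  (forall n, d n n <= 0) -> (forall n p, d n p.+1 <= d n p + d p p.+1) ->
  (forall n, d n n.+1 <= C * q ^+ n) ->
  forall n p, (n <= p)%N -> d n p <= C * q ^+ n / (1 - q).
Proof.
move=> C0 /andP[q0 q1] d0 dt dq n p np.
have q1' : 0 < 1 - q by rewrite subr_gt0.
(* The exact value of the finite geometric sum is kept, since the final bound alone is not stable
   under the induction. *)
have key j : d n (n + j)%N <= C * q ^+ n * (1 - q ^+ j) / (1 - q).
  elim: j => [|j ih]; first by rewrite addn0 expr0 subrr mulr0 mul0r.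
  rewrite addnS; apply: le_trans (dt _ _) _; apply: le_trans (lerD ih (dq _)) _.
  rewrite le_eqVlt; apply/orP; left; apply/eqP; rewrite exprD exprS; field.
  by rewrite gt_eqF.
rewrite -(subnKC np); apply: le_trans (key _) _.
rewrite ler_pM2r ?invr_gt0//; apply: ler_piMr; first by rewrite mulr_ge0// exprn_ge0.
by rewrite gerBl exprn_ge0.
Qed.

Lemma geometric_eventually_lt (C q e : R) : 0 <= q < 1 -> 0 < e ->
  exists n0, forall n, (n0 <= n)%N -> C * q ^+ n < e.
Proof.
move=> /andP[q0 q1] e0.
have := @cvg_geometric R C q; rewrite ger0_norm// => /(_ q1) /cvgrPdist_lt/(_ e e0)[n0 _ hn].
exists n0 => n /hn; rewrite /geometric /= sub0r normrN; apply: le_lt_trans; exact: ler_norm.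
Qed.

Lemma cauchy_real_cvg (u : nat -> R) :
  (forall e, 0 < e -> exists n0 : nat, forall p q : nat, (n0 <= p)%N -> (n0 <= q)%N ->
    `|u p - u q| < e) -> cvgn u.
Proof.
move=> h; apply/cauchy_cvgP/cauchy_exP => e /h[n0 hn0].
exists (u n0); exists n0 => // p /= np.
by rewrite /ball /= hn0.
Qed.

Definition climit u : R[i] := (limn (fun n => Re (u n))) +i* (limn (fun n => Im (u n))).

Lemma cvg_climit u : (forall e, 0 < e -> exists n0 : nat, forall p q : nat,
    (n0 <= p)%N -> (n0 <= q)%N -> normc (u p - u q) < e) ->
  (fun n => normc (u n - climit u)) @ \oo --> (0 : R).
Proof.
move=> h.
have cR : cvgn (fun n => Re (u n)).
  apply: cauchy_real_cvg => e /h[n0 hn0]; exists n0 => p q np nq.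
  by apply: le_lt_trans (hn0 _ _ np nq); rewrite -ReN -ReD Re_le_normc.
have cI : cvgn (fun n => Im (u n)).
  apply: cauchy_real_cvg => e /h[n0 hn0]; exists n0 => p q np nq.
  by apply: le_lt_trans (hn0 _ _ np nq); rewrite -ImN -ImD Im_le_normc.
apply/cvgrPdist_lt => e e0; have e20 : 0 < e / 2 by rewrite divr_gt0.
move/cvgrPdist_lt: cR => /(_ _ e20) hR; move/cvgrPdist_lt: cI => /(_ _ e20) hI.
near=> n; rewrite sub0r normrN ger0_norm ?normc_ge0//.
apply: le_lt_trans (normc_le_ReIm _) _; rewrite [e]splitr ReD ReN ImD ImN.
by rewrite ltrD//= distrC; near: n.
Unshelve. all: by end_near. Qed.

Lemma climit_unique u l : (fun n => normc (u n - l)) @ \oo --> (0 : R) -> climit u = l.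
Proof.
move=> /normc_cvg_ReIm[hR hI]; rewrite [RHS]complexE /climit.
rewrite (cvg_lim _ hR)// (cvg_lim _ hI)//.
by rewrite [LHS]complexE.
Qed.

Lemma normc_cvg_le u l (w : R[i]) (M : R) (n0 : nat) :
  (fun n => normc (u n - l)) @ \oo --> (0 : R) ->
  (forall n, (n0 <= n)%N -> normc (w - u n) <= M) -> normc (w - l) <= M.
Proof.
move=> ul h; apply/ler_addgt0Pr => e e0.
move/cvgrPdist_lt: ul => /(_ e e0)[n1 _ hn].
have := hn (maxn n0 n1) (leq_maxr _ _).
rewrite /= sub0r normrN ger0_norm ?normc_ge0// => h1.
apply: le_trans (normc_triangle _ (u (maxn n0 n1)) _) _.
by rewrite lerD ?(ltW h1)// h// leq_maxl.
Qed.

Lemma cvg0_ge (u : nat -> R) (a c : R) : u @ \oo --> (0 : R) -> (forall n, a <= c + u n) ->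
  a <= c.
Proof.
move=> u0 h; apply/ler_addgt0Pr => e e0.
move/cvgrPdist_lt: u0 => /(_ e e0)[n1 _ hn]; have := hn n1 (leqnn _).
rewrite /= sub0r normrN => h1; apply: le_trans (h n1) _; rewrite lerD2l.
by apply: le_trans (ler_norm _) _; exact: ltW.
Qed.

Lemma cvg0_geometric (C q : R) : 0 <= q < 1 -> (fun n => C * q ^+ n) @ \oo --> (0 : R).
Proof.
by move=> /andP[q0 q1]; apply: cvg_geometric; rewrite ger0_norm.
Qed.

End GeometricLimit.

Section FrameSum.
Context {R : realType} {X : ptopologicalType} {I : countType} (i0 : I).
Variable mu : {measure set (borel X) -> \bar R}.
Variables (k : X -> X -> R[i]) (o m : X -> X -> R) (z : X) (U : I -> set X)
  (xs : I -> X) (D Cm nk no : R) (N : nat).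
Hypothesis S : discretization mu k o m z U xs D Cm nk no N.
Variable Ck : R.
Hypothesis hCk : 0 <= Ck /\
  forall x, (\int[mu]_y (normc (k x y) * m x y)%:E <= Ck%:E)%E.

Local Notation v := (fun x => m x z).
Local Notation cint := (cintegral mu setT).
Local Notation cnt := (@cnt R I i0).
Local Notation Minf := (reproduced mu k m z).
Variable iota : X -> I.
Hypothesis hi : (forall y, U (iota y) y) /\
  forall i, measurable ([set y | iota y = i] : set (borel X)).
Local Notation synth := (synth i0 k xs).
Local Notation coef_bound := (coef_bound mu m z U xs).
Local Notation cw := (cell_mass mu iota).
Local Notation Cs := (sampling_const Cm no N).

(* The Riemann sum of the integral [F x = \int F y k x y] over the cells
   [iota = i], with nodes [xs i]. *)
Definition frame_sum (F : X -> R[i]) : X -> R[i] :=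
  synth (fun i => (cell_mass mu iota i)%:C * F (xs i)).

Definition residual (F : X -> R[i]) : X -> R[i] := fun x => F x - frame_sum F x.

Lemma residualE F x : residual F x = F x - frame_sum F x. Proof. by []. Qed.

Lemma frame_sum_coef C F : 0 <= C -> (forall x, normc (F x) <= C * v x) ->
  coef_bound C (fun i => (cw i)%:C * F (xs i)).
Proof.
move=> C0 FC; split => // i; rewrite normcM normc_ge0_real ?(cell_mass_ge0 mu iota)//.
rewrite mulrCA; apply: ler_pM; rewrite ?normc_ge0 ?(cell_mass_ge0 mu iota)//.
exact: (cell_mass_le S hi).
Qed.

Lemma frame_sum_coefE F : Minf F -> exists C, coef_bound C (fun i => (cw i)%:C * F (xs i)).
Proof. by move=> [_ [C C0 FC] _]; exists C; exact: frame_sum_coef. Qed.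

Lemma frame_sum_reproduced F : Minf F -> Minf (frame_sum F).
Proof. by move=> /frame_sum_coefE[C hC]; exact: (synth_reproduced i0 S hCk hC). Qed.

Lemma frame_sum_le C F x : 0 <= C -> (forall x, normc (F x) <= C * v x) ->
  normc (frame_sum F x) <= C * Cs * Ck * v x.
Proof. by move=> C0 FC; apply: (synth_le i0 S hCk); exact: frame_sum_coef. Qed.

Lemma frame_sum_lin a F G x : Minf F -> Minf G ->
  frame_sum (fun x => a * F x + G x) x = a * frame_sum F x + frame_sum G x.
Proof.
move=> /frame_sum_coefE[C hC] /frame_sum_coefE[C' hC'].
have i1 := synth_cintegrable i0 S hCk x hC.
have i2 := synth_cintegrable i0 S hCk x hC'.
rewrite -cintegralZ// -cintegralD//; last exact: cintegrableZ.
by congr cintegral; apply/funext => i; ring.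
Qed.

Lemma residual_reproduced F : Minf F -> Minf (residual F).
Proof.
move=> MF; have := reproduced_lin S hCk (-1) (frame_sum_reproduced MF) MF.
by congr reproduced; apply/funext => x; rewrite mulN1r addrC.
Qed.

Lemma residual_lin a F G : Minf F -> Minf G ->
  residual (fun x => a * F x + G x) = (fun x => a * residual F x + residual G x).
Proof.
by move=> MF MG; apply/funext => x; rewrite /residual frame_sum_lin//; ring.
Qed.

(** As an integral over [X] of a function constant on cells, the Riemann sum can be subtracted from
    the reproducing integral under one integral sign. *)
Lemma frame_sum_cell_integral F x : Minf F ->
  cintegrable mu setT (fun y => F (xs (iota y)) * k x (xs (iota y))) /\
  frame_sum F x = cint (fun y => F (xs (iota y)) * k x (xs (iota y))).
Proof.
move=> /frame_sum_coefE[C hC].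
have key := @iota_cintegral _ _ _ i0 _ _ _ _ _ _ _ _ _ _ _ _ S iota hi (fun i => F (xs i) * k x (xs i)).
have [|h1 h2] := key.
  have := coef_sum_kernel i0 S hCk x hC.
  rewrite (_ : integral _ _ _ =
    (\int[cnt]_i (cw i * normc (F (xs i) * k x (xs i)))%:E)%E); last first.
    apply: eq_integral => i _; rewrite !normcM normc_ge0_real ?(cell_mass_ge0 mu iota)//.
    by rewrite mulrA.
  by move=> /le_lt_trans; apply; rewrite ltry.
split => //; rewrite h2 /frame_sum /synth; congr cintegral.
by apply/funext => i; rewrite mulrA.
Qed.

End FrameSum.

Section Neumann.
Context {R : realType} {X : ptopologicalType} {I : countType} (i0 : I).
Variable mu : {measure set (borel X) -> \bar R}.
Variables (k : X -> X -> R[i]) (o m : X -> X -> R) (z : X) (U : I -> set X)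
  (xs : I -> X) (D Cm nk no : R) (N : nat).
Hypothesis S : discretization mu k o m z U xs D Cm nk no N.
Variable Ck : R.
Hypothesis hCk : 0 <= Ck /\
  forall x, (\int[mu]_y (normc (k x y) * m x y)%:E <= Ck%:E)%E.

Local Notation v := (fun x => m x z).
Local Notation cmeas F := (cmeasurable setT (F : borel X -> R[i])).
Local Notation Minf := (reproduced mu k m z).
Variable iota : X -> I.
Hypothesis hi : (forall y, U (iota y) y) /\
  forall i, measurable ([set y | iota y = i] : set (borel X)).
Variables (B : set (X -> R[i])) (NB : (X -> R[i]) -> R).
Hypothesis hB : function_space mu k m z B NB.
Local Notation Cs := (sampling_const Cm no N).
Local Notation frame_sum := (frame_sum i0 mu k xs iota).
Local Notation residual := (residual i0 mu k xs iota).
Local Notation q := (nk * no + no * (nk + no)).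
Hypothesis hq : q < 1.

Lemma contraction_range : 0 <= q < 1.
Proof.
by rewrite hq andbT addr_ge0 ?mulr_ge0 ?addr_ge0 ?(no_ge0 i0 S) ?(nk_ge0 i0 S).
Qed.

Lemma one_minus_q_gt0 : 0 < 1 - q. Proof. by rewrite subr_gt0. Qed.

(** Passing to the nodes changes both [F] and [k]: with [Fi] and [ki] for the values at nodes,
    [F k - Fi ki = (F - Fi) k + Fi (k - ki)]. The first error costs [nk * no], the second [no] times
    the norm of [Fi]. *)
Lemma residual_space F : Minf F -> B F ->
  B (residual F) /\ NB (residual F) <= q * NB F.
Proof.
move=> MF BF; have mF := fs_meas hB BF.
pose Fi y := F (xs (iota y)).
have mFi : cmeas Fi by exact: (iota_comp_meas i0 hi (fun i => F (xs i))).
have comp y t : normc (k (xs (iota y)) t) <= normc (k y t) + o t y.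
  apply: le_trans (lerD (lexx _) (normk_osc S t (hi.1 y) (dz_xs S (iota y)))).
  by rewrite normcBC addrC -{1}(subrK (k y t) (k (xs (iota y)) t)) normcD.
have mo := dz_o_meas S.
(* The samples are reproduced before they are compared, so that the bound is [nk + no] and the
   contraction constant is expressed by the quantities of the smallness condition. *)
have [BFi hFi] : B Fi /\ NB Fi <= nk * NB F + no * NB F.
  apply: (dominated_kernel S hB BF BF (oT_meas S) (fun x y => dz_o_ge0 S y x) (oT_bound S) mFi).
  move=> y; have nF := cmeas_normc mF.
  rewrite /Fi (rp_eq MF (xs (iota y))).
  apply: le_trans (normc_cintegral (reproduced_cintegrable S hCk _ MF)) _.
  rewrite -ge0_integral_RD; last 4 first.
  - by apply: measurable_funM => //; exact: (normk_meask S).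
  - by apply: measurable_funM => //; exact: (jointly_measurabler y mo).
  - by move=> t; rewrite mulr_ge0 ?normc_ge0.
  - by move=> t; rewrite mulr_ge0 ?normc_ge0 ?(dz_o_ge0 S).
  apply: le_integral_R.
  - by apply: cmeas_normc; apply: cmeasM => //; exact: (k_measl S).
  - apply: measurable_funD; apply: measurable_funM => //; first exact: (normk_meask S).
    exact: (jointly_measurabler y mo).
  - by move=> t; exact: normc_ge0.
  - by move=> t; rewrite normcM -mulrDr ler_wpM2l ?normc_ge0.
pose A y := F y - Fi y.
have mA : cmeas A by exact: cmeasB.
have [BA hA] : B A /\ NB A <= no * NB F.
  have [|BA hA] := dominated_osc S hB (fs_0 hB) BF mA; last first.
    by split=> //; rewrite (space_norm0 hB) add0r in hA.
  move=> y; rewrite normc00 add0e /A normcBC.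
  exact: (reproduced_osc S hCk MF (hi.1 y) (dz_xs S (iota y))).
have mr := rp_meas (residual_reproduced i0 S hCk hi MF).
have [|Br hr] := dominated_kernel S hB BA BFi mo (dz_o_ge0 S) (o_bound S) mr.
  move=> x; have [i1 E] := frame_sum_cell_integral i0 S hCk hi x MF.
  have i2 := reproduced_cintegrable S hCk x MF.
  rewrite residualE E (rp_eq MF x) -cintegralB//.
  apply: le_trans (normc_cintegral (cintegrableB i2 i1)) _.
  have mb : cmeas (fun y => F y * k x y - Fi y * k x (xs (iota y))).
    exact: cintegrable_meas (cintegrableB i2 i1).
  rewrite -ge0_integral_RD; last 4 first.
  - by apply: measurable_funM; [exact: cmeas_normc|exact: (normk_meask S)].
  - by apply: measurable_funM; [exact: cmeas_normc|exact: (jointly_measurablel x mo)].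
  - by move=> t; rewrite mulr_ge0 ?normc_ge0.
  - by move=> t; rewrite mulr_ge0 ?normc_ge0 ?(dz_o_ge0 S).
  apply: le_integral_R.
  - exact: cmeas_normc.
  - apply: measurable_funD; apply: measurable_funM; try exact: cmeas_normc.
      exact: (normk_meask S).
    exact: (jointly_measurablel x mo).
  - by move=> t; exact: normc_ge0.
  - move=> y.
    rewrite (_ : _ - _ = A y * k x y + Fi y * (k x y - k x (xs (iota y)))); last first.
      by rewrite /A /Fi; ring.
    apply: le_trans (normcD _ _) _; rewrite !normcM lerD2l ler_wpM2l ?normc_ge0//.
    exact: (dz_o_osc S x (hi.1 y) (dz_xs S (iota y))).
split => //; apply: le_trans hr _.
rewrite mulrDl -!mulrA mulrDl; apply: lerD.
  by rewrite ler_wpM2l ?(nk_ge0 i0 S).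
by rewrite ler_wpM2l ?(no_ge0 i0 S).
Qed.

Definition residuals n F := iter n residual F.
Definition partial_neumann F n x := \sum_(j < n) residuals j F x.
(** The limit is taken pointwise and mentions no function space, so the operator on [Y] and the one
    on [L^1_v] coincide by definition. Symmetry arguments can then pair the two. *)
Definition neumann F x := climit (partial_neumann F ^~ x).

Lemma residualsS F n : residuals n.+1 F = residual (residuals n F).
Proof. by []. Qed.

Lemma residuals_reproduced F n : Minf F -> Minf (residuals n F).
Proof. by move=> MF; elim: n => [//|n ih]; exact: (residual_reproduced i0 S hCk hi). Qed.

Lemma residuals_space F n : Minf F -> B F ->
  B (residuals n F) /\ NB (residuals n F) <= q ^+ n * NB F.
Proof.
move=> MF BF; elim: n => [|n [ih1 ih2]]; first by rewrite expr0 mul1r.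
have [h1 h2] := residual_space (residuals_reproduced n MF) ih1.
split => //; apply: le_trans h2 _; rewrite exprS -mulrA ler_wpM2l//.
by have /andP[] := contraction_range.
Qed.

Lemma residuals_lin a F G n : Minf F -> Minf G ->
  residuals n (fun x => a * F x + G x) = (fun x => a * residuals n F x + residuals n G x).
Proof.
move=> MF MG; elim: n => [//|n ih].
rewrite !residualsS ih (residual_lin i0 S hCk hi)//;
  exact: residuals_reproduced.
Qed.

Lemma partial_neumannS F n :
  partial_neumann F n.+1 = (fun x => partial_neumann F n x + residuals n F x).
Proof. by apply/funext => x; rewrite /partial_neumann big_ord_recr. Qed.

Lemma partial_neumann0 F : partial_neumann F 0 = (fun=> 0).
Proof. by apply/funext => x; rewrite /partial_neumann big_ord0. Qed.

Lemma reproduced0 : Minf (fun=> 0).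
Proof.
have := reproduced_lin S hCk (-1) (reproduced_kernel S z) (reproduced_kernel S z).
by congr reproduced; apply/funext => x; rewrite mulN1r addNr.
Qed.

Lemma partial_neumann_reproduced F n : Minf F -> Minf (partial_neumann F n).
Proof.
move=> MF; elim: n => [|n ih]; first by rewrite partial_neumann0; exact: reproduced0.
have := reproduced_lin S hCk 1 ih (residuals_reproduced n MF).
by rewrite partial_neumannS; congr reproduced; apply/funext => x; rewrite mul1r.
Qed.

Lemma partial_neumann_space F n : Minf F -> B F -> B (partial_neumann F n).
Proof.
move=> MF BF; elim: n => [|n ih]; first by rewrite partial_neumann0; exact: (fs_0 hB).
by rewrite partial_neumannS; apply: (spaceD hB) => //; exact: (residuals_space n MF BF).1.
Qed.

(** The sum of the first [n] iterates telescopes under [residual]. Equivalently, [frame_sum] maps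
    the [n]-th partial sum to [F] minus the [n]-th iterate, so partial sums are approximate
    preimages of [F]. *)
Lemma residual_partial_neumann F n x : Minf F ->
  residual (partial_neumann F n) x = partial_neumann F n x - F x + residuals n F x.
Proof.
move=> MF; elim: n => [|n ih] in x *.
  rewrite /residuals /= partial_neumann0 sub0r addNr /residual.
  have := frame_sum_lin i0 S hCk hi (-1) x (reproduced_kernel S z) (reproduced_kernel S z).
  have -> : (fun x => -1 * k x z + k x z) = fun=> 0.
    by apply/funext => y; rewrite mulN1r addNr.
  by rewrite mulN1r addNr => ->; rewrite subr0.
have := residual_lin i0 S hCk hi 1 (partial_neumann_reproduced n MF) (residuals_reproduced n MF).
move=> /(congr1 (fun f => f x)) /=; rewrite mul1r ih => h.
transitivity (residual (fun x => 1 * partial_neumann F n x + residuals n F x) x).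
  by congr (residual _ x); rewrite partial_neumannS; apply/funext => y; rewrite mul1r.
by rewrite h partial_neumannS; ring.
Qed.

Section Sum.
Variable F : X -> R[i].
Hypotheses (MF : Minf F) (BF : B F).

Let NF0 : 0 <= NB F := fs_ge0 hB BF.

Lemma residuals_pointwise Cp : 0 <= Cp ->
  (forall F, Minf F -> B F -> forall x, normc (F x) <= Cp * m x z * NB F) ->
  forall n x, normc (residuals n F x) <= Cp * v x * NB F * q ^+ n.
Proof.
move=> Cp0 hCp n x; have [h1 h2] := residuals_space n MF BF.
apply: le_trans (hCp _ (residuals_reproduced n MF) h1 x) _.
rewrite -[leRHS]mulrA; apply: ler_wpM2l; first by rewrite mulr_ge0 ?(m_ge0 S).
by rewrite mulrC.
Qed.

Lemma partial_neumann_dist n p : (n <= p)%N ->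
  NB (fun x => partial_neumann F n x - partial_neumann F p x) <= NB F * q ^+ n / (1 - q).
Proof.
pose d n p := NB (fun x => partial_neumann F n x - partial_neumann F p x).
have Bp j := partial_neumann_space j MF BF.
apply: (@geometric_dist _ d (NB F) q NF0 contraction_range) => [j|i j|j].
- rewrite /d (_ : (fun x => _) = fun=> 0); last by apply/funext => x; rewrite subrr.
  by rewrite (space_norm0 hB).
- exact: (space_dist_triangle hB).
- rewrite /d (_ : (fun x => _) = fun x => - residuals j F x); last first.
    by apply/funext => x; rewrite partial_neumannS; ring.
  have [h1 h2] := residuals_space j MF BF.
  by rewrite (space_normN hB)// mulrC.
Qed.

(** [fs_pointwise] converts the geometric decay of norms into geometric decay at each point, uniform
    relative to [v]. Such convergence is compatible with the reproducing integral and with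
    [frame_sum]. *)
Lemma partial_neumann_pointwise : exists2 C, 0 <= C & forall x,
  (fun n => normc (partial_neumann F n x - neumann F x)) @ \oo --> (0 : R) /\
  forall n, normc (partial_neumann F n x - neumann F x) <= C * q ^+ n * v x.
Proof.
have [Cp Cp0 hCp] := fs_pointwise hB.
have C0 : 0 <= Cp * NB F / (1 - q).
  by rewrite mulr_ge0 ?mulr_ge0// invr_ge0 ltW// one_minus_q_gt0.
exists (Cp * NB F / (1 - q)) => // x.
have dist n p : (n <= p)%N ->
    normc (partial_neumann F n x - partial_neumann F p x) <= Cp * NB F / (1 - q) * q ^+ n * v x.
  move=> np; pose d n p := normc (partial_neumann F n x - partial_neumann F p x).
  have CN0 : 0 <= Cp * v x * NB F by rewrite !mulr_ge0 ?(m_ge0 S).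
  have := @geometric_dist _ d (Cp * v x * NB F) q CN0 contraction_range.
  have -> : Cp * NB F / (1 - q) * q ^+ n * v x = Cp * v x * NB F * q ^+ n / (1 - q) by ring.
  apply => // [j|i j|j].
  - by rewrite /d subrr normc00.
  - exact: normc_triangle.
  - rewrite /d partial_neumannS opprD addrA subrr sub0r normcN.
    exact: residuals_pointwise.
have cv : (fun n => normc (partial_neumann F n x - neumann F x)) @ \oo --> (0 : R).
  apply: cvg_climit => e e0.
  have [n0 hn0] := geometric_eventually_lt (Cp * NB F / (1 - q) * v x) contraction_range e0.
  exists n0 => a b na nb.
  wlog ab : a b na nb / (a <= b)%N.
    move=> h; have [ab|/ltnW ba] := leqP a b; first exact: h.
    by rewrite normcBC; exact: h.
  by apply: le_lt_trans (dist _ _ ab) _; rewrite mulrAC; exact: hn0.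
split=> // n; apply: (normc_cvg_le (n0 := n) cv) => p np; exact: dist.
Qed.

Lemma neumann_reproduced : Minf (neumann F).
Proof.
have [C C0 hC] := partial_neumann_pointwise.
have mN : cmeas (neumann F).
  apply: (@cmeas_cvg _ _ (borel X) (partial_neumann F)); last by move=> x; exact: (hC x).1.
  by move=> n; exact: rp_meas (partial_neumann_reproduced n MF).
have bN x : normc (neumann F x) <= C * v x.
  have := (hC x).2 0; rewrite expr0 mulr1 partial_neumann0 sub0r normcN; exact.
split=> //; first by exists C.
move=> x; apply/eqP; rewrite -subr_eq0; apply/eqP; apply: normc_eq0; apply/eqP.
rewrite eq_le normc_ge0 andbT.
(* The [1] accounts for the distance between the limit and the [n]-th partial sum, [Ck] for the same
   distance integrated against [k]. *)
apply: (cvg0_ge (cvg0_geometric (C * (1 + Ck) * v x) contraction_range)) => n.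
rewrite add0r.
have Mp := partial_neumann_reproduced n MF.
have iN : cintegrable mu setT (fun y => neumann F y * k x y).
  by apply: (wbound_cintegrable S hCk) => //; exists C.
have ip := reproduced_cintegrable S hCk x Mp.
apply: le_trans (normc_triangle _ (partial_neumann F n x) _) _.
rewrite {2}(rp_eq Mp x) -cintegralB// normcBC.
rewrite (_ : (fun y => _) = fun y => (partial_neumann F n y - neumann F y) * k x y); last first.
  by apply/funext => y; rewrite mulrBl.
have Cq0 : 0 <= C * q ^+ n by rewrite mulr_ge0// exprn_ge0//; have /andP[] := contraction_range.
have mD : cmeas (fun y => partial_neumann F n y - neumann F y).
  by apply: cmeasB => //; exact: rp_meas Mp.
have h2 := wbound_cint_le S hCk x mD Cq0 (fun y => (hC y).2 n).
apply: le_trans (lerD ((hC x).2 n) h2) _.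
by rewrite le_eqVlt; apply/orP; left; apply/eqP; ring.
Qed.

Lemma neumann_space : B (neumann F) /\ NB (neumann F) <= NB F / (1 - q).
Proof.
have [C C0 hC] := partial_neumann_pointwise.
have Bp j := partial_neumann_space j MF BF.
have [||BN cvN] := fs_complete hB (u := partial_neumann F) (F := neumann F) Bp.
- move=> e e0.
  have [n0 hn0] := geometric_eventually_lt (NB F / (1 - q)) contraction_range e0.
  exists n0 => a b na nb.
  wlog ab : a b na nb / (a <= b)%N.
    move=> h; have [ab|/ltnW ba] := leqP a b; first exact: h.
    have -> : (fun x => partial_neumann F a x - partial_neumann F b x) =
              (fun x => - (partial_neumann F b x - partial_neumann F a x)).
      by apply/funext => x; rewrite opprB.
    by rewrite (space_normN hB) ?h//; exact: (spaceB hB).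
  by apply: le_lt_trans (partial_neumann_dist ab) _; rewrite mulrAC; exact: hn0.
- by move=> x; exact: (hC x).1.
split=> //.
apply: (cvg0_ge cvN) => n.
(* The partial sum of index 0 vanishes, so its distance to the [n]-th one is the norm of the latter,
   bounded uniformly in [n]. *)
have h := partial_neumann_dist (leq0n n).
rewrite expr0 mulr1 in h.
apply: (le_trans _ (lerD h (lexx _))).
rewrite (_ : (fun x => partial_neumann F 0 x - _) = fun x => - partial_neumann F n x); last first.
  by apply/funext => x; rewrite partial_neumann0 sub0r.
rewrite (space_normN hB)//.
rewrite -(space_normN hB (spaceB hB (Bp n) BN)).
apply: (le_trans _ (fs_normD hB (Bp n) (spaceN hB (spaceB hB (Bp n) BN)))).
rewrite le_eqVlt; apply/orP; left; apply/eqP; congr NB; apply/funext => x; ring.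
Qed.

Lemma frame_sum_neumann : frame_sum (neumann F) = F.
Proof.
have [C C0 hC] := partial_neumann_pointwise.
have MN := neumann_reproduced.
apply/funext => x; apply/eqP; rewrite -subr_eq0; apply/eqP; apply: normc_eq0; apply/eqP.
rewrite eq_le normc_ge0 andbT.
have [Cp Cp0 hCp] := fs_pointwise hB.
(* The first summand bounds [frame_sum] of the truncation error, the second the [n]-th iterate left
   over by [residual_partial_neumann]. *)
pose C' := C * Cs * Ck * v x + Cp * v x * NB F.
apply: (cvg0_ge (cvg0_geometric C' contraction_range)) => n; rewrite add0r.
have Mp := partial_neumann_reproduced n MF.
apply: le_trans (normc_triangle _ (frame_sum (partial_neumann F n) x) _) _.
rewrite mulrDl; apply: lerD.
  have Cq0 : 0 <= C * q ^+ n by rewrite mulr_ge0// exprn_ge0//; have /andP[] := contraction_range.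
  have Cx y : normc (-1 * partial_neumann F n y + neumann F y) <= C * q ^+ n * v y.
    by rewrite mulN1r addrC normcBC (hC y).2.
  have := frame_sum_le i0 S hCk hi x Cq0 Cx.
  rewrite (frame_sum_lin i0 S hCk hi)// mulN1r addrC => /le_trans; apply.
  by rewrite le_eqVlt; apply/orP; left; apply/eqP; ring.
have := residual_partial_neumann n x MF; rewrite residualE => h.
have -> : frame_sum (partial_neumann F n) x - F x = - residuals n F x.
  have -> : frame_sum (partial_neumann F n) x =
    partial_neumann F n x - (partial_neumann F n x - frame_sum (partial_neumann F n) x) by ring.
  by rewrite h; ring.
by rewrite normcN; exact: residuals_pointwise.
Qed.

(** Since [frame_sum F] is [F] minus its residual, its iterates are differences of consecutive
    iterates of [F], and the partial sums telescope to [F] minus the [n]-th iterate. *)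
Lemma neumann_frame_sum : neumann (frame_sum F) = F.
Proof.
have [Cp Cp0 hCp] := fs_pointwise hB.
have MD := residual_reproduced i0 S hCk hi MF.
apply/funext => x; apply: climit_unique.
have E n y : residuals n (frame_sum F) y = residuals n F y - residuals n.+1 F y.
  have := residuals_lin (-1) n MD MF.
  rewrite (_ : (fun x => _) = frame_sum F); last first.
    by apply/funext => t; rewrite residualE mulN1r opprB subrK.
  by move=> ->; rewrite mulN1r addrC /residuals -iterSr.
have G n : partial_neumann (frame_sum F) n x = F x - residuals n F x.
  elim: n => [|n ih]; first by rewrite partial_neumann0 subrr.
  by rewrite partial_neumannS ih E; ring.
apply: (squeeze_cvgr _ (@cvg_cst _ (0 : R) _ _ _)
  (cvg0_geometric (Cp * v x * NB F) contraction_range)).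
near=> n; rewrite normc_ge0 /= G.
have -> : F x - residuals n F x - F x = - residuals n F x by ring.
by rewrite normcN; exact: residuals_pointwise.
Unshelve. all: by end_near. Qed.

End Sum.

Lemma neumann_lin a F G : Minf F -> B F -> Minf G -> B G ->
  neumann (fun x => a * F x + G x) = (fun x => a * neumann F x + neumann G x).
Proof.
move=> MF BF MG BG; apply/funext => x; apply: climit_unique.
have [C C0 hC] := partial_neumann_pointwise MF BF.
have [C' C'0 hC'] := partial_neumann_pointwise MG BG.
have E n : partial_neumann (fun x => a * F x + G x) n x =
    a * partial_neumann F n x + partial_neumann G n x.
  elim: n => [|n ih]; first by rewrite !partial_neumann0 mulr0 addr0.
  by rewrite !partial_neumannS ih residuals_lin//; ring.
apply: (squeeze_cvgr _ (@cvg_cst _ (0 : R) _ _ _)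
  (cvg0_geometric ((normc a * C + C') * v x) contraction_range)).
near=> n; rewrite normc_ge0 /= E.
have -> : a * partial_neumann F n x + partial_neumann G n x - (a * neumann F x + neumann G x) =
  a * (partial_neumann F n x - neumann F x) + (partial_neumann G n x - neumann G x) by ring.
apply: le_trans (normcD _ _) _; rewrite normcM.
apply: le_trans (lerD (ler_wpM2l (normc_ge0 _) ((hC x).2 n)) ((hC' x).2 n)) _.
by rewrite le_eqVlt; apply/orP; left; apply/eqP; ring.
Unshelve. all: by end_near. Qed.

End Neumann.

(** * Weighted integrable functions and solid spaces *)

Section Fatou.
Context {R : realType} {d : measure_display} {T : measurableType d}.
Variable mu : {measure set T -> \bar R}.

Lemma fatou_le (D : set T) (mD : measurable D) (f : nat -> T -> \bar R)
    (g : T -> \bar R) (M : \bar R) :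
  (forall n, measurable_fun D (f n)) -> (forall n x, D x -> (0 <= f n x)%E) ->
  (forall x, D x -> f ^~ x @ \oo --> g x) -> (forall n, (\int[mu]_(x in D) f n x <= M)%E) ->
  (\int[mu]_(x in D) g x <= M)%E.
Proof.
move=> mf f0 fg fM.
have -> : (\int[mu]_(x in D) g x = \int[mu]_(x in D) limn_einf (f ^~ x))%E.
  by apply: eq_integral => x /set_mem Dx; have [-> _] := cvg_limn_einf_sup (fg x Dx).
apply: le_trans (fatou mu mD mf f0) _.
rewrite limn_einf_lim; apply: lime_le; first exact: is_cvg_einfs.
apply: nearW => n; apply: le_trans (fM n); apply: ereal_inf_lbound.
by exists n => /=.
Qed.

Lemma measurable_fun_invr (f : T -> R) : measurable_fun setT f -> (forall x, 0 < f x) ->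
  measurable_fun setT (fun x => (f x)^-1).
Proof.
move=> mf f0; have -> : (fun x => (f x)^-1) = (fun x => expR (- ln (f x))).
  by apply/funext => x; rewrite expRN lnK// posrE.
apply: (measurableT_comp (@measurable_expR R)).
by apply: measurable_funN; apply: (measurableT_comp (@measurable_ln R)).
Qed.

End Fatou.

Section WeightedL1.
Context {R : realType} {X : ptopologicalType} {I : countType} (i0 : I).
Variable mu : {measure set (borel X) -> \bar R}.
Variables (k : X -> X -> R[i]) (o m : X -> X -> R) (z : X) (U : I -> set X)
  (xs : I -> X) (D Cm nk no : R) (N : nat).
Hypothesis S : discretization mu k o m z U xs D Cm nk no N.
Variable Ck : R.
Hypothesis hCk : 0 <= Ck /\
  forall x, (\int[mu]_y (normc (k x y) * m x y)%:E <= Ck%:E)%E.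

Local Notation v := (fun x => m x z).
Local Notation cmeas F := (cmeasurable setT (F : borel X -> R[i])).
Local Notation smu := (dz_sigma S).
Local Notation wint := (wint mu m z).
Local Notation L1v := (L1w mu v).
Local Notation NL1v := (L1w_norm mu v).

Lemma L1wP F : L1v F <-> cmeas F /\ (wint F < +oo)%E.
Proof.
have vn x : normc (v x)%:C = v x by rewrite normc_ge0_real// (m_ge0 S).
have E G : (\int[mu]_x (normc (G x * (v x)%:C))%:E = wint G)%E.
  by apply: eq_integral => x _; rewrite normcM vn.
split => [/cintegrableP[mFv]|[mF Ffin]]; last first.
  apply/cintegrableP; rewrite E; split => //; apply: cmeasM => //.
  by apply: cmeas_real; exact: (v_meas S).
rewrite E; split => //.
have -> : F = fun x => (F x * (v x)%:C) * ((v x)^-1)%:C.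
  apply/funext => x; rewrite -mulrA -rmorphM/= mulfV ?mulr1//.
  by rewrite gt_eqF// (m_gt0 S).
apply: cmeasM => //; apply: cmeas_real; apply: measurable_fun_invr; first exact: (v_meas S).
by move=> x; exact: (m_gt0 S).
Qed.

Lemma L1w_normE F : NL1v F = fine (wint F).
Proof. by []. Qed.

Lemma L1w_norm_fin F : L1v F -> (NL1v F)%:E = wint F.
Proof.
move=> /L1wP[_ Ff]; rewrite L1w_normE fineK// ge0_fin_numE//; exact: (wint_ge0 S).
Qed.

Lemma wint_lin a F G : cmeas F -> cmeas G ->
  (wint (fun x => (a * F x + G x)%R) <= (normc a)%:E * wint F + wint G)%E.
Proof.
move=> mF mG; have [mF' mG'] := (wint_meas S mF, wint_meas S mG).
rewrite -ge0_integral_RZ ?normc_ge0//; last by move=> x; rewrite mulr_ge0 ?normc_ge0 ?(m_ge0 S).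
rewrite -ge0_integral_RD//; last 3 first.
- exact: measurable_funM.
- by move=> x; rewrite !mulr_ge0 ?normc_ge0 ?(m_ge0 S).
- by move=> x; rewrite !mulr_ge0 ?normc_ge0 ?(m_ge0 S).
apply: le_integral_R.
- by apply: (wint_meas S); apply: cmeasD => //; apply: cmeasM => //; exact: cmeas_cst.
- by apply: measurable_funD => //; exact: measurable_funM.
- by move=> x; rewrite mulr_ge0 ?normc_ge0 ?(m_ge0 S).
- move=> x; rewrite mulrA -mulrDl ler_wpM2r ?(m_ge0 S)// -normcM; exact: normcD.
Qed.

Lemma L1w_lin a F G : L1v F -> L1v G -> L1v (fun x => a * F x + G x).
Proof.
move=> /L1wP[mF iF] /L1wP[mG iG]; apply/L1wP; split.
  by apply: cmeasD => //; apply: cmeasM => //; exact: cmeas_cst.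
apply: le_lt_trans (wint_lin a mF mG) _.
by rewrite lte_add_pinfty// lte_mul_pinfty// lee_fin normc_ge0.
Qed.

(** By Fatou, a bound on the distances from [G] to the members of a sequence passes to its pointwise
    limit. The Cauchy condition thereby yields convergence to the prescribed limit [F]. *)
Lemma wint_complete (u : nat -> X -> R[i]) F (M : R) n0 : (forall n, cmeas (u n)) ->
  (forall x, (fun n => normc (u n x - F x)) @ \oo --> (0 : R)) ->
  forall G, cmeas G -> (forall n, (n0 <= n)%N -> (wint (fun x => (G x - u n x)%R) <= M%:E)%E) ->
  (wint (fun x => (G x - F x)%R) <= M%:E)%E.
Proof.
move=> mu_ uF G mG h.
apply: (@fatou_le _ _ (borel X) mu setT measurableT
  (fun n x => (normc (G x - u (n0 + n)%N x) * v x)%:E)).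
- by move=> n; apply/measurable_EFinP; apply: (wint_meas S); exact: cmeasB.
- by move=> n x _; rewrite lee_fin mulr_ge0 ?normc_ge0 ?(m_ge0 S).
- move=> x _; apply: cvg_EFin; first by apply: nearW.
  apply: cvgMr_tmp; apply/cvgrPdist_le => e e0.
  move/cvgrPdist_le: (uF x) => /(_ e e0)[n1 _ hn]; exists n1 => // n /= nn.
  have /= := hn (n0 + n)%N (leq_trans nn (leq_addl _ _)).
  rewrite sub0r normrN ger0_norm ?normc_ge0//; apply: le_trans.
  rewrite ler_norml; apply/andP; split.
    rewrite lerNl opprB lerBlDr.
    by apply: le_trans (normc_triangle _ (F x) _) _; rewrite [leRHS]addrC (normcBC (F x)).
  by rewrite lerBlDr [leRHS]addrC; exact: normc_triangle.
- by move=> n; apply: h; exact: leq_addr.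
Qed.

Lemma L1w_function_space : function_space mu k m z L1v NL1v.
Proof.
have m0 x y : 0 <= m x y := m_ge0 S x y.
have L0 : L1v (fun=> 0).
  apply/L1wP; split; first exact: cmeas_cst.
  by rewrite [X in (X < _)%E]integral0_eq ?ltry// => x _; rewrite normc00 mul0r.
split => //.
- exact: L1w_lin.
- by move=> F _; apply: fine_ge0; exact: (wint_ge0 S).
- move=> a F hF; have [mF _] := (L1wP F).1 hF.
  apply: EFin_inj; rewrite EFinM (L1w_norm_fin hF).
  rewrite -ge0_integral_RZ ?normc_ge0//; last 2 first.
  + exact: (wint_meas S).
  + by move=> x; rewrite mulr_ge0 ?normc_ge0.
  rewrite L1w_norm_fin.
    by apply: eq_integral => x _; rewrite normcM mulrA.
  have := L1w_lin a hF L0; rewrite (_ : (fun x => a * F x + _) = fun x => a * F x)//.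
  by apply/funext => x; rewrite addr0.
- move=> F G hF hG; have [[mF _] [mG _]] := ((L1wP F).1 hF, (L1wP G).1 hG).
  have E : (fun x => F x + G x) = (fun x => 1 * F x + G x).
    by apply/funext => x; rewrite mul1r.
  rewrite E -lee_fin EFinD !L1w_norm_fin//; last exact: L1w_lin.
  by apply: le_trans (wint_lin 1 mF mG) _; rewrite Normc.normc1 mul1e.
- by move=> F /L1wP[].
- move=> F0 F1 F2 K1 K2 c1 c2 F h0 h1 h2 mK1 K10 hK1 mK2 K20 hK2 mF hF.
  have [[mF0 i0'] [mF1 i1] [mF2 i2]] :=
    And3 ((L1wP F0).1 h0) ((L1wP F1).1 h1) ((L1wP F2).1 h2).
  have mv := v_meas S.
  have c0 K c : (forall x y, 0 <= K x y) -> kernel_bound mu m K c -> 0 <= c.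
    move=> K0 [aK _]; have [x _] := ae_exists_U S i0 aK; rewrite -lee_fin; apply: le_trans.
    by apply: integral_ge0 => y _; rewrite lee_fin mulr_ge0.
  have mI G (K : X -> X -> R) : cmeas G -> jointly_measurable K -> (forall x y, 0 <= K x y) ->
      measurable_fun setT ((fun x => \int[mu]_y (normc (G y) * K x y)%:E)%E : borel X -> \bar R).
    move=> mG mK K0; have nG := cmeas_normc mG.
    apply: (@measurable_fun_section_integral _ _ _ (borel X) (borel X) mu smu
      (fun p => (normc (G p.2) * K p.1 p.2)%:E)).
      apply/measurable_EFinP; apply: measurable_funM => //.
      exact: (jointly_measurable_transpose (fst_meas nG)).
    by move=> p; rewrite lee_fin mulr_ge0 ?normc_ge0.
  have I0 G (K : X -> X -> R) x : (forall x y, 0 <= K x y) ->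
      (0 <= \int[mu]_y (normc (G y) * K x y)%:E)%E.
    by move=> K0; apply: integral_ge0 => y _; rewrite lee_fin mulr_ge0 ?normc_ge0.
  have wK G K c : cmeas G -> jointly_measurable K -> (forall x y, 0 <= K x y) ->
      kernel_bound mu m K c ->
      (\int[mu]_x ((\int[mu]_y (normc (G y) * K x y)%:E) * (v x)%:E) <= c%:E * wint G)%E.
    move=> mG mK K0 hK.
    apply: (weighted_kernel_integral S (K := fun x y => K y x)) => //.
    - exact: jointly_measurable_transpose.
    - by apply: ae_impl hK.2 => y; under eq_integral do rewrite (dz_m_sym S).
    - exact: c0 hK.
    - exact: cmeas_normc.
    - by move=> x; exact: normc_ge0.
  have key : (wint F <= wint F0 + (c1%:E * wint F1 + c2%:E * wint F2))%E.
    apply: le_trans (leeD (lexx _) (leeD (wK _ _ _ mF1 mK1 K10 hK1) (wK _ _ _ mF2 mK2 K20 hK2))).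
    have mJ G K (mG : cmeas G) (mK : jointly_measurable K) (K0 : forall x y, 0 <= K x y) :
        measurable_fun setT ((fun x => (\int[mu]_y (normc (G y) * K x y)%:E) * (v x)%:E)%E : borel X -> \bar R).
      by apply: emeasurable_funM; [exact: mI|exact/measurable_EFinP].
    have J0 G K x : (forall x y, 0 <= K x y) ->
        (0 <= (\int[mu]_y (normc (G y) * K x y)%:E) * (v x)%:E)%E.
      by move=> K0; rewrite mule_ge0 ?I0// lee_fin.
    rewrite -ge0_integralDT; [|exact: mJ|exact: mJ|by move=> x; exact: J0|by move=> x; exact: J0].
    rewrite -ge0_integralDT; last 4 first.
    + by apply/measurable_EFinP; exact: (wint_meas S).
    + by apply: emeasurable_funD; exact: mJ.
    + by move=> x; rewrite lee_fin mulr_ge0 ?normc_ge0.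
    + by move=> x; rewrite adde_ge0 ?J0.
    apply: ge0_le_integralT.
    + by apply/measurable_EFinP; exact: (wint_meas S).
    + apply: emeasurable_funD; first by apply/measurable_EFinP; exact: (wint_meas S).
      by apply: emeasurable_funD; exact: mJ.
    + by move=> x; rewrite lee_fin mulr_ge0 ?normc_ge0.
    + move=> x; have v0 : (0 <= (m x z)%:E)%E by rewrite lee_fin.
      rewrite !EFinM; apply: le_trans (lee_wpmul2r v0 (hF x)) _.
      have [a0 b0] := (I0 F1 K1 x K10, I0 F2 K2 x K20).
      rewrite ge0_muleDl ?lee_fin ?normc_ge0//; last exact: adde_ge0.
      by rewrite ge0_muleDl.
  have hL : L1v F.
    apply/L1wP; split => //; apply: le_lt_trans key _.
    have [c10 c20] := (c0 _ _ K10 hK1, c0 _ _ K20 hK2).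
    apply: lte_add_pinfty => //.
    by apply: lte_add_pinfty; apply: lte_mul_pinfty; rewrite ?lee_fin.
  split => //; rewrite -lee_fin L1w_norm_fin//; apply: le_trans key _.
  by rewrite !EFinD !EFinM !L1w_norm_fin.
- move=> u F hu hC uF.
  have mu_ n : cmeas (u n) := ((L1wP (u n)).1 (hu n)).1.
  have mF : cmeas F by exact: (@cmeas_cvg _ _ (borel X) u F mu_ uF).
  have luB p n : L1v (fun x => u p x - u n x).
    have := L1w_lin (-1) (hu n) (hu p).
    by congr (L1w _ _ _); apply/funext => x; rewrite mulN1r addrC.
  have key e : 0 < e -> exists n0, forall n, (n0 <= n)%N ->
      (wint (fun x => (u n x - F x)%R) <= e%:E)%E.
    move=> /hC[n0 hn0]; exists n0 => n nn; apply: (wint_complete (n0 := n0) mu_ uF (mu_ n)) => p np.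
    by rewrite -L1w_norm_fin// lee_fin ltW// hn0.
  have luF n0 : (wint (fun x => (u n0 x - F x)%R) < +oo)%E -> L1v F.
    move=> h; have hd : L1v (fun x => u n0 x - F x) by apply/L1wP; split => //; exact: cmeasB.
    have := L1w_lin (-1) hd (hu n0); congr (L1w _ _ _).
    by apply/funext => x; rewrite mulN1r opprB subrK.
  have [n1 hn1] := key 1 ltr01.
  split; first by apply: (luF n1); apply: le_lt_trans (hn1 n1 (leqnn _)) _; rewrite ltry.
  apply/cvgrPdist_le => e e0; have [n0 hn0] := key e e0; exists n0 => // n /= nn.
  rewrite sub0r normrN ger0_norm; last by apply: fine_ge0; exact: (wint_ge0 S).
  have hle := hn0 n nn.
  rewrite -lee_fin L1w_norm_fin//; apply/L1wP; split; first exact: cmeasB.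
  by apply: le_lt_trans hle _; rewrite ltry.
(* In [L^1_v] the pointwise bound comes from the boundedness of [k] in the reproducing formula,
   together with [v >= 1]. *)
- have [B B0 hB] := dz_k_bnd S; exists B => // F MF LF x.
  have mF := rp_meas MF.
  rewrite (rp_eq MF x); apply: cintegral_le; first exact: (reproduced_cintegrable S hCk).
  apply: (@le_trans _ _ (\int[mu]_y (B * (normc (F y) * v y))%:E)%E).
    apply: le_integral_R.
    + by apply: cmeas_normc; apply: cmeasM => //; exact: (k_measl S).
    + by apply: measurable_funM => //; exact: (wint_meas S).
    + by move=> y; exact: normc_ge0.
    + move=> y; rewrite normcM mulrC; apply: ler_pM; rewrite ?normc_ge0//.
      by rewrite ler_peMr ?normc_ge0// (dz_m_ge1 S).
  rewrite ge0_integral_RZ//; last 2 first.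
  + exact: (wint_meas S).
  + by move=> y; rewrite mulr_ge0 ?normc_ge0.
  rewrite -[X in (_ * X)%E]/(wint F) -L1w_norm_fin// -EFinM lee_fin.
  apply: ler_wpM2r; first by apply: fine_ge0; exact: (wint_ge0 S).
  by rewrite ler_peMr// (dz_m_ge1 S).
Qed.

End WeightedL1.

Section IntegrationOn.
Context {R : realType} {d : measure_display} {T : measurableType d}.
Variable mu : {measure set T -> \bar R}.

Lemma cintegrable_onP (D : set T) (f : T -> R[i]) : measurable D ->
  cmeasurable setT f ->
  cintegrable mu D f <-> (\int[mu]_(x in D) (normc (f x))%:E < +oo)%E.
Proof.
move=> mD mf; have [mR mI] := mf.
have mN (h : T -> R) : measurable_fun setT h ->
    measurable_fun D (fun x => (`|h x|)%:E).
  move=> mh; apply/measurable_EFinP/measurable_funTS.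
  exact: (measurableT_comp (@normr_measurable R setT)).
have mfn : measurable_fun D (fun x => (normc (f x))%:E).
  by apply: measurable_funTS; exact: cmeas_enormc.
split=> [[/integrableP[_ i1] /integrableP[_ i2]]|i].
  apply: (@le_lt_trans _ _ (\int[mu]_(x in D) ((`|Re (f x)|)%:E + (`|Im (f x)|)%:E))%E).
    apply: ge0_le_integral => //.
    - by move=> x _; rewrite lee_fin normc_ge0.
    - by apply: emeasurable_funD; exact: mN.
    - by move=> x _; rewrite -EFinD lee_fin normc_le_ReIm.
  by rewrite ge0_integralD//; [rewrite lte_add_pinfty|exact: mN|exact: mN].
split; apply/integrableP; split.
- by apply/measurable_EFinP; exact: measurable_funTS.
- apply: le_lt_trans i; apply: ge0_le_integral => //; first exact: mN.
  by move=> x _; rewrite lee_fin Re_le_normc.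
- by apply/measurable_EFinP; exact: measurable_funTS.
- apply: le_lt_trans i; apply: ge0_le_integral => //; first exact: mN.
  by move=> x _; rewrite lee_fin Im_le_normc.
Qed.

Lemma ae_countable {J : countType} (P : J -> T -> Prop) :
  (forall j, {ae mu, forall x, P j x}) -> {ae mu, forall x, forall j, P j x}.
Proof.
move=> h; have := @ae_foralln _ _ _ mu (fun n x => if @choice.unpickle J n is Some j then P j x else True).
have h' n : \forall x \ae mu, if @choice.unpickle J n is Some j then P j x else True.
  by case: choice.unpickle => [j|]; [exact: h|exact: aeW].
move=> /(_ h'); apply: ae_impl => x H j.
by have := H (choice.pickle j); rewrite choice.pickleK.
Qed.

Lemma integral_normc_on_eq0 (D : set T) (f : T -> R[i]) : measurable D ->
  cmeasurable setT f -> (\int[mu]_(x in D) (normc (f x))%:E = 0)%E ->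
  {ae mu, forall x, D x -> f x = 0}.
Proof.
move=> mD mf i0.
have mfn : measurable_fun D (fun x => (normc (f x))%:E).
  by apply: measurable_funTS; exact: cmeas_enormc.
have [h _] := ae_eq_integral_abs mu mD mfn.
have /h : (\int[mu]_(x in D) `|(normc (f x))%:E| = 0)%E.
  by rewrite -[RHS]i0; apply: eq_integral => x _ /=; rewrite ger0_norm ?normc_ge0.
by apply: ae_impl => x hx Dx; apply: normc_eq0; have [] := hx Dx.
Qed.

End IntegrationOn.

Section BorelSets.
Context {X : ptopologicalType}.

Lemma open_borel (O : set X) : open O -> measurable (O : set (borel X)).
Proof. by move=> oO; exact: sub_sigma_algebra. Qed.

Lemma closed_borel (A : set X) : closed A -> measurable (A : set (borel X)).
Proof.
by move=> cA; rewrite -[A]setCK; apply: measurableC; apply: open_borel; exact: closed_openC.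
Qed.

Lemma compact_borel (K : set X) : hausdorff_space X -> compact K ->
  measurable (K : set (borel X)).
Proof. by move=> hX cK; apply: closed_borel; exact: compact_closed. Qed.

End BorelSets.

Section SolidSpace.
Context {R : realType} {X : ptopologicalType} {I : countType} (i0 : I).
Variable mu : {measure set (borel X) -> \bar R}.
Variables (k : X -> X -> R[i]) (o m : X -> X -> R) (z : X) (U : I -> set X)
  (xs : I -> X) (D Cm nk no : R) (N : nat).
Hypothesis S : discretization mu k o m z U xs D Cm nk no N.

Local Notation cmeas F := (cmeasurable setT (F : borel X -> R[i])).
Variables (Y : set (X -> R[i])) (NY : (X -> R[i]) -> R).
Hypotheses (hXsc : sigma_compact X) (hXh : hausdorff_space X)
  (hKfin : forall K : set X, compact K -> (mu K < +oo)%E)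
  (hpre : forall i, precompact (U i)) (hY1 : Y1 mu Y NY) (hY2 : Y2 mu Y NY m).

(** Local integrability gives measurability on each compact set; countably many of these cover
    [X]. *)
Lemma Y_meas F : Y F -> cmeas F.
Proof.
have [_ _ YL _ _] := hY1; move=> /YL hF; have [K [cK UK]] := hXsc.
have mK n : measurable (K n : set (borel X)) by exact: compact_borel (cK n).
split; rewrite -UK; apply/measurable_fun_bigcup => // n; apply/measurable_EFinP.
  by have [/integrableP[]] := hF _ (cK n).
by have [_ /integrableP[]] := hF _ (cK n).
Qed.

(** The solidity axiom asks for local integrability of [F]; a measurable [F] inherits it from the
    dominating [G]. *)
Lemma solidY F G : cmeas F -> Y G -> {ae mu, forall x, normc (F x) <= normc (G x)} ->
  Y F /\ NY F <= NY G.
Proof.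
move=> mF YG FG; have [_ _ YL _ sol] := hY1; apply: sol => // K cK.
have mK := compact_borel hXh cK.
apply/(cintegrable_onP mu mK mF).
apply: (@le_lt_trans _ _ (\int[mu]_(x in K) (normc (G x))%:E)%E); last first.
  by apply/(cintegrable_onP mu mK (Y_meas YG)); exact: YL.
apply: ae_ge0_le_integral => //.
- by move=> x _; rewrite lee_fin normc_ge0.
- by apply: measurable_funTS; exact: cmeas_enormc.
- by move=> x _; rewrite lee_fin normc_ge0.
- by apply: measurable_funTS; exact: cmeas_enormc (Y_meas YG).
- by apply: ae_impl FG => x FGx _; rewrite lee_fin.
Qed.

Lemma absY F : Y F -> Y (fun x => (normc (F x))%:C) /\ NY (fun x => (normc (F x))%:C) <= NY F.
Proof.
move=> YF; have mF := Y_meas YF; apply: solidY => //.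
  by apply: cmeas_real; exact: cmeas_normc.
by apply: aeW => x; rewrite normc_ge0_real ?normc_ge0.
Qed.

Lemma kernel_bound_ge0 K c : (forall x y, 0 <= K x y) -> kernel_bound mu m K c -> 0 <= c.
Proof.
move=> K0 [aK _]; have [x _] := ae_exists_U S i0 aK; rewrite -lee_fin; apply: le_trans.
by apply: integral_ge0 => y _; rewrite lee_fin mulr_ge0 ?(m_ge0 S).
Qed.

(** (Y2) is applied to [|F|] and the real kernel, so that the resulting integral is that of a
    nonnegative function. It may be infinite on a null set; hence a representative [G] and equality
    almost everywhere. *)
Lemma kernelY K c F : jointly_measurable K -> (forall x y, 0 <= K x y) ->
  kernel_bound mu m K c -> Y F ->
  exists G, [/\ Y G, NY G <= c * NY F &
    {ae mu, forall x, (\int[mu]_y (normc (F y) * K x y)%:E = (normc (G x))%:E)%E}].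
Proof.
move=> mK K0 hK YF; have [YaF hNaF] := absY YF.
have m0 x y : 0 <= m x y := m_ge0 S x y.
have c0 := kernel_bound_ge0 K0 hK.
pose Kc x y := (K x y)%:C : R[i].
have E x y : normc (weighted m Kc x y) = K x y * m x y.
  by rewrite /weighted normcM !normc_ge0_real.
have A1c : (A1_norm mu (weighted m Kc) <= c%:E)%E.
  rewrite /A1_norm ge_max; apply/andP; split; apply/ess_supP.
    by apply: ae_impl hK.1 => x; under [X in _ -> (X <= _)%E]eq_integral do rewrite E.
  by apply: ae_impl hK.2 => x; under [X in _ -> (X <= _)%E]eq_integral do rewrite E.
have AmK : Am mu m Kc.
  split; last by apply: le_lt_trans A1c _; rewrite ltry.
  apply: cmeasM; first exact: cmeas_real.
  by apply: cmeas_real; exact: (dz_m_meas S).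
have AmKc : Am_norm mu m Kc <= c.
  (* In the case of the value [-oo], [fine] returns 0, which is below [c] by [c0]. *)
  rewrite /Am_norm; case: (A1_norm mu (weighted m Kc)) A1c => [r|//|_] /=.
    by rewrite lee_fin.
  by [].
have [aI YG NG] := hY2 AmK YaF.
have bY : is_banach [set F | {ae mu, forall x, F x = 0}] Y NY by case: hY1.
exists (kernel_op mu Kc (fun x => (normc (F x))%:C)); split => //.
  apply: le_trans NG _; apply: (le_trans (ler_wpM2r (banach_ge0 bY YaF) AmKc)).
  by rewrite ler_wpM2l.
apply: ae_impl aI => x [i1 _].
have Ex : (fun y => Re ((normc (F y))%:C * Kc x y)) = (fun y => normc (F y) * K x y).
  by apply/funext => y; rewrite ReM /= mulr0 subr0.
have Ei : (fun y => Im ((normc (F y))%:C * Kc x y)) = (fun=> 0).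
  by apply/funext => y; rewrite ImM /= mul0r mulr0 addr0.
have r0 : 0 <= Rintegral mu setT (fun y => normc (F y) * K x y).
  by apply: Rintegral_ge0 => y _; rewrite mulr_ge0 ?normc_ge0.
have -> : kernel_op mu Kc (fun x => (normc (F x))%:C) x =
    (Rintegral mu setT (fun y => normc (F y) * K x y))%:C.
  rewrite /kernel_op /cintegral Ex Ei; congr (_ +i* _).
  by rewrite /Rintegral integral0_eq.
rewrite normc_ge0_real// /Rintegral fineK//.
have -> : (fun y => (normc (F y) * K x y)%:E) =
    (fun y => (Re ((normc (F y))%:C * Kc x y))%:E).
  by apply/funext => y; rewrite -[RHS]/((fun y => (Re ((normc (F y))%:C * Kc x y)) ) y)%:E Ex.
exact: integrable_fin_num.
Qed.

Lemma bY : is_banach [set F | {ae mu, forall x, F x = 0}] Y NY.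
Proof. by case: hY1. Qed.

Lemma Y_dom F0 F1 F2 K1 K2 c1 c2 F : Y F0 -> Y F1 -> Y F2 ->
  jointly_measurable K1 -> (forall x y, 0 <= K1 x y) -> kernel_bound mu m K1 c1 ->
  jointly_measurable K2 -> (forall x y, 0 <= K2 x y) -> kernel_bound mu m K2 c2 ->
  cmeas F ->
  (forall x, ((normc (F x))%:E <= (normc (F0 x))%:E +
    (\int[mu]_y (normc (F1 y) * K1 x y)%:E +
     \int[mu]_y (normc (F2 y) * K2 x y)%:E))%E) ->
  Y F /\ NY F <= NY F0 + (c1 * NY F1 + c2 * NY F2).
Proof.
move=> Y0 Y1' Y2' mK1 K10 hK1 mK2 K20 hK2 mF h.
have [G1 [YG1 NG1 E1]] := kernelY mK1 K10 hK1 Y1'.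
have [G2 [YG2 NG2 E2]] := kernelY mK2 K20 hK2 Y2'.
have [Ya0 N0] := absY Y0; have [Ya1 N1] := absY YG1; have [Ya2 N2] := absY YG2.
set a0 := (fun x => (normc (F0 x))%:C) in Ya0 N0 *.
set a1 := (fun x => (normc (G1 x))%:C) in Ya1 N1 *.
set a2 := (fun x => (normc (G2 x))%:C) in Ya2 N2 *.
have bYD (f g : X -> R[i]) : Y f -> Y g -> Y (f + g).
  by move=> Yf Yg; have := banach_lin bY 1 Yf Yg; rewrite scale1r.
have Y12 := bYD _ _ Ya1 Ya2; have Y012 := bYD _ _ Ya0 Y12.
have [|YF NF] := solidY mF Y012.
  apply: ae_impl (ae_and E1 E2) => x [e1 e2].
  have -> : normc ((a0 + (a1 + a2)) x) = normc (F0 x) + (normc (G1 x) + normc (G2 x)).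
    rewrite -[LHS]/(normc ((normc (F0 x))%:C + ((normc (G1 x))%:C + (normc (G2 x))%:C))).
    by rewrite -!real_complexD normc_ge0_real// !addr_ge0 ?normc_ge0.
  by rewrite -lee_fin !EFinD -e1 -e2; exact: h.
split=> //; apply: le_trans NF _; apply: le_trans (banach_normD bY Ya0 Y12) _.
apply: lerD => //; apply: le_trans (banach_normD bY Ya1 Ya2) _.
by apply: lerD; [exact: le_trans NG1|exact: le_trans NG2].
Qed.

(** Completeness provides a norm limit [L], which has to be identified with the pointwise limit [F].
    The embedding into [L^1_loc] and Fatou show that [F - L] has integral 0 on each compact set of
    the exhaustion, so [F] and [L] agree almost everywhere. *)
Lemma Y_complete (u : nat -> X -> R[i]) F : (forall n, Y (u n)) ->
  (forall eps : R, 0 < eps -> exists n0 : nat, forall p q : nat,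
     (n0 <= p)%N -> (n0 <= q)%N -> NY (fun x => u p x - u q x) < eps) ->
  (forall x, (fun n => normc (u n x - F x)) @ \oo --> (0 : R)) ->
  Y F /\ (fun n => NY (fun x => u n x - F x)) @ \oo --> (0 : R).
Proof.
move=> Yu uC uF; have [L YL NL] := banach_complete bY Yu uC.
have mu_ n : cmeas (u n) := Y_meas (Yu n).
have mF : cmeas F by exact: (@cmeas_cvg _ _ (borel X) u F mu_ uF).
have mL := Y_meas YL.
have YuL n : Y (u n - L).
  by have := banach_lin bY (-1) YL (Yu n); rewrite scaleN1r addrC.
have [K [cK UK]] := hXsc.
have mK n : measurable (K n : set (borel X)) by exact: compact_borel (cK n).
have [_ _ _ Yemb _] := hY1.
have FL : {ae mu, forall x, F x = L x}.
  have FLn n : {ae mu, forall x, K n x -> F x - L x = 0}.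
    apply: (@integral_normc_on_eq0 _ _ (borel X) mu (K n) (fun x => F x - L x)) => //.
      exact: cmeasB.
    apply/eqP; rewrite eq_le; apply/andP; split; last first.
      by apply: integral_ge0 => x _; rewrite lee_fin normc_ge0.
    have [C hC] := Yemb _ (cK n).
    apply/lee_addgt0Pr => e e0; rewrite add0e.
    (* The embedding constant [C] has no prescribed sign, hence the positive substitute. *)
    have C1 : 0 < `|C| + 1 by rewrite ltr_wpDl.
    have [n0 hn0] : exists n0, forall p, (n0 <= p)%N -> NY (u p - L) <= e / (`|C| + 1).
      move/cvgrPdist_le: NL => /(_ (e / (`|C| + 1)) (divr_gt0 e0 C1))[n0 _ hn0].
      exists n0 => p /hn0 /=; rewrite sub0r normrN; apply: le_trans; exact: ler_norm.
    apply: (@fatou_le _ _ (borel X) mu (K n) (mK n)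
      (fun p x => (normc (u (n0 + p)%N x - L x))%:E)).
    - by move=> p; apply: measurable_funTS; apply: cmeas_enormc; exact: cmeasB.
    - by move=> p x _; rewrite lee_fin normc_ge0.
    - move=> x _; apply: cvg_EFin; first by apply: nearW.
      apply/cvgrPdist_le => e' e'0.
      move/cvgrPdist_le: (uF x) => /(_ e' e'0)[n1 _ hn]; exists n1 => // p /= np.
      have /= := hn (n0 + p)%N (leq_trans np (leq_addl _ _)).
      rewrite sub0r normrN ger0_norm ?normc_ge0//; apply: le_trans.
      rewrite ler_norml; apply/andP; split.
        rewrite lerNl opprB lerBlDr.
        by apply: le_trans (normc_triangle _ (F x) _) _.
      rewrite lerBlDr (normcBC (u _ x) (F x)); exact: normc_triangle.
    - move=> p; apply: le_trans (hC _ (YuL (n0 + p)%N)) _; rewrite lee_fin.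
      have N0 := banach_ge0 bY (YuL (n0 + p)%N).
      apply: (@le_trans _ _ ((`|C| + 1) * NY (u (n0 + p)%N - L))).
        by apply: ler_wpM2r => //; apply: le_trans (ler_norm _) _; rewrite lerDl.
      by rewrite mulrC -ler_pdivlMr// hn0// leq_addr.
  apply: ae_impl (ae_countable FLn) => x hx.
  have : (\bigcup_n K n) x by rewrite UK.
  by move=> [n _ Knx]; apply/eqP; rewrite -subr_eq0; apply/eqP; exact: hx Knx.
have YF : Y F.
  by apply: (solidY mF YL _).1; apply: ae_impl FL => x ->.
split => //.
have YuF n : Y (u n - F).
  by have := banach_lin bY (-1) YF (Yu n); rewrite scaleN1r addrC.
apply: (squeeze_cvgr _ (@cvg_cst _ (0 : R) _ _ _) NL); apply: nearW => n.
apply/andP; split; first exact: (banach_ge0 bY (YuF n)).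
apply: (solidY _ (YuL n) _).2; first exact: cmeasB.
by apply: ae_impl FL => x; rewrite -[(u n - L) x]/(u n x - L x) => ->.
Qed.

End SolidSpace.

Section CoverIndicators.
Context {R : realType} {X : ptopologicalType} {I : countType} (i0 : I).
Variable mu : {measure set (borel X) -> \bar R}.
Variables (k : X -> X -> R[i]) (o m : X -> X -> R) (z : X) (U : I -> set X)
  (xs : I -> X) (D Cm nk no : R) (N : nat).
Hypothesis S : discretization mu k o m z U xs D Cm nk no N.
Variable Ck : R.
Hypothesis hCk : 0 <= Ck /\
  forall x, (\int[mu]_y (normc (k x y) * m x y)%:E <= Ck%:E)%E.

Local Notation v := (fun x => m x z).
Local Notation cmeas F := (cmeasurable setT (F : borel X -> R[i])).
Local Notation muR i := (fine (mu (U i))).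
Variables (Y : set (X -> R[i])) (NY : (X -> R[i]) -> R).
Hypotheses (hXsc : sigma_compact X) (hXh : hausdorff_space X)
  (hKfin : forall K : set X, compact K -> (mu K < +oo)%E)
  (hpre : forall i, precompact (U i)) (hY1 : Y1 mu Y NY) (hY2 : Y2 mu Y NY m).

Definition cover_indic (j : I) : X -> R[i] := fun x => (\1_(U j) x : R)%:C.
Local Notation chi := cover_indic.

Lemma normc_cover_indic j x : normc (chi j x) = \1_(U j) x.
Proof. by rewrite normc_ge0_real. Qed.

Lemma cover_indic_meas j : cmeas (chi j).
Proof. by apply: cmeas_real; exact: (indicU_meas S). Qed.

(** A rank-one kernel: it maps [|F|] to the constant [t] times the integral of [|F|] over [U i],
    placed on [U j]. Through (Y2) it compares members of [Y] carried by different covering sets. *)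
Definition box_kernel (t : R) (i j : I) : X -> X -> R :=
  fun x y => t * (\1_(U j) x * \1_(U i) y).

Lemma box_kernel_ge0 t i j : 0 <= t -> forall x y, 0 <= box_kernel t i j x y.
Proof. by move=> t0 x y; rewrite !mulr_ge0. Qed.

Lemma box_kernel_meas t i j : jointly_measurable (box_kernel t i j).
Proof.
apply: measurable_funM => //; apply: measurable_funM.
  exact: (fst_meas (indicU_meas S j)).
exact: (jointly_measurable_transpose (fst_meas (indicU_meas S i))).
Qed.

Lemma box_kernel_bound t i j : 0 <= t ->
  kernel_bound mu m (box_kernel t i j)
    (t * (Cm * Cm * m (xs j) (xs i) * (muR i + muR j))).
Proof.
move=> t0; have m0 x y : 0 <= m x y := m_ge0 S x y.
have Cm0 := Cm_ge0 i0 S.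
(* [M] bounds the weight for [x] in [U j] and [y] in [U i], by passing through the nodes [xs j] and
   [xs i]. The sum [muR i + muR j] in the constant serves both marginals. *)
pose M := Cm * Cm * m (xs j) (xs i).
have M0 : 0 <= M by rewrite !mulr_ge0.
have mle x y : box_kernel t i j x y * m x y <= t * M * (\1_(U j) x * \1_(U i) y).
  rewrite /box_kernel !indicE.
  case: (boolP (x \in U j)) => [/set_mem xj|_]; last by rewrite !mul0r !mulr0 mul0r.
  case: (boolP (y \in U i)) => [/set_mem yi|_]; last by rewrite !mulr0 mul0r.
  rewrite !mulr1 ler_wpM2l// /M.
  apply: le_trans (dz_m_sub S x y (xs j)) _; rewrite -!mulrA; apply: ler_pM => //.
    exact: (dz_Cm S xj (dz_xs S j)).
  apply: le_trans (dz_m_sub S _ y (xs i)) _; rewrite [leRHS]mulrC ler_wpM2l//.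
  exact: (dz_Cm S (dz_xs S i) yi).
have indic1 (A : set X) x : (\1_A x : R) <= 1 by rewrite indicE; case: (_ \in _).
have mK := box_kernel_meas t i j; have mm := dz_m_meas S.
have mKm : jointly_measurable (fun x y => box_kernel t i j x y * m x y) by exact: measurable_funM.
have K0 := box_kernel_ge0 i j t0.
have [mi0 mj0] : 0 <= muR i /\ 0 <= muR j by split; apply: ltW; exact: (muR_gt0 S).
have tM0 : 0 <= t * M by rewrite mulr_ge0.
split; apply: aeW => x.
  apply: (@le_trans _ _ (\int[mu]_y (t * M * \1_(U i) y)%:E)%E).
    apply: le_integral_R.
    - exact: (jointly_measurablel x mKm).
    - by apply: measurable_funM => //; exact: (indicU_meas S).
    - by move=> y; rewrite mulr_ge0.
    - by move=> y; apply: le_trans (mle x y) _; rewrite ler_wpM2l// ler_piMl.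
  rewrite ge0_integral_RZ//; last exact: (indicU_meas S).
  by rewrite -(mu_indicU S) (muRE S) -EFinM lee_fin -[leLHS]mulrA;
    do 2!(apply: ler_wpM2l => //); rewrite lerDl.
apply: (@le_trans _ _ (\int[mu]_y (t * M * \1_(U j) y)%:E)%E).
  apply: le_integral_R.
  - exact: (jointly_measurabler x mKm).
  - by apply: measurable_funM => //; exact: (indicU_meas S).
  - by move=> y; rewrite mulr_ge0.
  - by move=> y; apply: le_trans (mle y x) _; rewrite ler_wpM2l// ler_piMr.
rewrite ge0_integral_RZ//; last exact: (indicU_meas S).
by rewrite -(mu_indicU S) (muRE S) -EFinM lee_fin -[leLHS]mulrA;
    do 2!(apply: ler_wpM2l => //); rewrite lerDr.
Qed.

Lemma box_kernel_integral t i j (F : X -> R[i]) x : 0 <= t -> cmeas F ->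
  (\int[mu]_y (normc (F y) * box_kernel t i j x y)%:E =
   (t * \1_(U j) x)%:E * \int[mu]_(y in U i) (normc (F y))%:E)%E.
Proof.
move=> t0 mF; have nF := cmeas_normc mF.
rewrite [in RHS]integral_mkcond -ge0_integralZT ?mulr_ge0//; last 2 first.
- apply/(measurable_restrictT _ (dz_U_meas S i)); apply: measurable_funTS.
  exact/measurable_EFinP.
- by move=> y; rewrite patchE; case: ifP => // _; rewrite lee_fin normc_ge0.
apply: eq_integral => y _; rewrite patchE /box_kernel !indicE.
by case: ifP => _; rewrite ?mulr1 ?mulr0 ?mule0 -?EFinM//; congr EFin; ring.
Qed.

(** A nonzero [F] in [Y] cannot be null on all of the countably many covering sets. The integral is
    finite because the closure of [U i] is compact. *)
Lemma Y_nontrivial : exists F i, [/\ Y F, (0 < \int[mu]_(x in U i) (normc (F x))%:E)%E &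
  (\int[mu]_(x in U i) (normc (F x))%:E < +oo)%E].
Proof.
have [_ [F YF NF] YL _ _] := hY1; have mF := Y_meas hXsc hXh hY1 YF.
suff [i hi] : exists i, (0 < \int[mu]_(x in U i) (normc (F x))%:E)%E.
  exists F, i; split => //.
  have cK : compact (closure (U i)) by rewrite -precompactE.
  have mK := compact_borel hXh cK.
  apply: (@le_lt_trans _ _ (\int[mu]_(x in closure (U i)) (normc (F x))%:E)%E).
    apply: ge0_subset_integral => //.
    - exact: (dz_U_meas S).
    - by apply: measurable_funTS; exact: cmeas_enormc.
    - by move=> x _; rewrite lee_fin normc_ge0.
    - exact: subset_closure.
  by apply/(cintegrable_onP mu mK mF); exact: YL.
apply: contrapT => h.
move/eqP: NF; apply; apply/(banach_eq0 (bY hY1) YF).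
have F0 i : {ae mu, forall x, U i x -> F x = 0}.
  apply: (@integral_normc_on_eq0 _ _ (borel X) mu (U i) F (dz_U_meas S i) mF).
  apply/eqP; rewrite eq_le; apply/andP; split; last first.
    by apply: integral_ge0 => x _; rewrite lee_fin normc_ge0.
  by rewrite leNgt; apply/negP => hi; apply: h; exists i.
apply: ae_impl (ae_countable F0) => x hx.
by have [i ix] := dz_U_cov S x; exact: hx ix.
Qed.

Lemma Y0 : Y (fun=> 0). Proof. exact: (banach_0 (bY hY1)). Qed.

Lemma NY0 : NY (fun=> 0) = 0.
Proof. by apply/(banach_eq0 (bY hY1) Y0); exact: aeW. Qed.

Lemma box_domination t i j F G : 0 <= t -> Y F -> cmeas G ->
  (forall x, ((normc (G x))%:E <= (t * \1_(U j) x)%:E *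
     \int[mu]_(y in U i) (normc (F y))%:E)%E) ->
  Y G /\ NY G <= t * (Cm * Cm * m (xs j) (xs i) * (muR i + muR j)) * NY F.
Proof.
move=> t0 YF mG h; have mF := Y_meas hXsc hXh hY1 YF.
have [mK K0 hK] := And3 (box_kernel_meas t i j) (box_kernel_ge0 i j t0) (box_kernel_bound i j t0).
have [|YG NG] := Y_dom i0 S hXsc hXh hY1 hY2 Y0 YF Y0 mK K0 hK mK K0 hK mG.
  move=> x; rewrite normc00 add0e box_kernel_integral//.
  apply: le_trans (h x) _; rewrite leeDl//.
  by apply: integral_ge0 => y _; rewrite lee_fin mulr_ge0 ?normc_ge0.
by split => //; rewrite NY0 mulr0 addr0 add0r in NG.
Qed.

(** A box kernel carries a function with positive mass on some [U i] to [U j]; dividing by that mass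
    yields exactly the indicator. *)
Lemma cover_indic_Y j : Y (chi j).
Proof.
have [F [i [YF F0 Fi]]] := Y_nontrivial.
pose al := fine (\int[mu]_(x in U i) (normc (F x))%:E)%E.
have al0 : 0 < al by rewrite fine_gt0// F0 Fi.
have [||YG _] := @box_domination al^-1 i j F (chi j) _ YF (cover_indic_meas j).
- by rewrite invr_ge0 ltW.
- move=> x; rewrite normc_cover_indic.
  rewrite -(fineK (x := (\int[mu]_(x in U i) (normc (F x))%:E)%E)); last first.
    by rewrite ge0_fin_numE// ltW.
  by rewrite -EFinM lee_fin mulrAC -/al mulVf ?mul1r// gt_eqF.
by [].
Qed.

Lemma cover_indic_gt0 j : 0 < NY (chi j).
Proof.
rewrite lt_def (banach_ge0 (bY hY1) (cover_indic_Y j)) andbT; apply/eqP.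
move=> /(banach_eq0 (bY hY1) (cover_indic_Y j)) /(ae_exists_U S j)[x jx].
rewrite /chi indicE mem_set// => /(congr1 (@complex.Re R))/= /eqP.
by rewrite oner_eq0.
Qed.

(** The box kernel of height [1 / muR i] carries [chi i] to the fixed [chi i0], at a cost of order
    [m (xs i0) (xs i) <= v (xs i0) * v (xs i)]. The lower bound [D] on the measures makes the factor
    [1 + muR i0 / muR i] uniform in [i]. *)
Lemma cover_indic_lower : exists2 C, 0 <= C & forall i, 1 <= C * v (xs i) * NY (chi i).
Proof.
pose c0 := NY (chi i0); have c00 : 0 < c0 := cover_indic_gt0 i0.
have m0 x y : 0 <= m x y := m_ge0 S x y.
have Cm0 := Cm_ge0 i0 S; have D0 := dz_D_gt0 S.
exists (c0^-1 * (Cm * Cm * v (xs i0) * (1 + muR i0 / D))).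
  by rewrite !mulr_ge0 ?invr_ge0 ?(ltW c00)// addr_ge0// divr_ge0 ?ltW// (muR_gt0 S).
move=> i; have Di : D <= muR i by rewrite -lee_fin -(muRE S); exact: (dz_U_ge S).
have mi0 := muR_gt0 S i.
have [||_ N0] := @box_domination (muR i)^-1 i i0 (chi i) (chi i0) _ (cover_indic_Y i)
  (cover_indic_meas i0).
- by rewrite invr_ge0 ltW.
- move=> x; rewrite normc_cover_indic.
  rewrite (_ : (\int[mu]_(y in U i) (normc (chi i y))%:E)%E = (muR i)%:E); last first.
    rewrite -(muRE S) -[in RHS](setIid (U i)) -integral_indic//; try exact: (dz_U_meas S).
    by apply: eq_integral => y _; rewrite normc_cover_indic.
  by rewrite -EFinM lee_fin mulrAC mulVf ?mul1r// gt_eqF.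
have Ni := ltW (cover_indic_gt0 i).
rewrite -(ler_pM2l c00) mulr1; apply: le_trans N0 _.
rewrite !mulrA mulfV ?gt_eqF// mul1r; apply: ler_wpM2r => //.
have -> : (muR i)^-1 * Cm * Cm * m (xs i0) (xs i) * (muR i + muR i0) =
  Cm * Cm * m (xs i0) (xs i) * (1 + muR i0 / muR i) by field; rewrite gt_eqF.
rewrite [leRHS]mulrAC; apply: ler_pM.
- by rewrite !mulr_ge0.
- by rewrite addr_ge0// divr_ge0 ?ltW// (muR_gt0 S).
- rewrite -[leRHS]mulrA; apply: ler_wpM2l; first by rewrite mulr_ge0.
  by apply: le_trans (dz_m_sub S _ _ z) _; rewrite (dz_m_sym S z).
- by rewrite lerD2l ler_pM2l ?(muR_gt0 S)// lef_pV2 ?posrE.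
Qed.

Lemma Y_function_space : function_space mu k m z Y NY.
Proof.
have b := bY hY1.
have m0 x y : 0 <= m x y := m_ge0 S x y.
split.
- exact: Y0.
- by move=> a f g; exact: (banach_lin b).
- exact: (banach_ge0 b).
- by move=> a f; exact: (banach_normZ b).
- exact: (banach_normD b).
- exact: (Y_meas hXsc hXh hY1).
- exact: (Y_dom i0 S hXsc hXh hY1 hY2).
- exact: (Y_complete hXsc hXh hY1).
have [C C0 hC] := cover_indic_lower.
have no0 := no_ge0 i0 S; have Cm0 := Cm_ge0 i0 S.
exists (C * Cm * (1 + no)); first by rewrite !mulr_ge0// addr_ge0.
move=> F MF YF x; have [i ix] := dz_U_cov S x.
have mF := rp_meas MF; have NF := banach_ge0 b YF.
(* The constant [F x] on [U i] is dominated by [|F|] plus the oscillation bound, hence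
   [|F x| * NY (chi i) <= (1 + no) * NY F]; the lower bound on [NY (chi i)] finishes. *)
pose G y := F x * chi i y.
have mG : cmeas G by apply: cmeasM; [exact: cmeas_cst|exact: cover_indic_meas].
have mo := jointly_measurable_transpose (dz_o_meas S).
have [|YG NG] := Y_dom i0 S hXsc hXh hY1 hY2 YF YF Y0 mo (fun x y => dz_o_ge0 S y x) (oT_bound S)
    mo (fun x y => dz_o_ge0 S y x) (oT_bound S) mG.
  move=> y; rewrite /G normcM normc_cover_indic indicE.
  have I0 H : (0 <= \int[mu]_t (normc (H t) * o t y)%:E)%E.
    by apply: integral_ge0 => t _; rewrite lee_fin mulr_ge0 ?normc_ge0 ?(dz_o_ge0 S).
  case: (boolP (y \in U i)) => [/set_mem iy|_]; last first.
    by rewrite mulr0; apply: adde_ge0; [rewrite lee_fin normc_ge0|apply: adde_ge0; exact: I0].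
  rewrite mulr1; apply: le_trans (reproduced_osc_le S hCk MF iy ix) _.
  by rewrite leeD2l// leeDl// I0.
rewrite NY0 mulr0 addr0 in NG.
have := NG; rewrite (_ : NY G = normc (F x) * NY (chi i)); last first.
  by rewrite -(banach_normZ b)//; exact: cover_indic_Y.
have -> : NY F + no * NY F = (1 + no) * NY F by ring.
move=> {}NG.
have Nc0 := cover_indic_gt0 i; have nF := normc_ge0 (F x).
have vi : v (xs i) <= Cm * v x := v_cover S (dz_xs S i) ix.
apply: (@le_trans _ _ (C * v (xs i) * (normc (F x) * NY (chi i)))).
  have -> : C * v (xs i) * (normc (F x) * NY (chi i)) =
     C * v (xs i) * NY (chi i) * normc (F x) by ring.
  by rewrite ler_peMl.
have N0 : 0 <= (1 + no) * NY F by rewrite mulr_ge0// addr_ge0.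
apply: (@le_trans _ _ (C * (Cm * v x) * ((1 + no) * NY F))).
  apply: ler_pM => //; [by rewrite mulr_ge0|by rewrite mulr_ge0// ltW|].
  by rewrite ler_wpM2l.
by rewrite le_eqVlt; apply/orP; left; apply/eqP; ring.
Qed.

End CoverIndicators.

(** * Sequence spaces *)

Section SequenceSpaces.
Context {R : realType} {X : ptopologicalType} {I : countType} (i0 : I).
Variable mu : {measure set (borel X) -> \bar R}.
Variables (k : X -> X -> R[i]) (o m : X -> X -> R) (z : X) (U : I -> set X)
  (xs : I -> X) (D Cm nk no : R) (N : nat).
Hypothesis S : discretization mu k o m z U xs D Cm nk no N.

Variables (B : set (X -> R[i])) (NB : (X -> R[i]) -> R).
Hypothesis hB : function_space mu k m z B NB.
Local Notation chi := (cover_indic U).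
Hypotheses (chiB : forall i, B (chi i)) (chi_gt0 : forall i, 0 < NB (chi i)).
Local Notation step := (step_fun U).
Variable w : I -> R.
Hypothesis w_gt0 : forall i, 0 < w i.

(** With [w = 1] and [B = Y] this is [Y^flat]; with [w i = 1 / mu (U i)] it is [Y^natural]. *)
Definition seq_space : set (I -> R[i]) := [set c | B (step w c)].
Definition seq_norm (c : I -> R[i]) : R := NB (step w c).

Let w_ge0 i : 0 <= w i. Proof. exact: ltW. Qed.

Definition step_val (c : I -> R[i]) (y : X) : R :=
  \sum_(i <- fset_set [set i | U i y]) (normc (c i) * w i).

Lemma step_fun_val c y : step w c y = (step_val c y)%:C.
Proof. by rewrite /step_fun fsbig_finite//; exact: finite_U S y. Qed.

Lemma step_val_ge0 c y : 0 <= step_val c y.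
Proof. by apply: sumr_ge0 => i _; rewrite mulr_ge0 ?normc_ge0. Qed.

Lemma normc_step c y : normc (step w c y) = step_val c y.
Proof. by rewrite step_fun_val normc_ge0_real ?step_val_ge0. Qed.

Lemma step_valZ a c y : step_val (fun i => a * c i) y = normc a * step_val c y.
Proof. by rewrite /step_val mulr_sumr; apply: eq_bigr => i _; rewrite normcM mulrA. Qed.

Lemma step_val_le c c' y : (forall i, normc (c i) <= normc (c' i)) ->
  step_val c y <= step_val c' y.
Proof. by move=> h; apply: ler_sum => i _; rewrite ler_wpM2r. Qed.

Lemma step_valD c c' y : step_val (fun i => c i + c' i) y <= step_val c y + step_val c' y.
Proof.
rewrite /step_val -big_split /=; apply: ler_sum => i _.
by rewrite -mulrDl ler_wpM2r// normcD.
Qed.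

Lemma step_valB c c' y : `|step_val c y - step_val c' y| <= step_val (fun i => c i - c' i) y.
Proof.
rewrite ler_norml; apply/andP; split.
  rewrite lerNl opprB lerBlDr /step_val -big_split /=; apply: ler_sum => i _.
  rewrite -mulrDl ler_wpM2r// normcBC.
  by apply: le_trans (normcD _ _); rewrite subrK.
rewrite lerBlDr /step_val -big_split /=; apply: ler_sum => i _.
by rewrite -mulrDl ler_wpM2r//; apply: le_trans (normcD _ _); rewrite subrK.
Qed.

Lemma seq_space_le c c' : seq_space c' -> (forall i, normc (c i) <= normc (c' i)) ->
  seq_space c /\ seq_norm c <= seq_norm c'.
Proof.
move=> Bc' h; apply: (solid S hB Bc'); first exact: (step_meas i0 S).
by move=> y; rewrite !normc_step; exact: step_val_le.
Qed.

Lemma seq_spaceZ a c : seq_space c ->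
  seq_space (fun i => a * c i) /\ seq_norm (fun i => a * c i) = normc a * seq_norm c.
Proof.
move=> Bc; have E : step w (fun i => a * c i) = (fun y => (normc a)%:C * step w c y).
  by apply/funext => y; rewrite !step_fun_val step_valZ real_complexM.
rewrite /seq_space /seq_norm /= E; split; first exact: (spaceZ hB).
by rewrite (fs_normZ hB)// normc_ge0_real ?normc_ge0.
Qed.

Lemma seq_spaceD c c' : seq_space c -> seq_space c' ->
  seq_space (fun i => c i + c' i) /\ seq_norm (fun i => c i + c' i) <= seq_norm c + seq_norm c'.
Proof.
move=> Bc Bc'; have Bs := spaceD hB Bc Bc'.
have [||Bd Nd] := solid S hB (F := step w (fun i => c i + c' i)) Bs.
- exact: (step_meas i0 S).
- move=> y; rewrite normc_step !step_fun_val -real_complexD normc_ge0_real.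
    exact: step_valD.
  by rewrite addr_ge0 ?step_val_ge0.
by split => //; apply: le_trans Nd _; exact: (fs_normD hB).
Qed.

Lemma seq_spaceB c c' : seq_space c -> seq_space c' ->
  seq_space (fun i => c i - c' i) /\ seq_norm (fun i => c i - c' i) <= seq_norm c + seq_norm c'.
Proof.
move=> Bc Bc'; have [Bn Nn] := seq_spaceZ (-1) Bc'.
have := seq_spaceD Bc Bn; rewrite Nn normcN Normc.normc1 mul1r.
by rewrite (_ : (fun i => c i + -1 * c' i) = fun i => c i - c' i)//;
  apply/funext => i; rewrite mulN1r.
Qed.

Lemma seq_coord_le c i : seq_space c -> normc (c i) * (w i * NB (chi i)) <= seq_norm c.
Proof.
move=> Bc; have [||_] := solid S hB (F := fun y => ((normc (c i) * w i)%:C * chi i y)) Bc.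
- by apply: cmeasM; [exact: cmeas_cst|exact: (cover_indic_meas S)].
- move=> y; rewrite normc_step normcM normc_ge0_real ?mulr_ge0 ?normc_ge0//.
  rewrite normc_cover_indic (indicUE S) /step_val; case: ifP => iy; last first.
    by rewrite mulr0 sumr_ge0// => j _; rewrite mulr_ge0 ?normc_ge0.
  rewrite mulr1 (big_fsetD1 i)//= lerDl sumr_ge0// => j _.
  by rewrite mulr_ge0 ?normc_ge0.
rewrite (fs_normZ hB)// normc_ge0_real ?mulr_ge0 ?normc_ge0//.
by rewrite mulrA.
Qed.

Lemma seq_space_single i a : seq_space (fun j => if j == i then a else 0).
Proof.
have Bs := spaceZ hB (normc a * w i)%:C (chiB i).
apply: (solid S hB Bs _ _).1; first exact: (step_meas i0 S).
move=> y; rewrite normc_step normcM normc_cover_indic normc_ge0_real ?mulr_ge0 ?normc_ge0//.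
rewrite (indicUE S) /step_val.
rewrite (eq_bigr (fun j => if i == j then normc a * w j else 0)); last first.
  by move=> j _; rewrite eq_sym; case: ifP => _; rewrite ?normc00 ?mul0r.
rewrite (sum_pick (fun j => normc a * w j)) ?fset_uniq//.
by case: ifP; rewrite ?mulr1 ?mulr0.
Qed.

(** The map [step] takes moduli and is not linear, so limits cannot be transported through it
    directly. For fixed [n], the functions [step (u n - u p)] are Cauchy in [p] by the reverse
    triangle inequality and converge pointwise to [step (u n - l)], with [l] the coordinatewise
    limit. *)
Lemma seq_complete (u : nat -> I -> R[i]) : (forall n, seq_space (u n)) ->
  (forall e : R, 0 < e -> exists n0 : nat, forall p q : nat,
     (n0 <= p)%N -> (n0 <= q)%N -> seq_norm (fun i => u p i - u q i) < e) ->
  exists2 l, seq_space l & (fun n => seq_norm (fun i => u n i - l i)) @ \oo --> (0 : R).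
Proof.
move=> Bu uC; pose l i := climit (u ^~ i).
have ul i : (fun n => normc (u n i - l i)) @ \oo --> (0 : R).
  apply: cvg_climit => e e0.
  have c0 : 0 < w i * NB (chi i) by rewrite mulr_gt0.
  have [n0 hn0] := uC _ (mulr_gt0 e0 c0); exists n0 => p q np nq.
  rewrite -(ltr_pM2r c0); apply: le_lt_trans (hn0 _ _ np nq).
  exact: (seq_coord_le i (seq_spaceB (Bu p) (Bu q)).1).
have BuB n p : seq_space (fun i => u n i - u p i) := (seq_spaceB (Bu n) (Bu p)).1.
have key n : B (step w (fun i => u n i - l i)) /\
    (fun p => NB (fun y => step w (fun i => u n i - u p i) y -
       step w (fun i => u n i - l i) y)) @ \oo --> (0 : R).
  apply: (fs_complete hB (u := fun p => step w (fun i => u n i - u p i))).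
  - by move=> p; exact: BuB.
  - move=> e /uC[n0 hn0]; exists n0 => p q np nq; apply: le_lt_trans (hn0 _ _ nq np).
    apply: (solid S hB (BuB q p) _ _).2.
      by apply: cmeasB; exact: (step_meas i0 S).
    move=> y; rewrite !step_fun_val -real_complexB normc_real.
    rewrite normc_ge0_real ?step_val_ge0//; apply: le_trans (step_valB _ _ y) _.
    apply: step_val_le => i.
    by have -> : u n i - u p i - (u n i - u q i) = u q i - u p i by ring.
  - move=> y.
    have sl : (fun p => step_val (fun i => u p i - l i) y) @ \oo --> (0 : R).
      rewrite /step_val; elim: (enum_fset _) => [|i s ih].
        by under eq_fun do rewrite big_nil; exact: cvg_cst.
      under eq_fun do rewrite big_cons.
      have h : (fun p => normc (u p i - l i) * w i) @ \oo --> (0 * w i : R).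
        by apply: cvgMr_tmp; exact: ul.
      have := cvgD h ih; rewrite mul0r addr0; exact.
    apply: (squeeze_cvgr _ (@cvg_cst _ (0 : R) _ _ _) sl); apply: nearW => p.
    rewrite normc_ge0 andTb !step_fun_val -real_complexB normc_real.
    apply: le_trans (step_valB _ _ y) _; apply: step_val_le => i.
    have -> : u n i - u p i - (u n i - l i) = - (u p i - l i) by ring.
    by rewrite normcN.
exists l.
  have [B0 _] := key 0%N; have := (seq_spaceB (Bu 0%N) B0).1.
  rewrite (_ : (fun i => u 0%N i - _) = l)//.
  by apply/funext => i; rewrite opprB addrC subrK.
apply/cvgrPdist_le => e e0; have [n0 hn0] := uC e e0; exists n0 => // n /= nn.
rewrite sub0r normrN ger0_norm; last exact: (fs_ge0 hB (key n).1).
have [Bn cn] := key n.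
have cn0 : (fun p => NB (fun y => step w (fun i => u n i - u (n0 + p)%N i) y -
       step w (fun i => u n i - l i) y)) @ \oo --> (0 : R).
  apply/cvgrPdist_le => e' e'0; move/cvgrPdist_le: cn => /(_ e' e'0)[n1 _ h].
  by exists n1 => // p /= np; apply: h => /=; exact: leq_trans np (leq_addl _ _).
apply: (cvg0_ge cn0) => p.
apply: (@le_trans _ _ (seq_norm (fun i => u n i - u (n0 + p)%N i) +
   NB (fun y => step w (fun i => u n i - u (n0 + p)%N i) y - step w (fun i => u n i - l i) y))).
  rewrite -(space_normN hB (spaceB hB (BuB _ _) Bn)).
  apply: le_trans (fs_normD hB (BuB _ _) (spaceN hB (spaceB hB (BuB _ _) Bn))).
  rewrite le_eqVlt; apply/orP; left; apply/eqP; congr NB; apply/funext => y.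
  by rewrite opprB addrC subrK.
by rewrite lerD2r ltW// hn0// leq_addr.
Qed.

Lemma seq_bk_space : bk_space seq_space seq_norm.
Proof.
have coord0 c i : seq_space c -> normc (c i) <= seq_norm c / (w i * NB (chi i)).
  by move=> Bc; rewrite ler_pdivlMr ?mulr_gt0// seq_coord_le.
have B0 : seq_space 0.
  have := seq_space_single i0 0; congr seq_space; apply/funext => j.
  by case: ifP.
split; first split => //.
- move=> a f g Bf Bg; have [BZ _] := seq_spaceZ a Bf.
  exact: (seq_spaceD BZ Bg).1.
- by move=> f Bf; exact: (fs_ge0 hB Bf).
- move=> f Bf; split => [N0|/= ->].
    apply/funext => i; apply: normc_eq0; apply/eqP; rewrite eq_le normc_ge0 andbT.
    by apply: le_trans (coord0 f i Bf) _; rewrite N0 mul0r.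
  have [_] := seq_spaceZ 0 B0; rewrite normc00 mul0r => <-.
  by congr seq_norm; apply/funext => i; rewrite mul0r.
- by move=> a f /(seq_spaceZ a)[].
- by move=> f g Bf Bg; exact: (seq_spaceD Bf Bg).2.
- by move=> u Bu uC; exact: seq_complete.
move=> u l Bu Bl uC i.
have c0 : (fun n => seq_norm (u n - l) / (w i * NB (chi i))) @ \oo --> (0 : R).
  have := cvgMr_tmp (b := (w i * NB (chi i))^-1) uC; rewrite mul0r; exact.
apply: (squeeze_cvgr _ (@cvg_cst _ (0 : R) _ _ _) c0); apply: nearW => n.
rewrite normc_ge0 /=; apply: (coord0 (u n - l) i).
exact: (seq_spaceB (Bu n) Bl).1.
Qed.

End SequenceSpaces.

(** * Dual atoms *)

Section DualAtoms.
Context {R : realType} {X : ptopologicalType} {I : countType} (i0 : I).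
Variable mu : {measure set (borel X) -> \bar R}.
Variables (k : X -> X -> R[i]) (o m : X -> X -> R) (z : X) (U : I -> set X)
  (xs : I -> X) (D Cm nk no : R) (N : nat).
Hypothesis S : discretization mu k o m z U xs D Cm nk no N.
Variable Ck : R.
Hypothesis hCk : 0 <= Ck /\
  forall x, (\int[mu]_y (normc (k x y) * m x y)%:E <= Ck%:E)%E.

Local Notation v := (fun x => m x z).
Local Notation cint := (cintegral mu setT).
Local Notation cmeas F := (cmeasurable setT (F : borel X -> R[i])).
Local Notation cnt := (@cnt R I i0).
Local Notation smu := (dz_sigma S).
Local Notation Minf := (reproduced mu k m z).
Local Notation wint := (wint mu m z).
Variable iota : X -> I.
Hypothesis hi : (forall y, U (iota y) y) /\
  forall i, measurable ([set y | iota y = i] : set (borel X)).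
Local Notation synth := (synth i0 k xs).
Local Notation coef_bound := (coef_bound mu m z U xs).
Local Notation cw := (cell_mass mu iota).
Local Notation Cs := (sampling_const Cm no N).
Local Notation frame_sum := (frame_sum i0 mu k xs iota).
Local Notation q := (nk * no + no * (nk + no)).
Hypothesis hq : q < 1.
Local Notation L1v := (L1w mu v).
Local Notation NL1v := (L1w_norm mu v).
Local Notation P := (neumann i0 mu k xs iota).
Let hL := L1w_function_space i0 S hCk.

Lemma kernel_L1 x : L1v (k^~ x).
Proof.
apply/(L1wP S); split; first exact: (k_measr S).
by apply: le_lt_trans (wint_kernel S hCk x) _; rewrite ltry.
Qed.

Lemma kernel_L1_norm x : NL1v (k^~ x) <= Ck * v x.
Proof. by rewrite -lee_fin (L1w_norm_fin S (kernel_L1 x)); exact: (wint_kernel S hCk). Qed.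

(** The counterpart of [synth_pairing] with integrability on the other side: the coefficients are
    summable against [v (xs i)], while [A] is merely bounded by a multiple of [v]. *)
Lemma synth_pairing_bounded C c A : coef_bound C c -> Minf A ->
  (\int[cnt]_i (normc (c i) * v (xs i))%:E < +oo)%E ->
  cint (fun y => A y * Num.conj (synth c y)) =
  cintegral cnt setT (fun i => Num.conj (c i) * A (xs i)).
Proof.
move=> hc MA cfin; have mA := rp_meas MA; have [CA CA0 hA] := rp_bnd MA.
pose f (i : I) (y : X) := Num.conj (c i) * (A y * k (xs i) y).
have f1 i : cintegrable mu setT (f i).
  by apply: cintegrableZ; exact: (reproduced_cintegrable S hCk).
have fE i y : f i y = A y * Num.conj (c i * k y (xs i)).
  by rewrite /f conjCM -(dz_k_herm S); ring.
have f2 y : cintegrable cnt setT (f ^~ y).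
  have -> : f ^~ y = (fun i => A y * Num.conj (c i * k y (xs i))) by apply/funext => i.
  by apply: cintegrableZ; apply: cintegrable_conj; exact: (synth_cintegrable i0 S hCk _ hc).
transitivity (cint (fun y => cintegral cnt setT (f ^~ y))).
  congr cintegral; apply/funext => y; rewrite -cintegral_conj; last first.
    exact: (synth_cintegrable i0 S hCk _ hc).
  rewrite -cintegralZ; last by apply: cintegrable_conj; exact: (synth_cintegrable i0 S hCk _ hc).
  by congr cintegral; apply/funext => i; rewrite fE.
rewrite -(@sigma_finite_cfubini _ _ _ (discr i0) (borel X) cnt mu (sigma_finite_cnt i0) smu f)//.
- congr cintegral; apply/funext => i.
  by rewrite (rp_eq MA (xs i)) -cintegralZ//; exact: (reproduced_cintegrable S hCk).
- apply: (@cmeasurable_discr_prod R I i0 _ (borel X) f) => i.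
  exact: cintegrable_meas (f1 i).
- have Ck0 := hCk.1; have CACk0 : 0 <= CA * Ck by rewrite mulr_ge0.
  have m0 x y : 0 <= m x y := m_ge0 S x y.
  apply: (@le_lt_trans _ _ (\int[cnt]_i (CA * Ck * (normc (c i) * v (xs i)))%:E)%E); last first.
    rewrite ge0_integral_RZ//; first by rewrite lte_mul_pinfty.
    by move=> i; rewrite mulr_ge0 ?normc_ge0.
  apply: ge0_le_integralT; try exact: measurable_fun_discr.
    by move=> i; apply: integral_ge0 => y _; rewrite lee_fin normc_ge0.
  move=> i; rewrite (_ : integral _ _ _ =
      (\int[mu]_y (normc (c i) * (normc (A y) * normc (k (xs i) y)))%:E)%E); last first.
    by apply: eq_integral => y _; rewrite /f !normcM normc_conj.
  rewrite ge0_integral_RZ ?normc_ge0//; last 2 first.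
  + by apply: measurable_funM; [exact: cmeas_normc|exact: (normk_meask S)].
  + by move=> y; rewrite mulr_ge0 ?normc_ge0.
  rewrite mulrCA EFinM lee_wpmul2l ?lee_fin ?normc_ge0//.
  exact: (wbound_integral S hCk).
Qed.

Lemma scaled_kernel_reproduced a x : Minf (fun y => a * k y x).
Proof.
have M0 := reproduced0 S hCk; have := reproduced_lin S hCk a (reproduced_kernel S x) M0.
by congr reproduced; apply/funext => y; rewrite addr0.
Qed.

Lemma scaled_kernel_L1 a x : L1v (fun y => a * k y x).
Proof. exact: (spaceZ hL a (kernel_L1 x)). Qed.

Lemma neumann_L1 F : Minf F -> L1v F ->
  [/\ Minf (P F), L1v (P F), NL1v (P F) <= NL1v F / (1 - q) & frame_sum (P F) = F].
Proof.
move=> MF LF; have [h1 h2] := neumann_space i0 S hCk hi hL hq MF LF.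
split => //; first exact: (neumann_reproduced i0 S hCk hi hL hq MF LF).
exact: (frame_sum_neumann i0 S hCk hi hL hq MF LF).
Qed.

(* [P] inverts [frame_sum]; the dual atoms are its values on the normalized
   kernel functions. *)
Definition dual_atom (i : I) : X -> R[i] := P (fun y => (cw i)%:C * k y (xs i)).

Lemma dual_atomP i : [/\ Minf (dual_atom i), L1v (dual_atom i) &
  frame_sum (dual_atom i) = (fun y => (cw i)%:C * k y (xs i))].
Proof.
have [h1 h2 _ h3] := neumann_L1 (scaled_kernel_reproduced (cw i)%:C (xs i))
  (scaled_kernel_L1 (cw i)%:C (xs i)).
by split.
Qed.

Lemma sample_coef_bound F : Minf F -> exists C, coef_bound C (fun i => (cw i)%:C * F (xs i)).
Proof. exact: (frame_sum_coefE S hi). Qed.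

Lemma sample_coef_sum F : Minf F -> L1v F ->
  (\int[cnt]_i (normc ((cw i)%:C * F (xs i)) * v (xs i))%:E <= (Cs * NL1v F)%:E)%E.
Proof.
move=> MF LF; rewrite EFinM (L1w_norm_fin S LF).
apply: le_trans (sample_sum i0 S hCk MF).
have m0 x y : 0 <= m x y := m_ge0 S x y.
apply: le_integral_R; try exact: measurable_fun_discr.
  by move=> i; rewrite mulr_ge0 ?normc_ge0.
move=> i; rewrite normcM normc_ge0_real ?(cell_mass_ge0 mu iota)//.
rewrite mulrAC; apply: ler_wpM2r; first exact: normc_ge0.
by apply: ler_wpM2r => //; exact: (cell_mass_le S hi).
Qed.

(* Symmetry of [frame_sum] moves [P] from [F] to the kernel function. *)
Lemma neumann_sample B NB (hB : function_space mu k m z B NB) F i : Minf F -> B F ->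
  (cw i)%:C * P F (xs i) = cint (fun y => F y * Num.conj (dual_atom i y)).
Proof.
move=> MF BF; have [ME LE TE] := dual_atomP i.
have MA := neumann_reproduced i0 S hCk hi hB hq MF BF.
have TA := frame_sum_neumann i0 S hCk hi hB hq MF BF.
set A := P F in MA TA *.
have [C hC] := sample_coef_bound MA; have [C' hC'] := sample_coef_bound ME.
have wE : (wint (dual_atom i) < +oo)%E by have [_] := (L1wP S _).1 LE.
(* [h1] expands [F = frame_sum A] against the dual atom, [h2] expands [frame_sum] of the dual atom
   against [A]. Both give the same sum over the nodes, because the cell masses are real. *)
have h1 := synth_pairing i0 S hCk hC ME wE.
have h2 := synth_pairing_bounded hC' MA (le_lt_trans (sample_coef_sum ME LE) (ltry _)).
rewrite -[X in cint (fun y => X y * _)]TA [RHS]h1.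
transitivity (cint (fun y => A y * Num.conj (frame_sum (dual_atom i) y))); last first.
  rewrite [LHS]h2; congr cintegral; apply/funext => j.
  by rewrite conjCM conjC_real; ring.
rewrite TE (rp_eq MA (xs i)) -cintegralZ; last exact: (reproduced_cintegrable S hCk).
congr cintegral; apply/funext => y.
by rewrite conjCM conjC_real -(dz_k_herm S); ring.
Qed.

(** Applied to the kernel function at [x], [neumann_sample] shows that the values at a fixed [x] of
    all dual atoms are conjugated samples of one function in [L^1_v]. Summability over [i] then
    follows from the sampling estimate. *)
Lemma dual_atom_kernel i x : dual_atom i x = Num.conj ((cw i)%:C * P (k^~ x) (xs i)).
Proof.
have [ME LE TE] := dual_atomP i.
rewrite (neumann_sample hL i (reproduced_kernel S x) (kernel_L1 x)).
rewrite -cintegral_conj; last first.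
  have := cintegrable_conj (reproduced_cintegrable S hCk x ME).
  rewrite (_ : (fun y => Num.conj (dual_atom i y * k x y)) =
    (fun y => k y x * Num.conj (dual_atom i y)))//.
  by apply/funext => y; rewrite conjCM -(dz_k_herm S) mulrC.
rewrite {1}(rp_eq ME x); congr cintegral; apply/funext => y.
by rewrite conjCM conjCC -(dz_k_herm S) mulrC.
Qed.

Definition dual_const : R := Cs * (Ck / (1 - q)).

Lemma dual_atom_sum x :
  (\int[cnt]_i (normc (dual_atom i x) * v (xs i))%:E <= (dual_const * v x)%:E)%E.
Proof.
have [MP LP NP _] := neumann_L1 (reproduced_kernel S x) (kernel_L1 x).
under eq_integral do rewrite dual_atom_kernel normc_conj.
apply: le_trans (sample_coef_sum MP LP) _; rewrite lee_fin /dual_const -mulrA.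
apply: ler_wpM2l; first exact: (sampling_const_ge0 i0 S).
apply: le_trans NP _; rewrite mulrAC.
by apply: ler_wpM2r; [rewrite invr_ge0 subr_ge0 ltW|exact: kernel_L1_norm].
Qed.

(** Measurability and the reproducing formula pass from the dual atoms to [F] by Fubini. This is
    meant for the transform of a functional, about which only its values on atoms are known. *)
Lemma dual_expansion_reproduced C F : 0 <= C -> (forall x, normc (F x) <= C * v x) ->
  (forall x, F x = cintegral cnt setT (fun i => dual_atom i x * F (xs i))) -> Minf F.
Proof.
move=> C0 FC FE; have m0 x y : 0 <= m x y := m_ge0 S x y.
have ME i := let: And3 h _ _ := dual_atomP i in h.
pose g (y : X) (i : I) := dual_atom i y * F (xs i).
have mg : cmeasurable setT (fun p : borel X * discr i0 => g p.1 p.2).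
  have mf : cmeasurable setT (fun p : discr i0 * borel X => g p.2 p.1).
    apply: (@cmeasurable_discr_prod R I i0 _ (borel X) (fun i y => g y i)) => i.
    by apply: cmeasM; [exact: rp_meas (ME i)|exact: cmeas_cst].
  by split; [exact: (measurableT_comp mf.1 (@measurable_swap _ _ (borel X) (discr i0)))|
             exact: (measurableT_comp mf.2 (@measurable_swap _ _ (borel X) (discr i0)))].
have mF : cmeas F.
  have -> : F = (fun y => cintegral cnt setT (g y)) by apply/funext.
  exact: (@cmeas_section_cintegral _ _ _ (borel X) (discr i0) cnt (sigma_finite_cnt i0) g).
have gsum y : (\int[cnt]_i (normc (g y i))%:E <= (C * dual_const * v y)%:E)%E.
  apply: (@le_trans _ _ (\int[cnt]_i (C * (normc (dual_atom i y) * v (xs i)))%:E)%E).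
    apply: le_integral_R; try exact: measurable_fun_discr.
      by move=> i; exact: normc_ge0.
    by move=> i; rewrite normcM mulrCA ler_wpM2l ?normc_ge0.
  rewrite ge0_integral_RZ//; last by move=> i; rewrite mulr_ge0 ?normc_ge0.
  by rewrite -mulrA EFinM lee_wpmul2l ?lee_fin// dual_atom_sum.
have gi y : cintegrable cnt setT (g y).
  apply/cintegrableP; split; first exact: cmeasurable_discr.
  by apply: le_lt_trans (gsum y) _; rewrite ltry.
split => //; first by exists C.
move=> x; pose f (i : I) (y : X) := g y i * k x y.
have f1 i : cintegrable mu setT (f i).
  have := cintegrableZ (F (xs i)) (reproduced_cintegrable S hCk x (ME i)).
  by rewrite (_ : (fun y => _) = f i)//; apply/funext => y; rewrite /f /g; ring.
have f2 y : cintegrable cnt setT (f ^~ y).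
  have := cintegrableZ (k x y) (gi y).
  by rewrite (_ : (fun i => _) = f ^~ y)//; apply/funext => i; rewrite /f mulrC.
transitivity (cint (fun y => cintegral cnt setT (f ^~ y))); last first.
  congr cintegral; apply/funext => y; rewrite [in RHS]FE mulrC -cintegralZ; last exact: gi.
  by congr cintegral; apply/funext => i; rewrite /f mulrC.
have mf : cmeasurable setT (fun p : discr i0 * borel X => f p.1 p.2).
  apply: (@cmeasurable_discr_prod R I i0 _ (borel X) f) => i.
  exact: cintegrable_meas (f1 i).
rewrite -(@sigma_finite_cfubini _ _ _ (discr i0) (borel X) cnt mu (sigma_finite_cnt i0) smu f)//.
  rewrite [LHS]FE; congr cintegral; apply/funext => i.
  rewrite (rp_eq (ME i) x) mulrC -cintegralZ; last exact: (reproduced_cintegrable S hCk).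
  by congr cintegral; apply/funext => y; rewrite /f /g; ring.
have mfn := cmeas_enormc mf.
rewrite (@sigma_finite_tonelli _ _ _ (discr i0) (borel X) cnt mu (sigma_finite_cnt i0) smu
  (fun p => (normc (f p.1 p.2))%:E))//; last by move=> p; rewrite lee_fin normc_ge0.
have dc0 : 0 <= C * dual_const.
  rewrite mulr_ge0// mulr_ge0 ?(sampling_const_ge0 i0 S)//.
  by rewrite divr_ge0 ?hCk.1// subr_ge0 ltW.
have bnd y : normc (C * dual_const * v y)%:C <= C * dual_const * v y.
  by rewrite normc_ge0_real// mulr_ge0.
have mV : cmeas (fun y => (C * dual_const * v y)%:C).
  by apply: cmeas_real; apply: measurable_funM => //; exact: (v_meas S).
apply: le_lt_trans (ltry (C * dual_const * Ck * v x)).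
apply: le_trans (wbound_integral S hCk x mV dc0 bnd).
apply: ge0_le_integralT.
- apply: (@measurable_fun_section_integral _ _ _ (borel X) (discr i0) cnt (sigma_finite_cnt i0)
    (fun p => (normc (f p.2 p.1))%:E)).
    exact: (measurableT_comp mfn (@measurable_swap _ _ (borel X) (discr i0))).
  by move=> p; rewrite lee_fin normc_ge0.
- apply/measurable_EFinP; apply: measurable_funM; first exact: cmeas_normc.
  exact: (normk_meask S).
- by move=> y; apply: integral_ge0 => i _; rewrite lee_fin normc_ge0.
- move=> y; rewrite (_ : integral _ _ _ =
      (\int[cnt]_i (normc (k x y) * normc (g y i))%:E)%E); last first.
    by apply: eq_integral => i _; rewrite /f normcM mulrC.
  rewrite ge0_integral_RZ ?normc_ge0//; last by move=> i; exact: normc_ge0.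
  rewrite mulrC EFinM lee_wpmul2l ?lee_fin ?normc_ge0//.
  rewrite normc_ge0_real; last by rewrite mulr_ge0.
  exact: gsum.
Qed.

(** The remainder is dominated by the terms off [J], and each kernel function has weighted integral
    at most [Ck * v (xs i)]. Synthesis series with such coefficients therefore converge in
    [L^1_v]. *)
Lemma synth_tail C c (J : {fset I}) : coef_bound C c ->
  (\int[cnt]_i (normc (c i) * v (xs i))%:E < +oo)%E ->
  (wint (fun y => (synth c y - \sum_(i <- J) c i * k y (xs i))%R) <=
   Ck%:E * \int[cnt]_i (if i \in J then 0 else normc (c i) * v (xs i))%:E)%E.
Proof.
move=> hc cfin; have m0 x y : 0 <= m x y := m_ge0 S x y; have Ck0 := hCk.1.
pose b i := if i \in J then 0 else normc (c i).
have b0 i : 0 <= b i by rewrite /b; case: ifP => _; rewrite ?normc_ge0.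
pose f (i : I) (y : X) := (b i * (normc (k y (xs i)) * v y))%:E : \bar R.
have f0 i y : (0 <= f i y)%E by rewrite lee_fin !mulr_ge0 ?normc_ge0.
have mw i : measurable_fun setT ((fun y => normc (k y (xs i)) * v y) : borel X -> R).
  exact: (wint_meas S (k_measr S (xs i))).
have mf : measurable_fun setT (fun p : discr i0 * borel X => f p.1 p.2).
  apply: (@measurable_fun_discr_prod I i0 _ _ (borel X) _ f) => i.
  by apply/measurable_EFinP; apply: measurable_funM.
apply: (@le_trans _ _ (\int[mu]_y \int[cnt]_i f i y)%E).
  apply: ge0_le_integralT.
  - apply/measurable_EFinP; apply: (wint_meas S); apply: cmeasB.
      exact: (synth_meas i0 S).
    by apply: cmeas_sum => i _; apply: cmeasM; [exact: cmeas_cst|exact: (k_measr S)].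
  - apply: (@measurable_fun_section_integral _ _ _ (borel X) (discr i0) cnt (sigma_finite_cnt i0)
      (fun p => f p.2 p.1)) => //.
    exact: (measurableT_comp mf (@measurable_swap _ _ (borel X) (discr i0))).
  - by move=> y; rewrite lee_fin mulr_ge0 ?normc_ge0.
  - move=> y; have := synth_cintegrable i0 S hCk y hc => /cintegrableP[_ ci].
    rewrite EFinM; apply: le_trans (lee_wpmul2r _ (cintegral_cnt_sub_sum J ci)) _.
      by rewrite lee_fin.
    rewrite -ge0_integralZTr ?lee_fin//; last first.
      by move=> i; case: ifP => _; rewrite lee_fin ?normc_ge0.
    apply: ge0_le_integralT; try exact: measurable_fun_discr.
      by move=> i; rewrite mule_ge0 ?lee_fin//; case: ifP => _; rewrite ?normc_ge0.
    move=> i; rewrite /f /b -EFinM lee_fin normcM.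
    by case: ifP => _; rewrite ?mul0r// mulrA.
rewrite -(@sigma_finite_tonelli _ _ _ (discr i0) (borel X) cnt mu (sigma_finite_cnt i0) smu
  (fun p => f p.1 p.2))//.
rewrite -ge0_integral_RZ//; last by move=> i; case: ifP => _; rewrite ?mulr_ge0 ?normc_ge0.
apply: ge0_le_integralT; try exact: measurable_fun_discr.
  by move=> i; apply: integral_ge0.
move=> i; rewrite /f /= ge0_integral_RZ//; last by move=> y; rewrite mulr_ge0 ?normc_ge0.
apply: le_trans (lee_wpmul2l _ (wint_kernel S hCk (xs i))) _; first by rewrite lee_fin.
rewrite -EFinM lee_fin /b; case: ifP => _; first by rewrite mul0r mulr0.
by rewrite mulrCA.
Qed.

End DualAtoms.

Section Coefficients.
Context {R : realType} {X : ptopologicalType} {I : countType} (i0 : I).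
Variable mu : {measure set (borel X) -> \bar R}.
Variables (k : X -> X -> R[i]) (o m : X -> X -> R) (z : X) (U : I -> set X)
  (xs : I -> X) (D Cm nk no : R) (N : nat).
Hypothesis S : discretization mu k o m z U xs D Cm nk no N.
Variable Ck : R.
Hypothesis hCk : 0 <= Ck /\
  forall x, (\int[mu]_y (normc (k x y) * m x y)%:E <= Ck%:E)%E.

Local Notation v := (fun x => m x z).
Local Notation muR i := (fine (mu (U i))).
Local Notation Minf := (reproduced mu k m z).
Variable iota : X -> I.
Hypothesis hi : (forall y, U (iota y) y) /\
  forall i, measurable ([set y | iota y = i] : set (borel X)).
Local Notation synth := (synth i0 k xs).
Local Notation coef_bound := (coef_bound mu m z U xs).
Local Notation cw := (cell_mass mu iota).
Variables (B : set (X -> R[i])) (NB : (X -> R[i]) -> R).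
Hypothesis hB : function_space mu k m z B NB.
Local Notation frame_sum := (frame_sum i0 mu k xs iota).
Local Notation q := (nk * no + no * (nk + no)).
Hypothesis hq : q < 1.
Local Notation P := (neumann i0 mu k xs iota).
Local Notation E := (dual_atom i0 mu k xs iota).
Local Notation chi := (cover_indic U).
Hypotheses (chiB : forall i, B (chi i)) (chi_gt0 : forall i, 0 < NB (chi i))
  (chi_low : exists2 C : R, 0 <= C & forall i, 1 <= C * v (xs i) * NB (chi i)).
Local Notation wflat := (fun=> 1 : R).
Local Notation wnat := (fun i => (muR i)^-1).
Local Notation flat := (seq_space U B wflat).
Local Notation nat_ := (seq_space U B wnat).
Local Notation Nflat := (seq_norm U NB wflat).
Local Notation Nnat := (seq_norm U NB wnat).

Let w1 (i : I) : (0 : R) < 1. Proof. exact: ltr01. Qed.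
Let wn (i : I) : 0 < (muR i)^-1. Proof. by rewrite invr_gt0 (muR_gt0 S). Qed.

(** The entries in [J] are removed, not kept: this is the tail that remains after summation over
    [J]. *)
Definition truncate (c : I -> R[i]) (J : {fset I}) : I -> R[i] :=
  fun i => if i \in J then 0 else c i.

(** Off the support of a finitely supported approximant [c'], the sequences [c] and [c - c'] agree;
    by solidity the tail of [c] is no larger than [c - c']. *)
Lemma truncate_cvg0 w : (forall i, 0 < w i) ->
  finite_sequences_dense (seq_space U B w) (seq_norm U NB w) ->
  forall c, seq_space U B w c ->
  (fun J : {fset I} => seq_norm U NB w (truncate c J)) @ totally --> (0 : R).
Proof.
move=> w0 fd c Bc.
have tB J : seq_space U B w (truncate c J).
  apply: (seq_space_le i0 S hB w0 Bc _).1 => i.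
  by rewrite /truncate; case: ifP => _; rewrite ?normc00 ?normc_ge0.
apply: totally_cvg0 => [J|e e0]; first exact: (fs_ge0 hB (tB J)).
have [c' [Bc' fc'] ce] := fd c Bc e e0.
exists (fset_set [set i | c' i != 0]) => J sJ.
apply: le_trans (ltW ce).
have [Bd _] := seq_spaceB i0 S hB w0 Bc Bc'.
apply: (seq_space_le i0 S hB w0 Bd _).2 => i; rewrite /truncate; case: ifPn => iJ; first by rewrite normc00 normc_ge0.
suff -> : c' i = 0 by rewrite subr0.
apply/eqP; apply: contraNT iJ => ci; apply: (fsubsetP sJ).
by rewrite in_fset_set//; apply/mem_set.
Qed.

(** A single coordinate satisfies [|c i| * NB (chi i) <= muR i * Nnat c], and the indicators are
    bounded below by [1 / (C * v (xs i))]. Every sequence of [Y^natural] thus has a pointwise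
    convergent synthesis. *)
Lemma nat_coef_bound c : nat_ c -> exists C, coef_bound C c.
Proof.
move=> Bc; have [C C0 hC] := chi_low.
exists (C * Nnat c); split; first by rewrite mulr_ge0//; exact: (fs_ge0 hB Bc).
move=> i; have h := seq_coord_le S hB chiB wn i Bc.
have mu0 := muR_gt0 S i; have m0 : 0 <= v (xs i) := m_ge0 S _ _.
have h1 : normc (c i) * NB (chi i) <= muR i * Nnat c.
  by rewrite -ler_pdivrMl//; apply: le_trans h; rewrite mulrCA.
have := ler_wpM2l (normc_ge0 (c i)) (hC i); rewrite mulr1 => h2; apply: le_trans h2 _.
rewrite mulrCA; apply: le_trans (ler_wpM2l (mulr_ge0 C0 m0) h1) _.
by rewrite le_eqVlt; apply/orP; left; apply/eqP; ring.
Qed.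

Lemma synth_nat c : nat_ c ->
  [/\ Minf (synth c), B (synth c) & NB (synth c) <= (nk + no) * Nnat c].
Proof.
move=> Bc; have [C hC] := nat_coef_bound Bc.
by split; [exact: (synth_reproduced i0 S hCk hC)|exact: (synth_space i0 S hCk hB hC Bc).1|
           exact: (synth_space i0 S hCk hB hC Bc).2].
Qed.

Lemma synth_truncate c J : nat_ c ->
  synth (truncate c J) = (fun x => synth c x - \sum_(i <- J) c i * k x (xs i)).
Proof.
move=> Bc; have [C hC] := nat_coef_bound Bc; apply/funext => x.
rewrite -(cintegral_cnt_fset i0) -cintegralB.
- congr cintegral; apply/funext => i; rewrite /truncate.
  by case: ifP => _; rewrite ?mul0r ?subrr ?subr0.
- exact: (synth_cintegrable i0 S hCk _ hC).
- exact: cintegrable_cnt_fset.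
Qed.

Lemma nat_truncate c J : nat_ c -> nat_ (truncate c J).
Proof.
move=> Bc; apply: (seq_space_le i0 S hB wn Bc _).1 => i.
by rewrite /truncate; case: ifP => _; rewrite ?normc00 ?normc_ge0.
Qed.

Lemma synth_single i (a : R[i]) :
  synth (fun j => if j == i then a else 0) = (fun x => a * k x (xs i)).
Proof.
apply/funext => x; rewrite -(cintegral_cnt_single i0 i (a * k x (xs i))).
by congr cintegral; apply/funext => j; case: eqP => [->|]; rewrite ?mul0r.
Qed.

(** A kernel function at a node is the synthesis of a unit sequence. *)
Lemma kernel_space i : B (k^~ (xs i)).
Proof.
have [_ + _] := synth_nat (seq_space_single i0 S hB chiB wn i 1).
rewrite synth_single; congr B; apply/funext => x; exact: mul1r.
Qed.

Lemma flat_nat d : flat d -> nat_ (fun i => (cw i)%:C * d i) /\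
  Nnat (fun i => (cw i)%:C * d i) <= Nflat d.
Proof.
move=> Bd; apply: (solid S hB Bd).
  by apply: (step_meas i0 S) => i; exact: ltW.
move=> x; rewrite (normc_step S wn) (normc_step S w1); apply: ler_sum => i _.
rewrite normcM normc_ge0_real ?(cell_mass_ge0 mu iota)// mulr1 mulrAC.
rewrite -[leRHS]mul1r; apply: ler_wpM2r; first exact: normc_ge0.
by rewrite ler_pdivrMr ?(muR_gt0 S)// mul1r (cell_mass_le S hi).
Qed.

Lemma neumann_total F : Minf F -> B F -> [/\ Minf (P F), B (P F),
  NB (P F) <= NB F / (1 - q), frame_sum (P F) = F & P (frame_sum F) = F].
Proof.
move=> MF BF; have [h1 h2] := neumann_space i0 S hCk hi hB hq MF BF.
split => //; first exact: (neumann_reproduced i0 S hCk hi hB hq MF BF).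
  exact: (frame_sum_neumann i0 S hCk hi hB hq MF BF).
exact: (neumann_frame_sum i0 S hCk hi hB hq MF BF).
Qed.

Lemma flat_sample F : Minf F -> B F -> flat (fun i => F (xs i)) /\
  Nflat (fun i => F (xs i)) <= N%:R * (1 + no) * NB F.
Proof. exact: (sampling_space i0 S hCk hB). Qed.

Definition coef_const : R := N%:R * (1 + no) / (1 - q).

Lemma nat_coef F : Minf F -> B F -> nat_ (fun i => (cw i)%:C * P F (xs i)) /\
  Nnat (fun i => (cw i)%:C * P F (xs i)) <= coef_const * NB F.
Proof.
move=> MF BF; have [MP BP NP _ _] := neumann_total MF BF.
have [h1 h2] := flat_sample MP BP; have [h3 h4] := flat_nat h1.
split => //; apply: le_trans h4 (le_trans h2 _).
have no0 := no_ge0 i0 S.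
rewrite /coef_const -[leRHS]mulrA [_^-1 * _]mulrC; apply: ler_wpM2l => //.
by rewrite mulr_ge0// addr_ge0.
Qed.

(* The operator [Omega] of the Banach frame, which recovers [F] from its samples. *)
Definition reconstruct (d : I -> R[i]) : X -> R[i] :=
  P (synth (fun i => (cw i)%:C * d i)).

Lemma reconstructP d : flat d -> [/\ Minf (reconstruct d), B (reconstruct d) &
  NB (reconstruct d) <= (nk + no) / (1 - q) * Nflat d].
Proof.
move=> Bd; have [Bc Nc] := flat_nat Bd; have [M1 B1 N1] := synth_nat Bc.
have [M2 B2 N2 _ _] := neumann_total M1 B1; split => //.
apply: le_trans N2 _; rewrite mulrAC; apply: ler_wpM2r.
  by rewrite invr_ge0 subr_ge0 ltW.
apply: le_trans N1 _; apply: ler_wpM2l => //.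
by rewrite addr_ge0 ?(nk_ge0 i0 S) ?(no_ge0 i0 S).
Qed.

Lemma reconstruct_sample F : Minf F -> B F -> reconstruct (fun i => F (xs i)) = F.
Proof. by move=> MF BF; have [_ _ _ _] := neumann_total MF BF. Qed.

Lemma synth_lin a c c' : nat_ c -> nat_ c' ->
  synth (fun i => a * c i + c' i) = (fun x => a * synth c x + synth c' x).
Proof.
move=> Bc Bc'; have [C hC] := nat_coef_bound Bc; have [C' hC'] := nat_coef_bound Bc'.
have ic := synth_cintegrable i0 S hCk _ hC; have ic' := synth_cintegrable i0 S hCk _ hC'.
apply/funext => x; rewrite -cintegralZ// -cintegralD//; last exact: cintegrableZ.
by congr cintegral; apply/funext => i; rewrite mulrDl mulrA.
Qed.

Lemma reconstruct_lin a d d' : flat d -> flat d' ->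
  reconstruct (fun i => a * d i + d' i) = (fun x => a * reconstruct d x + reconstruct d' x).
Proof.
move=> Bd Bd'; have [Bc _] := flat_nat Bd; have [Bc' _] := flat_nat Bd'.
have [M1 B1 _] := synth_nat Bc; have [M2 B2 _] := synth_nat Bc'.
rewrite /reconstruct -(neumann_lin i0 S hCk hi hB hq a M1 B1 M2 B2) -(synth_lin a Bc Bc').
by congr P; congr synth; apply/funext => i; ring.
Qed.

Lemma neumann_sum (J : seq I) (F : I -> X -> R[i]) (a : I -> R[i]) :
  (forall i, Minf (F i) /\ B (F i)) ->
  Minf (fun x => \sum_(i <- J) a i * F i x) /\ B (fun x => \sum_(i <- J) a i * F i x) /\
  P (fun x => \sum_(i <- J) a i * F i x) = (fun x => \sum_(i <- J) a i * P (F i) x).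
Proof.
move=> hF; elim: J => [|j J [ihM [ihB ih]]].
  have -> : (fun x => \sum_(i <- [::]) a i * F i x) = (fun=> 0) by apply/funext => x; rewrite big_nil.
  have M0 := reproduced0 S hCk; have B0 := fs_0 hB.
  split => //; split => //; have := neumann_lin i0 S hCk hi hB hq (-1) M0 B0 M0 B0.
  have -> : (fun x : X => -1 * 0 + 0 : R[i]) = (fun=> 0) by apply/funext => x; rewrite mulr0 addr0.
  by move=> ->; apply/funext => x; rewrite big_nil mulN1r addNr.
have -> : (fun x => \sum_(i <- j :: J) a i * F i x) =
    (fun x => a j * F j x + \sum_(i <- J) a i * F i x) by apply/funext => x; rewrite big_cons.
have [Mj Bj] := hF j.
split; first exact: (reproduced_lin S hCk).
split; first exact: (fs_lin hB).
by rewrite (neumann_lin i0 S hCk hi hB hq)// ih; apply/funext => x; rewrite big_cons.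
Qed.

(** By linearity of [P] and the definition of the dual atoms, the remainder of the dual expansion is
    the reconstruction of a tail; boundedness of [reconstruct] then controls it. *)
Lemma reconstruct_truncate d J : flat d ->
  reconstruct (truncate d J) = (fun x => reconstruct d x - \sum_(i <- J) d i * E i x).
Proof.
move=> Bd; have [Bc _] := flat_nat Bd; have [M1 B1 _] := synth_nat Bc.
rewrite /reconstruct.
have -> : (fun i => (cw i)%:C * truncate d J i) = truncate (fun i => (cw i)%:C * d i) J.
  by apply/funext => i; rewrite /truncate; case: ifP => _; rewrite ?mulr0.
rewrite synth_truncate//.
pose G i : X -> R[i] := fun y => (cw i)%:C * k y (xs i).
have hG i : Minf (G i) /\ B (G i).
  split; first exact: (scaled_kernel_reproduced S hCk).
  exact: (spaceZ hB _ (kernel_space i)).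
have [MG [BG PG]] := neumann_sum J (fun i => - d i) hG.
have -> : (fun x => synth (fun i => (cw i)%:C * d i) x -
    \sum_(i <- J) (cw i)%:C * d i * k x (xs i)) =
  (fun x => 1 * synth (fun i => (cw i)%:C * d i) x + \sum_(i <- J) - d i * G i x).
  apply/funext => x; rewrite mul1r; congr (_ + _); rewrite -sumrN.
  by apply: eq_bigr => i _; rewrite /G; ring.
rewrite (neumann_lin i0 S hCk hi hB hq)// PG; apply/funext => x; rewrite mul1r.
congr (_ + _); rewrite -sumrN; apply: eq_bigr => i _; rewrite mulNr; congr (- (_ * _)).
Qed.

End Coefficients.

(** * Coorbit spaces *)

Section Antidual.
Context {R : realType} {X : ptopologicalType} {I : countType} (i0 : I).
Variable mu : {measure set (borel X) -> \bar R}.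
Variables (k : X -> X -> R[i]) (o m : X -> X -> R) (z : X) (U : I -> set X)
  (xs : I -> X) (D Cm nk no : R) (N : nat).
Hypothesis S : discretization mu k o m z U xs D Cm nk no N.
Variable Ck : R.
Hypothesis hCk : 0 <= Ck /\
  forall x, (\int[mu]_y (normc (k x y) * m x y)%:E <= Ck%:E)%E.

Local Notation v := (fun x => m x z).
Local Notation cint := (cintegral mu setT).
Local Notation cmeas F := (cmeasurable setT (F : borel X -> R[i])).
Local Notation cnt := (@cnt R I i0).
Local Notation Minf := (reproduced mu k m z).
Local Notation wint := (wint mu m z).
Variable iota : X -> I.
Hypothesis hi : (forall y, U (iota y) y) /\
  forall i, measurable ([set y | iota y = i] : set (borel X)).
Local Notation coef_bound := (coef_bound mu m z U xs).
Local Notation cw := (cell_mass mu iota).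
Local Notation q := (nk * no + no * (nk + no)).
Hypothesis hq : q < 1.
Local Notation L1v := (L1w mu v).
Local Notation NL1v := (L1w_norm mu v).
Local Notation P := (neumann i0 mu k xs iota).
Local Notation E := (dual_atom i0 mu k xs iota).
Let hL := L1w_function_space i0 S hCk.

(** Convergence uniform relative to [v] passes through the reproducing integral, at the cost of a
    factor [Ck]. *)
Lemma reproduced_limit (u : nat -> X -> R[i]) F : (forall n, Minf (u n)) ->
  (forall e, 0 < e -> exists n0 : nat, forall n, (n0 <= n)%N ->
     forall x, normc (u n x - F x) <= e * v x) -> Minf F.
Proof.
move=> Mu uF; have v0 x : 0 <= v x := m_ge0 S x z; have Ck0 := hCk.1.
have mF : cmeas F.
  apply: (@cmeas_cvg _ _ (borel X) u F) => [n|x]; first exact: rp_meas (Mu n).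
  apply/cvgrPdist_le => e e0.
  have vx : 0 < v x := m_gt0 S x z.
  have [n0 h] := uF _ (divr_gt0 e0 vx); exists n0 => // n /= nn.
  by rewrite sub0r normrN ger0_norm ?normc_ge0//; have := h n nn x; rewrite divfK ?gt_eqF.
have FC : exists2 C, 0 <= C & forall x, normc (F x) <= C * v x.
  have [n0 h] := uF 1 ltr01; have [C C0 hC] := rp_bnd (Mu n0).
  exists (C + 1) => [|x]; first by rewrite addr_ge0.
  have -> : F x = u n0 x - (u n0 x - F x) by ring.
  by apply: le_trans (normcB _ _) _; rewrite mulrDl lerD// h.
split => // x; apply/eqP; rewrite -subr_eq0; apply/eqP/normc_eq0/eqP.
rewrite eq_le normc_ge0 andbT; apply/ler_addgt0Pr => e e0; rewrite add0r.
have c0 : 0 < (1 + Ck) * v x by rewrite mulr_gt0 ?(m_gt0 S)// ltr_pwDl.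
have [n h] := uF _ (divr_gt0 e0 c0); have {}h := h n (leqnn n).
set d := e / _ in h; have d0 : 0 <= d by rewrite divr_ge0// ltW.
have -> : e = d * v x + d * Ck * v x by rewrite /d; field; rewrite !gt_eqF ?(m_gt0 S)// ltr_pwDl.
apply: le_trans (normc_triangle _ (u n x) _) _; apply: lerD; first by rewrite normcBC.
rewrite {1}(rp_eq (Mu n) x) -cintegralB; last 2 first.
- exact: (reproduced_cintegrable S hCk).
- exact: (wbound_cintegrable S hCk).
have -> : (fun y => u n y * k x y - F y * k x y) = (fun y => (u n y - F y) * k x y).
  by apply/funext => y; rewrite mulrBl.
apply: (wbound_cint_le S hCk) => //; apply: cmeasB => //; exact: rp_meas (Mu n).
Qed.

Context {H : completeNormedModType R[i]}.
Variables (W : H -> X -> R[i]) (a : X -> H).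
Hypotheses (W_lin : forall c f g x, W (c *: f + g) x = c * W f x + W g x)
  (W_rep : forall f, Minf (W f)) (W_atom : forall x y, W (a y) x = k x y).

(** This becomes [K^1_v] for [W f x = <f, S^-1 psi_x>] with [a = psi], and [H^1_v] when [psi] and
    [S^-1 psi] exchange their roles. *)
Definition analyzing : set H := [set f | L1v (W f)].
Definition analyzing_norm (f : H) : R := NL1v (W f).
Local Notation B1 := analyzing.
Local Notation N1 := analyzing_norm.
Local Notation Vof phi := (fun x => phi (a x)).

(** The inverse of the transform [phi |-> phi \o a]. The value 0 outside the test space follows the
    convention of [antidual], so that equality of functionals is equality of functions. *)
Definition synthesis (F : X -> R[i]) (g : H) : R[i] :=
  if g \in B1 then cint (fun y => F y * Num.conj (W g y)) else 0.

Lemma W_linE c f g : W (c *: f + g) = (fun x => c * W f x + W g x).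
Proof. by apply/funext => x; exact: W_lin. Qed.

Lemma analyzing_lin c f g : B1 f -> B1 g -> B1 (c *: f + g).
Proof. by rewrite /analyzing /= W_linE; exact: (L1w_lin S). Qed.

Lemma atom_analyzing x : B1 (a x).
Proof.
rewrite /analyzing /= (_ : W (a x) = k^~ x); first exact: (kernel_L1 S hCk).
by apply/funext => y.
Qed.

Lemma pairing_bound C F g : cmeas F -> 0 <= C -> (forall x, normc (F x) <= C * v x) -> B1 g ->
  cintegrable mu setT (fun y => F y * Num.conj (W g y)) /\
  normc (cint (fun y => F y * Num.conj (W g y))) <= C * N1 g.
Proof.
move=> mF C0 FC Bg; have mW := rp_meas (W_rep g).
have m1 : cmeas (fun y => F y * Num.conj (W g y)).
  by apply: cmeasM => //; exact: cmeas_conj.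
have m2 : measurable_fun setT ((fun y => normc (W g y) * v y) : borel X -> R).
  exact: (wint_meas S mW).
have v0 x : 0 <= v x := m_ge0 S x z.
have h : (\int[mu]_y (normc (F y * Num.conj (W g y)))%:E <= (C * N1 g)%:E)%E.
  rewrite EFinM (L1w_norm_fin S Bg) /wint -ge0_integral_RZ//; last first.
    by move=> y; rewrite mulr_ge0 ?normc_ge0.
  apply: le_integral_R; first exact: cmeas_normc.
  - by apply: measurable_funM.
  - by move=> y; exact: normc_ge0.
  - by move=> y; rewrite normcM normc_conj [leRHS]mulrCA mulrC ler_wpM2l ?normc_ge0.
have ci : cintegrable mu setT (fun y => F y * Num.conj (W g y)).
  by apply/cintegrableP; split => //; apply: le_lt_trans h (ltry _).
by split => //; exact: cintegral_le.
Qed.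

Lemma synthesisE F g : B1 g -> synthesis F g = cint (fun y => F y * Num.conj (W g y)).
Proof. by move=> Bg; rewrite /synthesis mem_set. Qed.

Lemma synthesis_antidual F : Minf F -> antidual B1 N1 (synthesis F).
Proof.
move=> MF; have mF := rp_meas MF; have [C C0 FC] := rp_bnd MF; split.
- move=> c f g Bf Bg; rewrite !synthesisE//; last exact: analyzing_lin.
  have [cf _] := pairing_bound mF C0 FC Bf; have [cg _] := pairing_bound mF C0 FC Bg.
  rewrite -cintegralZ// -cintegralD//; last exact: cintegrableZ.
  congr cintegral; apply/funext => y; rewrite W_lin conjCD conjCM; ring.
- by exists C => f Bf; rewrite synthesisE//; exact: (pairing_bound mF C0 FC Bf).2.
- by move=> f Bf; rewrite /synthesis memNset.
Qed.

Lemma synthesis_atom F x : Minf F -> synthesis F (a x) = F x.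
Proof.
move=> MF; rewrite (synthesisE _ (atom_analyzing x)) [RHS](rp_eq MF x).
by congr cintegral; apply/funext => y; rewrite W_atom -(dz_k_herm S).
Qed.

Lemma synthesis_kernel y g : B1 g -> synthesis (k^~ y) g = Num.conj (W g y).
Proof.
move=> Bg; rewrite synthesisE// [in RHS](rp_eq (W_rep g) y) -cintegral_conj.
  by congr cintegral; apply/funext => t; rewrite conjCM -(dz_k_herm S) mulrC.
exact: (reproduced_cintegrable S hCk).
Qed.

Lemma antidual_sub_sum phi g c (s : seq I) : antidual B1 N1 phi -> B1 g ->
  B1 (g - \sum_(i <- s) c i *: a (xs i)) /\
  phi (g - \sum_(i <- s) c i *: a (xs i)) =
  phi g - \sum_(i <- s) Num.conj (c i) * phi (a (xs i)).
Proof.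
move=> [pl _ _] Bg; elim: s => [|j s [ihB ih]]; first by rewrite !big_nil !subr0.
have -> : g - \sum_(i <- j :: s) c i *: a (xs i) =
    (- c j) *: a (xs j) + (g - \sum_(i <- s) c i *: a (xs i)).
  by rewrite big_cons opprD scaleNr addrCA.
split; first exact: analyzing_lin (atom_analyzing _) ihB.
rewrite pl//; last exact: atom_analyzing.
by rewrite ih big_cons rmorphN /=; ring.
Qed.

(* [g] is the limit of finite combinations of atoms, whose coefficients come
   from the discretized reproducing formula for [W g]. *)
Lemma antidual_expansion phi g : antidual B1 N1 phi -> B1 g ->
  phi g = cintegral cnt setT (fun i =>
    Num.conj ((cw i)%:C * P (W g) (xs i)) * phi (a (xs i))).
Proof.
move=> hphi Bg; have [_ [M0 hM0] _] := hphi.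
have [MP LP _ TA] := neumann_L1 i0 S hCk hi hq (W_rep g) Bg.
set c := (fun i => (cw i)%:C * P (W g) (xs i)).
have [C hc] : exists C, coef_bound C c := sample_coef_bound S hi MP.
have cfin : (\int[cnt]_i (normc (c i) * v (xs i))%:E < +oo)%E.
  exact: le_lt_trans (sample_coef_sum i0 S hCk hi MP LP) (ltry _).
have v0 x : 0 <= v x := m_ge0 S x z; have Ck0 := hCk.1.
pose M := `|M0|; have M_ge0 : 0 <= M by rewrite normr_ge0.
have N1_ge0 f : B1 f -> 0 <= N1 f by move=> Bf; exact: (fs_ge0 hL Bf).
have hM f : B1 f -> normc (phi f) <= M * N1 f.
  move=> Bf; apply: le_trans (hM0 f Bf) _.
  by apply: ler_wpM2r; [exact: N1_ge0|exact: ler_norm].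
have F_le x : normc (phi (a x)) <= M * Ck * v x.
  apply: le_trans (hM _ (atom_analyzing x)) _; rewrite -mulrA ler_wpM2l//.
  rewrite /analyzing_norm (_ : W (a x) = k^~ x); last by apply/funext => y.
  exact: (kernel_L1_norm S hCk).
have ps : (\int[cnt]_i (normc (Num.conj (c i) * phi (a (xs i))))%:E < +oo)%E.
  apply: (@le_lt_trans _ _ (\int[cnt]_i (M * Ck * (normc (c i) * v (xs i)))%:E)%E).
    apply: le_integral_R; try exact: measurable_fun_discr.
      by move=> i; exact: normc_ge0.
    move=> i; rewrite normcM normc_conj mulrCA ler_wpM2l ?normc_ge0//.
  rewrite ge0_integral_RZ ?mulr_ge0//; first by rewrite lte_mul_pinfty// lee_fin mulr_ge0.
  by move=> i; rewrite mulr_ge0 ?normc_ge0.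
apply/eqP; rewrite -subr_eq0; apply/eqP/normc_eq0/eqP.
rewrite eq_le normc_ge0 andbT; apply/ler_addgt0Pr => e e0; rewrite add0r.
(* Two errors of size [M * Ck * (e / K)] occur, one from the functional on the remainder vector and
   one from the tail of the scalar series; the summand 1 keeps [K] positive. *)
pose K := 2 * (M * Ck) + 1; have K0 : 0 < K by rewrite ltr_wpDl ?mulr_ge0.
have b0 i : 0 <= normc (c i) * v (xs i) by rewrite mulr_ge0 ?normc_ge0.
have [J0 hJ] := integral_cnt_tail (i0 := i0) b0 cfin (divr_gt0 e0 K0).
have {}hJ := hJ J0 (fsubset_refl _).
have [Bd phid] := antidual_sub_sum c J0 hphi Bg.
have MCk : 0 <= M * Ck by rewrite mulr_ge0.
have t1 : normc (phi g - \sum_(i <- J0) Num.conj (c i) * phi (a (xs i))) <= M * Ck * (e / K).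
  rewrite -phid; apply: le_trans (hM _ Bd) _; rewrite -mulrA ler_wpM2l//.
  rewrite -lee_fin (L1w_norm_fin S Bd) EFinM.
  have h3 := lee_wpmul2l (x := Ck%:E) Ck0 hJ; apply: le_trans h3.
  apply: le_trans (synth_tail S hCk J0 hc cfin).
  rewrite le_eqVlt; apply/orP; left; apply/eqP; congr wint; apply/funext => x.
  have -> : W (g - \sum_(i <- J0) c i *: a (xs i)) x =
      W g x - \sum_(i <- J0) c i * k x (xs i).
    elim: (enum_fset J0) => [|j s ih]; first by rewrite !big_nil !subr0.
    have -> : g - \sum_(i <- j :: s) c i *: a (xs i) =
        (- c j) *: a (xs j) + (g - \sum_(i <- s) c i *: a (xs i)).
      by rewrite big_cons opprD scaleNr addrCA.
    by rewrite W_lin ih W_atom big_cons; ring.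
  by congr (_ - _); rewrite -[in LHS]TA.
have t2 : normc (cintegral cnt setT (fun i => Num.conj (c i) * phi (a (xs i))) -
    \sum_(i <- J0) Num.conj (c i) * phi (a (xs i))) <= M * Ck * (e / K).
  rewrite -lee_fin; apply: le_trans (cintegral_cnt_sub_sum J0 ps) _.
  apply: (@le_trans _ _ (\int[cnt]_i
      (M * Ck * (if i \in J0 then 0 else normc (c i) * v (xs i)))%:E)%E).
    apply: ge0_le_integralT; try exact: measurable_fun_discr.
      by move=> i; case: ifP => _; rewrite lee_fin ?normc_ge0.
    move=> i; rewrite lee_fin; case: ifP => _; first by rewrite mulr0.
    by rewrite normcM normc_conj mulrCA ler_wpM2l ?normc_ge0.
  rewrite ge0_integral_RZ//; last by move=> i; case: ifP.
  exact: (lee_wpmul2l (x := (M * Ck)%:E) MCk hJ).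
apply: le_trans (normc_triangle _ (\sum_(i <- J0) Num.conj (c i) * phi (a (xs i))) _) _.
rewrite normcBC in t2; apply: le_trans (lerD t1 t2) _.
apply: (@le_trans _ _ (K * (e / K))); last by rewrite mulrCA divff ?mulr1// gt_eqF.
rewrite -mulrDl ler_wpM2r ?divr_ge0 ?(ltW e0) ?(ltW K0)// /K mulr_natl mulr2n lerDl.
exact: ler01.
Qed.

(** Taking an atom for [g], the expansion exhibits the transform as a series in the dual atoms,
    hence reproduced. Taking a general [g], the pairing formula sums the same series to the integral
    that defines [synthesis]. *)
Lemma antidual_reproduced phi : antidual B1 N1 phi ->
  Minf (Vof phi) /\ phi = synthesis (Vof phi).
Proof.
move=> hphi; have [_ [M0 hM0] phi0] := hphi; have v0 x : 0 <= v x := m_ge0 S x z.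
have MF : Minf (Vof phi).
  apply: (@dual_expansion_reproduced _ _ _ i0 _ _ _ _ _ _ _ _ _ _ _ _ S _ hCk _ hi hq (`|M0| * Ck)).
  - by rewrite mulr_ge0// hCk.1.
  - move=> x; apply: le_trans (hM0 _ (atom_analyzing x)) _.
    apply: (@le_trans _ _ (`|M0| * N1 (a x))).
      apply: ler_wpM2r; last exact: ler_norm.
      exact: (fs_ge0 hL (atom_analyzing x)).
    rewrite -mulrA ler_wpM2l//.
    rewrite /analyzing_norm (_ : W (a x) = k^~ x); last by apply/funext => y.
    exact: (kernel_L1_norm S hCk).
  - move=> x; rewrite (antidual_expansion hphi (atom_analyzing x)).
    congr cintegral; apply/funext => i.
    rewrite (dual_atom_kernel i0 S hCk hi hq); congr (Num.conj (_ * _) * _).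
    by congr (P _ _); apply/funext => y; rewrite W_atom.
split => //; apply/funext => g; rewrite /synthesis.
case: ifPn => [/set_mem Bg|/negP nBg]; last by apply: phi0 => Bg; apply: nBg; exact: mem_set.
rewrite (antidual_expansion hphi Bg).
have [MP LP _ TA] := neumann_L1 i0 S hCk hi hq (W_rep g) Bg.
have [C hc] := sample_coef_bound S hi MP.
have cfin := le_lt_trans (sample_coef_sum i0 S hCk hi MP LP) (ltry _).
by rewrite -(synth_pairing_bounded S hCk hc MF cfin) -[in RHS]TA.
Qed.

End Antidual.

#[local] Existing Instance totally_filter.

Section Coorbit.
Context {R : realType} {X : ptopologicalType} {I : countType} (i0 : I).
Variable mu : {measure set (borel X) -> \bar R}.
Variables (k : X -> X -> R[i]) (o m : X -> X -> R) (z : X) (U : I -> set X)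
  (xs : I -> X) (D Cm nk no : R) (N : nat).
Hypothesis S : discretization mu k o m z U xs D Cm nk no N.
Variable Ck : R.
Hypothesis hCk : 0 <= Ck /\
  forall x, (\int[mu]_y (normc (k x y) * m x y)%:E <= Ck%:E)%E.

Local Notation v := (fun x => m x z).
Local Notation cnt := (@cnt R I i0).
Local Notation muR i := (fine (mu (U i))).
Local Notation Minf := (reproduced mu k m z).
Variable iota : X -> I.
Hypothesis hi : (forall y, U (iota y) y) /\
  forall i, measurable ([set y | iota y = i] : set (borel X)).
Local Notation synth := (synth i0 k xs).
Local Notation cw := (cell_mass mu iota).
Variables (B : set (X -> R[i])) (NB : (X -> R[i]) -> R).
Hypothesis hB : function_space mu k m z B NB.
Local Notation q := (nk * no + no * (nk + no)).
Hypothesis hq : q < 1.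
Local Notation P := (neumann i0 mu k xs iota).
Local Notation E := (dual_atom i0 mu k xs iota).
Local Notation chi := (cover_indic U).
Hypotheses (chiB : forall i, B (chi i)) (chi_gt0 : forall i, 0 < NB (chi i))
  (chi_low : exists2 C : R, 0 <= C & forall i, 1 <= C * v (xs i) * NB (chi i)).
Local Notation wflat := (fun=> 1 : R).
Local Notation wnat := (fun i => (muR i)^-1).
Local Notation flat := (seq_space U B wflat).
Local Notation nat_ := (seq_space U B wnat).
Local Notation Nflat := (seq_norm U NB wflat).
Local Notation Nnat := (seq_norm U NB wnat).
Let w1 (i : I) : (0 : R) < 1. Proof. exact: ltr01. Qed.
Let wn (i : I) : 0 < (muR i)^-1. Proof. by rewrite invr_gt0 (muR_gt0 S). Qed.

Context {H : completeNormedModType R[i]}.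
Variables (W : H -> X -> R[i]) (a : X -> H).
Hypotheses (W_lin : forall c f g x, W (c *: f + g) x = c * W f x + W g x)
  (W_rep : forall f, Minf (W f)) (W_atom : forall x y, W (a y) x = k x y).
Local Notation B1 := (analyzing mu m z W).
Local Notation N1 := (analyzing_norm mu m z W).
Local Notation Vof phi := (fun x => phi (a x)).
Local Notation ext := (synthesis mu m z W).
Let synth_natP := synth_nat i0 S hCk hB chiB chi_low.
Let neumannP := neumann_total i0 S hCk hi hB hq.

Definition coorbit : set (H -> R[i]) := [set phi | antidual B1 N1 phi /\ B (Vof phi)].
Definition coorbit_norm (phi : H -> R[i]) : R := NB (Vof phi).
Local Notation Co := coorbit.
Local Notation NCo := coorbit_norm.

Lemma coorbit_synthesis F : Minf F -> B F -> Co (ext F) /\ NCo (ext F) = NB F.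
Proof.
move=> MF BF; have VF : Vof (ext F) = F.
  by apply/funext => x; exact: (synthesis_atom S hCk W_atom).
by split; [split; [exact: (synthesis_antidual S)|rewrite VF]|rewrite /NCo VF].
Qed.

Lemma coorbit_analysis phi : Co phi ->
  [/\ Minf (Vof phi), B (Vof phi) & phi = ext (Vof phi)].
Proof.
move=> [ha hb].
by have [] := antidual_reproduced i0 S hCk hi hq W_lin W_rep W_atom ha.
Qed.

Lemma synthesis_lin c F G : Minf F -> Minf G ->
  ext (fun x => c * F x + G x) = c *: ext F + ext G.
Proof.
move=> MF MG; apply/funext => g.
rewrite (_ : (c *: ext F + ext G) g = c * ext F g + ext G g)// /synthesis.
case: ifPn => [/set_mem Bg|_]; last by rewrite mulr0 addr0.
have [CF CF0 hF] := rp_bnd MF; have [CG CG0 hG] := rp_bnd MG.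
have [iF _] := pairing_bound S W_rep (rp_meas MF) CF0 hF Bg.
have [iG _] := pairing_bound S W_rep (rp_meas MG) CG0 hG Bg.
rewrite -cintegralZ// -cintegralD//; last exact: cintegrableZ.
by congr cintegral; apply/funext => x; ring.
Qed.

Lemma coorbit_lin c phi psi : Co phi -> Co psi -> Co (c *: phi + psi).
Proof.
move=> /coorbit_analysis[M1 b1 ->] /coorbit_analysis[M2 b2 ->].
rewrite -synthesis_lin//; apply: (coorbit_synthesis _ _).1.
  exact: (reproduced_lin S hCk).
exact: (fs_lin hB).
Qed.

Lemma coorbit0 : Co 0.
Proof.
have M0 := reproduced0 S hCk.
have [h _] := coorbit_synthesis M0 (fs_0 hB); congr Co: h.
apply/funext => g; rewrite /synthesis; case: ifP => // _.
rewrite -[RHS](@cintegral0 _ _ _ mu); congr cintegral; apply/funext => y.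
by rewrite mul0r.
Qed.

Lemma coorbit_eq0 phi : Co phi -> NCo phi = 0 -> phi = 0.
Proof.
move=> Cphi; have [MF BF {2}->] := coorbit_analysis Cphi => N0.
have [C _ hC] := fs_pointwise hB.
apply/funext => g; rewrite /synthesis; case: ifP => // _.
rewrite -[RHS](@cintegral0 _ _ _ mu); congr cintegral; apply/funext => y.
rewrite (_ : phi (a y) = 0) ?mul0r//; apply: normc_eq0; apply/eqP.
rewrite eq_le normc_ge0 andbT; apply: le_trans (hC _ MF BF y) _.
by rewrite (_ : NB (Vof phi) = 0) ?mulr0.
Qed.

(** The pointwise bound makes the transforms of a Cauchy sequence converge uniformly relative to
    [v]. The limit is therefore reproduced and defines a functional; completeness of [B] then gives
    norm convergence. *)
Lemma coorbit_complete (u : nat -> H -> R[i]) : (forall n, Co (u n)) ->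
  (forall e : R, 0 < e -> exists n0 : nat, forall p q : nat,
     (n0 <= p)%N -> (n0 <= q)%N -> NCo (u p - u q) < e) ->
  exists2 l, Co l & (fun n => NCo (u n - l)) @ \oo --> (0 : R).
Proof.
move=> Cu uC; pose F n := Vof (u n).
have MF n : Minf (F n) by have [] := coorbit_analysis (Cu n).
have BF n : B (F n) by have [] := coorbit_analysis (Cu n).
have v0 x : 0 < v x := m_gt0 S x z.
have [C C0 hC] := fs_pointwise hB.
have C1 : 0 < C + 1 by rewrite ltr_wpDl.
have dF p q x : normc (F p x - F q x) <= (C + 1) * v x * NCo (u p - u q).
  have Md : Minf (fun x => F p x - F q x).
    have := reproduced_lin S hCk (-1) (MF q) (MF p); congr reproduced.
    by apply/funext => y; rewrite mulN1r addrC.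
  have Bd := spaceB hB (BF p) (BF q).
  apply: le_trans (hC _ Md Bd x) _; apply: ler_wpM2r; first exact: (fs_ge0 hB Bd).
  by apply: ler_wpM2r; [exact: ltW|rewrite lerDl].
pose G x := climit (F ^~ x).
have FG x : (fun n => normc (F n x - G x)) @ \oo --> (0 : R).
  apply: cvg_climit => e e0.
  have c0 : 0 < (C + 1) * v x by rewrite mulr_gt0.
  have [n0 h] := uC _ (divr_gt0 e0 c0); exists n0 => p q np nq.
  by apply: le_lt_trans (dF p q x) _; rewrite mulrC -ltr_pdivlMr// h.
have unif e : 0 < e -> exists n0 : nat, forall n, (n0 <= n)%N ->
    forall x, normc (F n x - G x) <= e * v x.
  move=> e0; have [n0 h] := uC _ (divr_gt0 e0 C1); exists n0 => n nn x.
  apply: (normc_cvg_le (n0 := n0) (FG x)) => p np.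
  apply: le_trans (dF n p x) _; rewrite mulrAC; apply: ler_wpM2r; first exact: ltW.
  by rewrite mulrC -ler_pdivlMr// ltW// h.
have MG : Minf G by apply: (reproduced_limit S hCk MF).
have [BG cG] : B G /\ (fun n => NB (fun x => F n x - G x)) @ \oo --> (0 : R).
  by apply: (fs_complete hB) => // e /uC.
have [CG NG] := coorbit_synthesis MG BG.
exists (ext G) => //; apply: cvg_trans cG; apply: near_eq_cvg; near=> n.
rewrite /NCo; congr NB; apply/funext => x.
by rewrite -[in LHS](synthesis_atom S hCk W_atom x MG).
Unshelve. all: by end_near. Qed.

Lemma coorbit_banach : is_banach [set 0] Co NCo.
Proof.
split => //.
- exact: coorbit0.
- exact: coorbit_lin.
- by move=> f /coorbit_analysis[_ BF _]; exact: (fs_ge0 hB BF).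
- move=> f Cf; split => [|/= ->]; first exact: coorbit_eq0.
  exact: (space_norm0 hB).
- by move=> c f /coorbit_analysis[_ BF _]; exact: (fs_normZ hB c BF).
- by move=> f g /coorbit_analysis[_ BF _] /coorbit_analysis[_ BG _]; exact: (fs_normD hB BF BG).
- exact: coorbit_complete.
Qed.

Variable e : I -> H.
Hypothesis W_dual : forall i, W (e i) = E i.

Lemma dual_analyzing i : B1 (e i).
Proof.
rewrite /analyzing /= W_dual.
by have [] := dual_atomP i0 S hCk hi hq i.
Qed.

Lemma coorbit_coef phi i : Co phi -> phi (e i) = (cw i)%:C * P (Vof phi) (xs i).
Proof.
move=> Cphi; have [MF BF phiE] := coorbit_analysis Cphi.
rewrite {1}phiE (synthesisE _ (dual_analyzing i)) W_dual.
by rewrite (neumann_sample i0 S hCk hi hq hB i MF BF).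
Qed.

Lemma coorbit_coefE phi : Co phi ->
  (fun i => phi (e i)) = (fun i => (cw i)%:C * P (Vof phi) (xs i)).
Proof. by move=> Cphi; apply/funext => i; exact: coorbit_coef. Qed.

Lemma coorbit_expansion phi : Co phi ->
  [/\ nat_ (fun i => phi (e i)), Nnat (fun i => phi (e i)) <= coef_const nk no N * NCo phi,
   phi = ext (synth (fun i => phi (e i))) &
   NCo phi <= (nk + no) * Nnat (fun i => phi (e i))].
Proof.
move=> Cphi; have [MF BF phiE] := coorbit_analysis Cphi.
have [h1 h2] := nat_coef i0 S hCk hi hB hq MF BF.
have [_ _ _ TF _] := neumannP MF BF; rewrite coorbit_coefE//.
have {}TF : synth (fun i => (cw i)%:C * P (Vof phi) (xs i)) = Vof phi := TF.
by have [_ _ N2] := synth_natP h1; rewrite TF in N2 *; split.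
Qed.

(** The bounds at hand may be 0, whereas a norm equivalence asks for positive constants; adding 1
    repairs this. *)
Lemma equivalence_constants (A A' : R) : 0 <= A -> 0 <= A' ->
  exists C1 C2 : R, [/\ 0 < C1, 0 < C2 & forall x y : R, 0 <= x -> 0 <= y ->
    x <= A * y -> y <= A' * x -> C1 * x <= y /\ y <= C2 * x].
Proof.
move=> A0 A0'; have A1 : 0 < A + 1 by rewrite ltr_wpDl.
have A1' : 0 < A' + 1 by rewrite ltr_wpDl.
exists (A + 1)^-1, (A' + 1); split => //; first by rewrite invr_gt0.
move=> x y x0 y0 xy yx; split.
  by rewrite ler_pdivrMl//; apply: le_trans xy _; rewrite ler_wpM2r// lerDl.
by apply: le_trans yx _; rewrite ler_wpM2r// lerDl.
Qed.

Let nkno_ge0 : 0 <= nk + no.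
Proof. by rewrite addr_ge0 ?(nk_ge0 i0 S) ?(no_ge0 i0 S). Qed.

Let samp_ge0 : 0 <= N%:R * (1 + no).
Proof. by rewrite mulr_ge0// addr_ge0// (no_ge0 i0 S). Qed.

Let q1_ge0 : 0 <= (1 - q)^-1.
Proof. by rewrite invr_ge0 subr_ge0 ltW. Qed.

Lemma coorbit_coef_equivalence : norm_equivalence Co NCo nat_ Nnat (fun i phi => phi (e i)).
Proof.
have [C1 [C2 [C1_gt0 C2_gt0 h]]] := equivalence_constants nkno_ge0 (mulr_ge0 samp_ge0 q1_ge0).
exists C1, C2; split => // phi Cphi.
have [h1 h2 _ h3] := coorbit_expansion Cphi; have [_ BF _] := coorbit_analysis Cphi.
by have [] := h _ _ (fs_ge0 hB BF) (fs_ge0 hB h1) h3 h2.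
Qed.

Lemma coorbit_sample_equivalence :
  norm_equivalence Co NCo flat Nflat (fun i phi => phi (a (xs i))).
Proof.
have [C1 [C2 [C1_gt0 C2_gt0 h]]] := equivalence_constants (mulr_ge0 nkno_ge0 q1_ge0) samp_ge0.
exists C1, C2; split => // phi Cphi; have [MF BF _] := coorbit_analysis Cphi.
have [h1 h2] := flat_sample i0 S hCk hB MF BF.
have [_ _ h3] := reconstructP i0 S hCk hi hB hq chiB chi_low h1.
rewrite (reconstruct_sample i0 S hCk hi hB hq MF BF) in h3.
by have [] := h _ _ (fs_ge0 hB BF) (fs_ge0 hB h1) h3 h2.
Qed.

Lemma kernel_coorbit i : Co (ext (k^~ (xs i))).
Proof.
apply: (coorbit_synthesis _ _).1; first exact: (reproduced_kernel S).
exact: (kernel_space i0 S hCk hB chiB chi_low).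
Qed.

(** Tested on [h], the series becomes the scalar series of [c i] times the conjugate of
    [W h (xs i)]. It is absolutely summable because [W h] lies in [L^1_v], and [synth_pairing]
    identifies its sum. *)
Lemma atomic_weak_sum c : nat_ c ->
  unconditional_sum (weak_star B1) (fun i => c i *: ext (k^~ (xs i))) (ext (synth c)).
Proof.
move=> Bc p [h Bh ->]; have [C hC] := nat_coef_bound S hB chiB chi_low Bc.
have [_ wh] := (L1wP S _).1 Bh.
have cs : (\int[cnt]_i (normc (c i * Num.conj (W h (xs i))))%:E < +oo)%E.
  have := coef_sum i0 S hCk hC (W_rep h); under eq_integral do rewrite -(normc_conj (W h _)) -normcM.
  move=> hs; apply: le_lt_trans hs _; have [C0 _] := hC.
  by rewrite lte_mul_pinfty// lee_fin mulr_ge0// (sampling_const_ge0 i0 S).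
have := cnt_summable_totally cs.
rewrite -(synth_pairing i0 S hCk hC (W_rep h) wh); apply: cvg_trans.
apply: near_eq_cvg; near=> J.
rewrite -(synthesisE _ Bh) /= !fctE fct_sumE; congr (normc (_ - _)).
by apply: eq_bigr => i _; rewrite -(synthesis_kernel S hCk W_rep _ Bh).
Unshelve. all: by end_near. Qed.

(** The remainder over [J] is the synthesis of a tail, whose norm in [Y^natural] tends to 0 by
    density of the finite sequences. *)
Lemma atomic_norm_sum c : nat_ c -> finite_sequences_dense nat_ Nnat ->
  unconditional_norm_sum Co NCo (fun i => c i *: ext (k^~ (xs i))) (ext (synth c)).
Proof.
move=> Bc fd; have [M1 b1 _] := synth_natP Bc; split.
- move=> i; have := coorbit_lin (c i) (kernel_coorbit i) coorbit0.
  by rewrite addr0.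
- exact: (coorbit_synthesis M1 b1).1.
move=> _ ->; have tC := truncate_cvg0 i0 S hB wn fd Bc.
have h : (fun J => (nk + no) * Nnat (truncate c J)) @ totally --> (0 : R).
  by have := cvgMl_tmp (a := nk + no) tC; rewrite mulr0; exact.
apply: (squeeze_cvgr _ (@cvg_cst _ (0 : R) _ _ _) h); apply: nearW => J.
have [_ b2 N2] := synth_natP (nat_truncate i0 S hB J Bc).
suff -> : NCo (ext (synth c) - \sum_(i <- J) c i *: ext (k^~ (xs i))) = NB (synth (truncate c J)).
  by rewrite N2 andbT; exact: (fs_ge0 hB b2).
rewrite /NCo (synth_truncate i0 S hCk hB chiB chi_low J Bc); congr NB; apply/funext => x.
rewrite !fctE fct_sumE (synthesis_atom S hCk W_atom x M1); congr (_ - _).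
apply: eq_bigr => i _.
by rewrite -[in RHS](synthesis_atom S hCk W_atom x (reproduced_kernel S (xs i))).
Qed.

Lemma coorbit_coef_bounded i : bounded_functional Co NCo (fun phi => phi (e i)).
Proof.
split; first by [].
have [C1 [C2 [_ C2_gt0 h]]] := coorbit_coef_equivalence.
have ci : 0 < (muR i)^-1 * NB (chi i) by rewrite mulr_gt0.
exists (C2 / ((muR i)^-1 * NB (chi i))) => phi Cphi; have [h1 _ h2] := h _ Cphi.
rewrite mulrAC ler_pdivlMr//; apply: le_trans h2.
exact: (seq_coord_le S hB chiB wn i h1).
Qed.

Lemma coorbit_sample_bounded i : bounded_functional Co NCo (fun phi => phi (a (xs i))).
Proof.
split; first by [].
have [C _ hC] := fs_pointwise hB; exists (C * v (xs i)) => phi /coorbit_analysis[MF BF _].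
exact: (hC _ MF BF (xs i)).
Qed.

Lemma coorbit_atomic_decomposition : atomic_decomposition Co NCo nat_ Nnat (weak_star B1)
  (fun i => ext (k^~ (xs i))).
Proof.
split; [exact: coorbit_banach|exact: (seq_bk_space i0 S hB chiB chi_gt0 wn)|exact: kernel_coorbit|].
exists (fun i phi => phi (e i)); split.
- exact: coorbit_coef_bounded.
- have [C1 [C2 [_ C2_gt0 h]]] := coorbit_coef_equivalence.
  by exists C2 => // f /h[].
- exists (nk + no + 1); first by rewrite ltr_wpDl.
  move=> c Bc; have [M1 b1 n1] := synth_natP Bc; have [h1 h2] := coorbit_synthesis M1 b1.
  exists (ext (synth c)); split => //; first exact: atomic_weak_sum.
  rewrite h2; apply: le_trans n1 _; apply: ler_wpM2r; last by rewrite lerDl.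
  exact: (fs_ge0 hB Bc).
- move=> phi Cphi; have [h1 _ h2 _] := coorbit_expansion Cphi.
  by rewrite [X in unconditional_sum _ _ X]h2; exact: atomic_weak_sum.
Qed.

Lemma coorbit_banach_frame : banach_frame Co NCo flat Nflat (fun i phi => phi (a (xs i))).
Proof.
have recP := reconstructP i0 S hCk hi hB hq chiB chi_low.
split.
- exact: coorbit_banach.
- exact: (seq_bk_space i0 S hB chiB chi_gt0 w1).
- exact: coorbit_sample_bounded.
- exact: coorbit_sample_equivalence.
exists (fun d => ext (reconstruct i0 mu k xs iota d)); split.
- by move=> d /recP[M1 b1 _]; exact: (coorbit_synthesis M1 b1).1.
- move=> c d d' Bd Bd'; have [M1 _ _] := recP _ Bd; have [M2 _ _] := recP _ Bd'.
  rewrite -synthesis_lin//; congr ext.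
  exact: (reconstruct_lin i0 S hCk hi hB hq chiB chi_low).
- exists ((nk + no) / (1 - q)) => d /recP[M1 b1 n1].
  by rewrite (coorbit_synthesis M1 b1).2.
- move=> phi Cphi; have [MF BF phiE] := coorbit_analysis Cphi.
  by rewrite (reconstruct_sample i0 S hCk hi hB hq MF BF).
Qed.

Lemma sample_norm_sum (f : I -> H -> R[i]) : (forall i, f i = ext (E i)) ->
  finite_sequences_dense flat Nflat -> forall phi, Co phi ->
  unconditional_norm_sum Co NCo (fun i => phi (a (xs i)) *: f i) phi.
Proof.
move=> fE fd phi Cphi; have [MF BF phiE] := coorbit_analysis Cphi.
have ME i : Minf (E i) by have [] := dual_atomP i0 S hCk hi hq i.
have BE i : B (E i).
  have hk := spaceZ hB (cw i)%:C (kernel_space i0 S hCk hB chiB chi_low i).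
  by have [] := neumannP (scaled_kernel_reproduced S hCk (cw i)%:C (xs i)) hk.
have [Bd _] := flat_sample i0 S hCk hB MF BF; split => //.
- move=> i; rewrite fE; have := coorbit_lin (phi (a (xs i))) (coorbit_synthesis (ME i) (BE i)).1 coorbit0.
  by rewrite addr0.
move=> _ ->; have tC := truncate_cvg0 i0 S hB w1 fd Bd.
set c := (nk + no) / (1 - q).
have h : (fun J => c * Nflat (truncate (fun i => phi (a (xs i))) J)) @ totally --> (0 : R).
  by have := cvgMl_tmp (a := c) tC; rewrite mulr0; exact.
apply: (squeeze_cvgr _ (@cvg_cst _ (0 : R) _ _ _) h); apply: nearW => J.
have Bt : flat (truncate (fun i => phi (a (xs i))) J).
  apply: (seq_space_le i0 S hB w1 Bd _).1 => i.
  by rewrite /truncate; case: ifP => _; rewrite ?normc00 ?normc_ge0.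
have [_ b2 N2] := reconstructP i0 S hCk hi hB hq chiB chi_low Bt.
suff -> : NCo (phi - \sum_(i <- J) phi (a (xs i)) *: f i) =
    NB (reconstruct i0 mu k xs iota (truncate (fun i => phi (a (xs i))) J)).
  by rewrite N2 andbT; exact: (fs_ge0 hB b2).
rewrite /NCo (reconstruct_truncate i0 S hCk hi hB hq chiB chi_low J Bd).
rewrite (reconstruct_sample i0 S hCk hi hB hq MF BF); congr NB; apply/funext => x.
rewrite !fctE fct_sumE; congr (_ - _); apply: eq_bigr => i _.
by rewrite fE -[in RHS](synthesis_atom S hCk W_atom x (ME i)).
Qed.

End Coorbit.

(** * Hermitian forms and the frame operator *)

Section HermitianForms.
Context {R : realType} {H : lmodType R[i]}.

(** Stated for bare functions because two forms are used, the inner product and the form of the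
    frame operator, and Riesz' theorem is applied to each. *)
Record hermitian_form (Q : H -> H -> R[i]) : Prop := {
  hf_lin : forall c f g h, Q (c *: f + g) h = c * Q f h + Q g h;
  hf_sym : forall f g, Q g f = Num.conj (Q f g);
  hf_pos : forall f, 0 <= complex.Re (Q f f) }.

Variable Q : H -> H -> R[i].
Hypothesis hQ : hermitian_form Q.
Local Notation n f := (complex.Re (Q f f)).

Lemma formZ c f h : Q (c *: f) h = c * Q f h.
Proof.
have h0 : Q 0 h = 0.
  by have := hf_lin hQ (-1) 0 0 h; rewrite scaler0 addr0 mulN1r addNr.
by have := hf_lin hQ c f 0 h; rewrite addr0 h0 addr0.
Qed.

Lemma formD f g h : Q (f + g) h = Q f h + Q g h.
Proof. by have := hf_lin hQ 1 f g h; rewrite scale1r mul1r. Qed.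

Lemma formB f g h : Q (f - g) h = Q f h - Q g h.
Proof. by rewrite formD -scaleN1r formZ mulN1r. Qed.

Lemma formDr f g h : Q h (f + g) = Q h f + Q h g.
Proof. by rewrite (hf_sym hQ) formD conjCD -!(hf_sym hQ). Qed.

Lemma formBr f g h : Q h (f - g) = Q h f - Q h g.
Proof. by rewrite (hf_sym hQ) formB conjCB -!(hf_sym hQ). Qed.

Lemma formZr c f h : Q h (c *: f) = Num.conj c * Q h f.
Proof. by rewrite (hf_sym hQ) formZ conjCM -!(hf_sym hQ). Qed.

Lemma form_Re_sym f g : complex.Re (Q f g) = complex.Re (Q g f).
Proof. by rewrite (hf_sym hQ f g) Re_conj. Qed.

Lemma form_diag f : Q f f = (n f)%:C.
Proof.
apply: complexP => //=; have := congr1 (@complex.Im R) (hf_sym hQ f f).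
by rewrite Im_conj; lra.
Qed.

Lemma form_quadratic (t : R) f g :
  n (f + t%:C *: g) = n f + 2 * t * complex.Re (Q g f) + t ^+ 2 * n g.
Proof.
rewrite formD !formDr !formZ !formZr conjC_real !ReD !ReM !ImM /= (form_Re_sym f g); ring.
Qed.

Lemma form_scale c f : n (c *: f) = normc c ^+ 2 * n f.
Proof. by rewrite formZ formZr mulrA mul_conj_normc form_diag ReM /= mul0r subr0. Qed.

Lemma form_parallelogram f g : n (f - g) = 2 * n f + 2 * n g - n (f + g).
Proof. by rewrite !formB !formD !formBr !formDr !(ReD, ReN); ring. Qed.

(** Positivity of [Q] at [g - s u f], for every unimodular [u], divided by [s]. It stands in for the
    Cauchy-Schwarz inequality, with [s] left free for absorption arguments. *)
Lemma form_young s f g : 0 < s -> normc (Q f g) <= (s * n f + s^-1 * n g) / 2.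
Proof.
move=> s0; have sq u : normc u = 1 -> complex.Re (u * Q f g) <= (s * n f + s^-1 * n g) / 2.
  move=> u1; rewrite -formZ.
  have -> : n f = n (u *: f) by rewrite form_scale u1 expr1n mul1r.
  have := hf_pos hQ (g + (- s)%:C *: (u *: f)).
  rewrite form_quadratic => h.
  have : 0 <= s^-1 * (n g + 2 * - s * complex.Re (Q (u *: f) g) + (- s) ^+ 2 * n (u *: f)).
    by rewrite mulr_ge0// invr_ge0 ltW.
  have -> : s^-1 * (n g + 2 * - s * complex.Re (Q (u *: f) g) + (- s) ^+ 2 * n (u *: f)) =
     s^-1 * n g - 2 * complex.Re (Q (u *: f) g) + s * n (u *: f).
    by field; rewrite gt_eqF.
  lra.
apply: normc_le_rotation => //; rewrite divr_ge0// addr_ge0// mulr_ge0 ?(hf_pos hQ)//.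
  exact: ltW.
by rewrite invr_ge0 ltW.
Qed.

End HermitianForms.

Section Riesz.
Context {R : realType} {H : completeNormedModType R[i]}.
Local Notation hn f := (normc `|f|).

Lemma norm_realE (f : H) : `|f| = (hn f)%:C.
Proof.
apply: complexP => /=; last first.
  by have := normr_ge0 f; rewrite lecE => /andP[/eqP/= ->].
have : 0 <= `|f| := normr_ge0 f; rewrite lecE => /andP[/eqP/= h1 h2].
by case: `|f| h1 h2 => x y /= -> x0; rewrite expr0n /= addr0 sqrtr_sqr ger0_norm.
Qed.

Lemma hilbert_complete (u : nat -> H) :
  (forall e : R, 0 < e -> exists n0 : nat, forall p q : nat, (n0 <= p)%N -> (n0 <= q)%N ->
    hn (u p - u q) < e) ->
  exists l, forall e : R, 0 < e -> exists n0 : nat, forall n, (n0 <= n)%N -> hn (u n - l) < e.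
Proof.
move=> uC; have posE (e : R[i]) : 0 < e -> 0 < complex.Re e /\ e = (complex.Re e)%:C.
  by rewrite ltcE => /andP[/eqP/= h1 h2]; split => //; apply: complexP.
have /cauchy_cvg/cvg_ex[l ul] : cauchy (u @ \oo).
  apply/cauchy_ballP => e /posE[e0 eE]; have [n0 h] := uC _ e0.
  exists (u @` [set n | (n0 <= n)%N], u @` [set n | (n0 <= n)%N]) => /=.
    by split; exists n0 => // n /= nn; exists n.
  move=> [_ _] /= [[p np <-] [q nq <-]].
  by rewrite -ball_normE /ball_ /= norm_realE eE ltcR h.
exists l => e e0; move/cvgrPdist_lt: ul => /(_ e%:C); rewrite ltcR => /(_ e0)[n0 _ h].
by exists n0 => n nn; rewrite -ltcR -norm_realE distrC; exact: (h n nn).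
Qed.

Variables (Q : H -> H -> R[i]) (c1 c2 : R).
Hypotheses (hQ : hermitian_form Q) (c1_gt0 : 0 < c1) (c2_gt0 : 0 < c2)
  (Q_ge : forall f, c1 * hn f ^+ 2 <= complex.Re (Q f f))
  (Q_le : forall f, complex.Re (Q f f) <= c2 * hn f ^+ 2).
Local Notation n f := (complex.Re (Q f f)).
Variables (phi : H -> R[i]) (K : R).
Hypotheses (phi_lin : forall c f g, phi (c *: f + g) = c * phi f + phi g)
  (phi_bnd : forall f, normc (phi f) <= K * (1 + hn f ^+ 2)).

(** The quadratic functional minimized by the vector that represents [phi] with respect to [Q]. *)
Let energy f := n f - 2 * complex.Re (phi f).

Let phi0 : phi 0 = 0.
Proof. by have := phi_lin (-1) 0 0; rewrite scaler0 addr0 mulN1r addNr. Qed.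

Let phiZ c f : phi (c *: f) = c * phi f.
Proof. by have := phi_lin c f 0; rewrite addr0 phi0 addr0. Qed.

Let phiD f g : phi (f + g) = phi f + phi g.
Proof. by have := phi_lin 1 f g; rewrite scale1r mul1r. Qed.

Let hnZ c (f : H) : hn (c *: f) = normc c * hn f.
Proof. by rewrite normrZ normcM; congr (_ * _); rewrite normc_ge0_real ?normc_ge0. Qed.

Let K_ge0 : 0 <= K.
Proof.
by have := phi_bnd 0; rewrite phi0 normr0 normc00 expr0n addr0 mulr1.
Qed.

(** Applied to [f / s], the quadratic bound on [phi] gives [|phi f| <= s * K + K / s * |f|^2]. For
    [2 * K / s <= c1] the quadratic part is absorbed by [n f]; the summand 1 in [s] keeps it
    positive when [K = 0]. *)
Let energy_lower : exists L, forall f, L <= energy f.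
Proof.
pose s := 2 * K / c1 + 1; have s0 : 0 < s by rewrite ltr_wpDl// divr_ge0 ?mulr_ge0// ltW.
exists (- (2 * s * K)) => f; rewrite /energy.
have h := phi_bnd (s^-1%:C *: f).
have s1 : 0 <= s^-1 by rewrite invr_ge0 ltW.
rewrite phiZ hnZ normcM (normc_ge0_real s1) in h.
have {}h : normc (phi f) <= s * (K * (1 + (s^-1 * hn f) ^+ 2)) by rewrite -ler_pdivrMl.
have hs : 2 * K * s^-1 <= c1.
  rewrite ler_pdivrMr// (_ : c1 * s = 2 * K + c1) ?lerDl ?ltW//.
  by rewrite /s; field; rewrite gt_eqF.
have hR := Re_le_normc (phi f); have hR' := ler_norm (complex.Re (phi f)).
have := Q_ge f; have hh : 0 <= hn f ^+ 2 by rewrite exprn_ge0// normc_ge0.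
have E1 : 2 * (s * (K * (1 + (s^-1 * hn f) ^+ 2))) = 2 * s * K + 2 * K * s^-1 * hn f ^+ 2.
  by field; rewrite gt_eqF.
have := ler_wpM2r hh hs; lra.
Qed.

(** By the parallelogram law at midpoints, a minimizing sequence of [energy] is Cauchy. The first
    variation is estimated at near-minimizers close to the limit and not at the limit itself, so
    continuity of [energy] does not come in. *)
Lemma riesz_representation : exists h, forall g, phi g = Q g h.
Proof.
have [L hL] := energy_lower.
pose d := inf (range energy).
have hinf : has_inf (range energy).
  by split; [exists (energy 0), 0|exists L => _ [f _ <-]].
have d_le f : d <= energy f by apply: ge_inf; [exists L => _ [g _ <-]|exists f].
have e_gt0 j : 0 < (j.+1%:R : R)^-1 by rewrite invr_gt0 ltr0n.
have /choice[u hu] j : exists f, energy f < d + (j.+1%:R : R)^-1.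
  by have [_ [f _ <-] hf] := inf_adherent (e_gt0 j) hinf; exists f.
have dist p q : n (u p - u q) <= 2 * ((p.+1%:R : R)^-1 + (q.+1%:R : R)^-1).
  have hm := d_le ((2^-1 : R)%:C *: (u p + u q)).
  have := hu p; have := hu q; move: hm.
  rewrite /energy (form_scale hQ) normc_ge0_real ?invr_ge0// phiZ phiD ReM ReD /= mul0r subr0.
  rewrite (form_parallelogram hQ) (_ : 2^-1 ^+ 2 = 4^-1 :> R); last by field.
  move: (p.+1%:R^-1) (q.+1%:R^-1) => ep eq; lra.
have small e : 0 < e -> exists n0 : nat, forall j, (n0 <= j)%N -> (j.+1%:R : R)^-1 < e.
  move=> e0; have := near_infty_natSinv_lt (PosNum e0) => -[n0 _ h].
  by exists n0 => j nj; exact: h.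
have [h uh] : exists l, forall e : R, 0 < e -> exists n0 : nat, forall j, (n0 <= j)%N ->
    hn (u j - l) < e.
  apply: hilbert_complete => e e0.
  have e1 : 0 < c1 * e ^+ 2 / 4 by rewrite divr_gt0// mulr_gt0// exprn_gt0.
  have [n0 hn0] := small _ e1; exists n0 => p q np nq.
  rewrite -(@ltr_pXn2r _ 2)// ?nnegrE ?normc_ge0 ?(ltW e0)//.
  rewrite -(ltr_pM2l c1_gt0); apply: le_lt_trans (Q_ge _) _.
  apply: le_lt_trans (dist p q) _; have := hn0 _ np; have := hn0 _ nq.
  move: (p.+1%:R^-1) (q.+1%:R^-1) => ep eq; lra.
have small2 e : 0 < e -> exists j, (j.+1%:R : R)^-1 + n (h - u j) <= e.
  move=> e0; have e2 : 0 < e / 2 by rewrite divr_gt0.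
  (* A distance below 1 has a smaller square, so a bound on the distance itself makes
     [c2 * hn (u j - h) ^+ 2] at most [e / 2]. *)
  have e3 : 0 < Num.min 1 (e / (2 * c2)).
    by rewrite lt_min ltr01 divr_gt0// mulr_gt0.
  have [n0 h0] := small _ e2; have [n1 h1] := uh _ e3.
  pose j := maxn n0 n1; exists j.
  have hj0 := h0 j (leq_maxl _ _); have hj := h1 j (leq_maxr _ _).
  have : c2 * hn (u j - h) ^+ 2 <= e / 2.
    rewrite -ler_pdivlMl//.
    have -> : c2^-1 * (e / 2) = e / (2 * c2) by field; rewrite gt_eqF.
    move: hj; rewrite lt_min => /andP[hj1 hj2].
    apply: le_trans (ltW hj2); rewrite expr2 -[leRHS]mul1r.
    by apply: ler_wpM2r; [exact: normc_ge0|exact: ltW].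
  have := Q_le (h - u j); rewrite (_ : hn (h - u j) = hn (u j - h)) 1?distrC//; move: (j.+1%:R^-1) hj0 => ej hj0; lra.
have key g : complex.Re (Q g h) = complex.Re (phi g).
  have ng := hf_pos hQ g.
  apply/eqP; rewrite -subr_eq0 -normr_eq0 eq_le normr_ge0 andbT.
  apply/ler_addgt0Pr => e e0; rewrite add0r.
  have ng1 : 0 < n g + 1 by rewrite ltr_wpDl.
  (* Twice the first variation at [u j] is at most [ej / t + t * n g]. Once
     [ej + n (h - u j) <= t ^+ 2], the total error is at most [t * n g + t], which equals [e] for
     this [t]. *)
  pose t := e / (n g + 1); have t0 : 0 < t by rewrite divr_gt0.
  have [j] := small2 _ (exprn_gt0 2 t0); move: (hu j); move: (j.+1%:R^-1) => ej huj hj.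
  have var s : 0 <= ej + 2 * s * (complex.Re (Q g (u j)) - complex.Re (phi g)) + s ^+ 2 * n g.
    have := d_le (u j + s%:C *: g); rewrite /energy (form_quadratic hQ) phiD phiZ ReD ReM /=.
    rewrite mul0r subr0; have := huj; rewrite /energy; lra.
  have d1 := form_young hQ g (h - u j) t0.
  have d2 := Re_le_normc (Q g (h - u j)); rewrite (formBr hQ) ReD ReN -(formBr hQ) in d2.
  have tj : t^-1 * (ej + n (h - u j)) <= t.
    by rewrite -ler_pdivlMl ?invr_gt0// invrK -expr2.
  have et : e = t * n g + t by rewrite /t; field; rewrite gt_eqF.
  have v1 := ler_wpM2l (ltW (_ : 0 < t^-1)) (var t).
  have v2 := ler_wpM2l (ltW (_ : 0 < t^-1)) (var (- t)).
  have ti : 0 < t^-1 by rewrite invr_gt0.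
  have {}v1 := v1 ti; have {}v2 := v2 ti.
  set r := complex.Re (Q g (u j)) in v1 v2 d2 *; set p := complex.Re (phi g) in v1 v2 *.
  have E1 : t^-1 * (ej + 2 * t * (r - p) + t ^+ 2 * n g) =
     t^-1 * ej + 2 * (r - p) + t * n g by field; rewrite gt_eqF.
  have E2 : t^-1 * (ej + 2 * - t * (r - p) + (- t) ^+ 2 * n g) =
     t^-1 * ej - 2 * (r - p) + t * n g by field; rewrite gt_eqF.
  rewrite mulr0 E1 in v1; rewrite mulr0 E2 in v2; rewrite mulrDr in tj.
  move: d2; rewrite ler_norml => /andP[d2 d3]; rewrite ler_norml; apply/andP; split; lra.
exists h => g; apply: complexP; first by rewrite key.
(* The real-part identity at [i g] is the identity of imaginary parts at [g]. *)
have := key ('i *: g); rewrite (formZ hQ) phiZ !ReM /= !mul0r !mul1r !sub0r.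
by move/oppr_inj => ->.
Qed.

End Riesz.

Section FrameOperator.
Context {R : realType} {H : completeNormedModType R[i]}.
Variable ip : {dot H for (@Num.conj R[i])}.
Context {X : ptopologicalType}.
Variables (mu : {measure set (borel X) -> \bar R}) (psi : X -> H).
Hypotheses (hnorm : forall f : H, `|f| ^+ 2 = ip f f) (hpsi : continuous_frame ip mu psi).
Local Notation hn f := (normc `|f|).
Local Notation cint := (cintegral mu setT).
Local Notation T := (frame_op_inv ip mu psi).
Local Notation k := (frame_kernel ip mu psi).

Lemma dot_hermitian : hermitian_form ip.
Proof.
split=> [c f g h|f g|f]; first by rewrite linearPl.
- by have := @hermitian_subproof _ _ _ _ ip g f; rewrite expr0 mul1r.
- by have := dnorm_ge0 ip f; rewrite lecE => /andP[].
Qed.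

Lemma dot_norm f : complex.Re (ip f f) = hn f ^+ 2.
Proof.
rewrite -hnorm (_ : `|f| ^+ 2 = (hn f ^+ 2)%:C)//.
by rewrite [in LHS]norm_realE !expr2 real_complexM.
Qed.

Lemma dot_eq f h : (forall g, ip f g = ip h g) -> f = h.
Proof.
move=> fh; apply/eqP; rewrite -subr_eq0 -(dnorm_eq0 ip); apply/eqP.
by rewrite (formB dot_hermitian) fh subrr.
Qed.

Lemma dot_young f g : normc (ip f g) <= hn f ^+ 2 + hn g ^+ 2.
Proof.
have := form_young dot_hermitian f g ltr01; rewrite invr1 !mul1r !dot_norm.
have := exprn_ge0 2 (normc_ge0 `|f|); have := exprn_ge0 2 (normc_ge0 `|g|); lra.
Qed.

Lemma continuous_borel (g : X -> R) : continuous g -> measurable_fun setT (g : borel X -> R).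
Proof.
move=> /continuousP cg; apply: (measurability _ (RGenOpens.measurableE R)).
move=> _ [_ [a [b ->] <-]]; rewrite setTI; apply: open_borel.
exact/cg/interval_open.
Qed.

Lemma frame_cmeas f : cmeasurable setT ((fun x => ip f (psi x)) : borel X -> R[i]).
Proof.
have [cf _ _] := hpsi; have {}cf := cf f.
have re (p : R[i] -> R) : (forall z w, `|p z - p w| <= normc (z - w)) ->
    measurable_fun setT ((fun x => p (ip f (psi x))) : borel X -> R).
  move=> pl; apply: continuous_borel => x; apply/cvgrPdist_lt => e e0.
  have e0' : 0 < e%:C by rewrite ltcR.
  move/cvgrPdist_lt: (cf x) => /(_ _ e0'); apply: filterS => y hy.
  by apply: le_lt_trans (pl _ _) _; rewrite -ltcR.
split; apply: re => z w.
  by rewrite -ReN -ReD; exact: Re_le_normc.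
by rewrite -ImN -ImD; exact: Im_le_normc.
Qed.

Lemma frame_cmeasC g : cmeasurable setT ((fun x => ip (psi x) g) : borel X -> R[i]).
Proof.
have -> : (fun x => ip (psi x) g) = (fun x => Num.conj (ip g (psi x))).
  by apply/funext => x; exact: (hf_sym dot_hermitian).
exact: cmeas_conj (frame_cmeas g).
Qed.

Let sq_meas f : measurable_fun setT ((fun x => normc (ip f (psi x)) ^+ 2) : borel X -> R).
Proof. by apply: measurable_funX; exact: cmeas_normc (frame_cmeas f). Qed.

Let sq_ge0 f x : 0 <= normc (ip f (psi x)) ^+ 2.
Proof. by rewrite exprn_ge0// normc_ge0. Qed.

Lemma frame_sq_lty f : (\int[mu]_x (normc (ip f (psi x)) ^+ 2)%:E < +oo)%E.
Proof. by have [_ _ [C1 [C2 [_ _ h]]]] := hpsi; apply: le_lt_trans (h f).2 (ltry _). Qed.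

(** The form [<S f, g>], available before [S] is known to exist. The frame inequalities make it
    equivalent to the inner product, so Riesz' theorem holds for it as well. *)
Definition frame_form (f g : H) : R[i] := cint (fun x => ip f (psi x) * ip (psi x) g).
Local Notation Q := frame_form.

Lemma frame_form_integrable f g : cintegrable mu setT (fun x => ip f (psi x) * ip (psi x) g).
Proof.
apply: (@le_cintegrable _ _ _ mu _
  (fun x => (normc (ip f (psi x)) ^+ 2 + normc (ip g (psi x)) ^+ 2)%:E)).
- by apply: cmeasM; [exact: frame_cmeas|exact: frame_cmeasC].
- by apply/measurable_EFinP; exact: measurable_funD.
- move=> x; rewrite lee_fin normcM (hf_sym dot_hermitian g) normc_conj.
  set a := normc _; set b := normc _.
  by have := sqr_ge0 (a - b); rewrite sqrrB; have := sqr_ge0 a; have := sqr_ge0 b; lra.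
- by rewrite ge0_integral_RD// lte_add_pinfty// frame_sq_lty.
Qed.

Lemma frame_form_hermitian : hermitian_form Q.
Proof.
split.
- move=> c f g h; have ifh := frame_form_integrable f h.
  have igh := frame_form_integrable g h; have icf := cintegrableZ c ifh.
  rewrite /Q -cintegralZ// -cintegralD//.
  by congr cintegral; apply/funext => x; rewrite linearPl mulrDl mulrA.
- move=> f g; rewrite /Q -cintegral_conj; last exact: frame_form_integrable.
  congr cintegral; apply/funext => x.
  by rewrite conjCM -!(hf_sym dot_hermitian) mulrC.
- move=> f; apply: Rintegral_ge0 => x _.
  rewrite (hf_sym dot_hermitian f) mul_conj_normc; exact: sq_ge0.
Qed.

Lemma frame_form_diag f :
  (complex.Re (Q f f))%:E = (\int[mu]_x (normc (ip f (psi x)) ^+ 2)%:E)%E.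
Proof.
rewrite /Q /cintegral /= /Rintegral (_ : integral _ _ _ =
  (\int[mu]_x (normc (ip f (psi x)) ^+ 2)%:E)%E); last first.
  by apply: eq_integral => x _; rewrite (hf_sym dot_hermitian f (psi x)) mul_conj_normc.
rewrite fineK// ge0_fin_numE ?frame_sq_lty//.
by apply: integral_ge0 => x _; rewrite lee_fin.
Qed.

Lemma frame_form_bounds : exists c1 c2, [/\ 0 < c1, 0 < c2,
  forall f, c1 * hn f ^+ 2 <= complex.Re (Q f f) &
  forall f, complex.Re (Q f f) <= c2 * hn f ^+ 2].
Proof.
have [_ _ [C1 [C2 [C1_gt0 C2_gt0 h]]]] := hpsi; exists C1, C2; split => // f.
  by rewrite -lee_fin frame_form_diag; exact: (h f).1.
by rewrite -lee_fin frame_form_diag; exact: (h f).2.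
Qed.

Lemma dot_riesz (phi : H -> R[i]) (K : R) :
  (forall c f g, phi (c *: f + g) = c * phi f + phi g) ->
  (forall f, normc (phi f) <= K * (1 + hn f ^+ 2)) ->
  exists h, forall g, phi g = ip g h.
Proof.
move=> pl pb; apply: (riesz_representation dot_hermitian ltr01 ltr01 _ _ pl pb) => f.
  by rewrite mul1r dot_norm.
by rewrite mul1r dot_norm.
Qed.

(** [frame_op] selects a vector by its weak definition, with default 0; Riesz' theorem for the inner
    product guarantees that one exists. *)
Lemma frame_opE f g : ip (frame_op ip mu psi f) g = Q f g.
Proof.
have [c1 [c2 [c1_gt0 c2_gt0 hc1 hc2]]] := frame_form_bounds.
have hQ := frame_form_hermitian.
have [h hh] : exists h, forall g, Q g f = ip g h.
  apply: (dot_riesz (K := c2 + complex.Re (Q f f))) => [c g1 g2|g1]; first exact: (hf_lin hQ).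
  apply: le_trans (form_young hQ g1 f ltr01) _; rewrite invr1 !mul1r.
  have := hc2 g1; have := hf_pos hQ f; have := exprn_ge0 2 (normc_ge0 `|g1|) => p1 p2 p3.
  have := mulr_ge0 p2 p1; have := mulr_ge0 (ltW c2_gt0) p1; rewrite mulrDr mulr1 mulrDl; lra.
rewrite /frame_op; case: xgetP => [h' _ /(_ g)//|/(_ h)[]] g'.
by rewrite (hf_sym dot_hermitian g') -hh -(hf_sym hQ).
Qed.

(** The vector that represents [<., f>] with respect to the frame form is a preimage of [f] under
    [S]. Surjectivity of [S] thus comes from Riesz' theorem for that form. *)
Lemma frame_op_invE f g : Q (T f) g = ip f g.
Proof.
have [c1 [c2 [c1_gt0 c2_gt0 hc1 hc2]]] := frame_form_bounds.
have hQ := frame_form_hermitian.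
have [h hh] : exists h, forall g, ip g f = Q g h.
  apply: (riesz_representation hQ c1_gt0 c2_gt0 hc1 hc2 (phi := ip^~ f) (K := 1 + hn f ^+ 2)).
    by move=> c g1 g2; exact: (hf_lin dot_hermitian).
  move=> g1; apply: le_trans (dot_young g1 f) _.
  have := exprn_ge0 2 (normc_ge0 `|g1|); have := exprn_ge0 2 (normc_ge0 `|f|) => p1 p2.
  have := mulr_ge0 p1 p2; rewrite mulrDr mulr1 mulrDl mul1r; lra.
rewrite -frame_opE; congr (ip _ g); rewrite /frame_op_inv.
case: xgetP => [//|/(_ h)[]]; apply: dot_eq => g'.
by rewrite frame_opE (hf_sym hQ) -hh -(hf_sym dot_hermitian).
Qed.

Lemma frame_op_inv_sym f g : ip (T f) g = ip f (T g).
Proof.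
have hQ := frame_form_hermitian.
by rewrite (hf_sym dot_hermitian g) -frame_op_invE -(hf_sym hQ) frame_op_invE.
Qed.

Lemma frame_op_inv_bounded : exists2 c : R, 0 <= c & forall f, hn (T f) ^+ 2 <= c * hn f ^+ 2.
Proof.
have [c1 [c2 [c1_gt0 _ hc1 _]]] := frame_form_bounds.
exists (c1^-1 ^+ 2) => [|f]; first exact: sqr_ge0.
have := hc1 (T f); rewrite frame_op_invE => h1.
have c1i : 0 < c1^-1 by rewrite invr_gt0.
(* With the parameter [c1^-1], half of [c1 * hn (T f) ^+ 2] appears on the right and is absorbed by
   the lower frame bound. *)
have := form_young dot_hermitian f (T f) c1i; rewrite invrK !dot_norm => h2.
have := Re_le_normc (ip f (T f)); have := ler_norm (complex.Re (ip f (T f))) => h3 h4.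
rewrite -(ler_pM2l c1_gt0).
rewrite (_ : c1 * (c1^-1 ^+ 2 * _) = c1^-1 * hn f ^+ 2); first by lra.
by field; rewrite gt_eqF.
Qed.

Lemma frame_kernel_sym x y : k y x = Num.conj (k x y).
Proof.
by rewrite /frame_kernel -(hf_sym dot_hermitian) frame_op_inv_sym.
Qed.

(** An additive bound from Young's inequality; what matters is uniformity in [x] and at most
    quadratic growth in [f], the form in which the Riesz lemma takes its hypothesis. *)
Lemma frame_bounded : exists2 M : R, 0 <= M & forall f x,
  normc (ip f (psi x)) <= hn f ^+ 2 + M /\ normc (ip f (T (psi x))) <= hn f ^+ 2 + M.
Proof.
have [_ [M hM] _] := hpsi; have [c c0 hc] := frame_op_inv_bounded.
have hM2 x : hn (psi x) ^+ 2 <= M ^+ 2.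
  have h : hn (psi x) <= M by rewrite -lecR -norm_realE.
  have M0 := le_trans (normc_ge0 `|psi x|) h.
  by rewrite !expr2 ler_pM// normc_ge0.
have M2 : 0 <= M ^+ 2 by exact: sqr_ge0.
exists ((1 + c) * M ^+ 2) => [|f x]; first by rewrite mulr_ge0// addr_ge0.
have cM : 0 <= c * M ^+ 2 by rewrite mulr_ge0.
have := hc (psi x); have := ler_wpM2l c0 (hM2 x); have := hM2 x => p1 p2 p3.
by split; apply: le_trans (dot_young _ _) _; rewrite lerD2l mulrDl mul1r; lra.
Qed.

(** The identity [<f, S^-1 g>_S = <f, g>] for the frame form, taken at [g = psi_x]. *)
Lemma frame_reproducing f x :
  ip f (psi x) = cint (fun y => ip f (psi y) * k x y).
Proof.
have hQ := frame_form_hermitian.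
by rewrite [LHS](hf_sym dot_hermitian) -frame_op_invE -(hf_sym hQ).
Qed.

Lemma dual_frame_reproducing f x :
  ip f (T (psi x)) = cint (fun y => ip f (T (psi y)) * k x y).
Proof.
rewrite -[LHS]frame_op_invE; congr cintegral; apply/funext => y.
by rewrite frame_op_inv_sym.
Qed.

(** The weak integral of [F y * psi_y]. Riesz' theorem represents functionals that are linear in
    [g], so it is applied to the conjugate of the required one. *)
Lemma weak_integral (F : X -> R[i]) : cintegrable mu setT F ->
  exists e, forall g, ip e g = cint (fun y => F y * ip (psi y) g).
Proof.
move=> iF; have mF := cintegrable_meas iF; have lF := cintegrable_lty iF.
have [M M0 hM] := frame_bounded.
have F_fin : (\int[mu]_x (normc (F x))%:E)%E = (fine (\int[mu]_x (normc (F x))%:E)%E)%:E.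
  by rewrite fineK// ge0_fin_numE//; exact: integral_normc_ge0.
set K0 := fine _ in F_fin.
have K0_ge0 : 0 <= K0 by rewrite /K0 fine_ge0// integral_normc_ge0.
have bnd g : (\int[mu]_y (normc (Num.conj (F y) * ip g (psi y)))%:E <=
    ((hn g ^+ 2 + M) * K0)%:E)%E.
  rewrite EFinM -F_fin -ge0_integral_RZ; last 3 first.
  - by rewrite addr_ge0// sqr_ge0.
  - exact: cmeas_normc.
  - by move=> y; exact: normc_ge0.
  apply: le_integral_R.
  - apply: cmeas_normc; apply: cmeasM; [exact: cmeas_conj|exact: frame_cmeas].
  - by apply: measurable_funM => //; exact: cmeas_normc.
  - by move=> y; exact: normc_ge0.
  - move=> y; rewrite normcM normc_conj mulrC; apply: ler_wpM2r; first exact: normc_ge0.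
    exact: (hM g y).1.
have ib g : cintegrable mu setT (fun y => Num.conj (F y) * ip g (psi y)).
  apply/cintegrableP; split; last by apply: le_lt_trans (bnd g) (ltry _).
  apply: cmeasM; [exact: cmeas_conj|exact: frame_cmeas].
have [e he] : exists e, forall g, cint (fun y => Num.conj (F y) * ip g (psi y)) = ip g e.
  apply: (dot_riesz (K := (1 + M) * K0)) => [c f g|f].
    rewrite -cintegralZ// -cintegralD//; last exact: cintegrableZ.
    by congr cintegral; apply/funext => y; rewrite linearPl; ring.
  apply: (le_trans (cintegral_le (ib f) (bnd f))).
  rewrite mulrAC; apply: ler_wpM2r => //.
  have := exprn_ge0 2 (normc_ge0 `|f|) => p1; have := mulr_ge0 M0 p1.
  rewrite mulrDr mulr1 mulrDl; lra.
exists e => g; rewrite (hf_sym dot_hermitian g) -he -cintegral_conj//.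
congr cintegral; apply/funext => y.
by rewrite conjCM conjCC -(hf_sym dot_hermitian).
Qed.

End FrameOperator.

(** * Measurability and kernel norms *)

(* [X * X] with the pointed topological structure required by [compact_cover]. *)
Definition pointed_square (X : ptopologicalType) : Type := (X * X)%type.
HB.instance Definition _ (X : ptopologicalType) :=
  Topological.copy (pointed_square X) (X * X)%type.
HB.instance Definition _ (X : ptopologicalType) :=
  isPointed.Build (pointed_square X) (point, point).

Section ProductBorel.
Context {R : realType} {X : ptopologicalType}.
Hypothesis hXsc : sigma_compact X.

(** Without second countability, an open subset of [X * X] may fail to belong to the product of the
    Borel sigma-algebras. By compactness, finitely many open rectangles still fit between [C] and
    [O]. *)
Lemma compact_between (C O : set (X * X)) : compact C -> open O -> C `<=` O ->
  exists M : set (borel X * borel X), [/\ measurable M, C `<=` M & M `<=` O].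
Proof.
move=> kC oO CO; have cC : @cover_compact (pointed_square X) C by rewrite -compact_cover.
pose D : set (set X * set X) := [set PQ | [/\ open PQ.1, open PQ.2 & PQ.1 `*` PQ.2 `<=` O]].
have [|p Cp|F FD CF] := cC _ D (fun PQ => PQ.1 `*` PQ.2).
- move=> PQ [oP oQ _]; rewrite openE => -[x y] [/= Px Qy].
  by exists PQ => //; split; exact: open_nbhs_nbhs.
- have := oO; rewrite openE => /(_ p (CO _ Cp)) [[A B] /= [nA nB] AB].
  exists (A°, B°) => /=.
    by split; [exact: open_interior|exact: open_interior|];
      move=> r [r1 r2]; apply: AB; split; exact: interior_subset.
  by split => /=.
exists (\bigcup_(PQ in [set` F]) (PQ.1 `*` PQ.2)); split => //.
- apply: fin_bigcup_measurable; first exact: finite_fset.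
  move=> PQ /= /FD /set_mem [oP oQ _].
  by apply: (@measurableX _ _ (borel X) (borel X)); exact: open_borel.
- by move=> p [PQ /= /FD /set_mem [_ _ h]] /h.
Qed.

(** The preimage of an open interval is the union of preimages of closed subintervals, cut by
    products of the exhausting compact sets. These countably many compact pieces are separated from
    the outside by measurable sets. *)
Lemma sigma_compact_jointly_measurable (m : X -> X -> R) :
  continuous (fun p : X * X => m p.1 p.2) -> jointly_measurable m.
Proof.
move=> cm; have [K [cK KT]] := hXsc.
apply: (measurability _ (RGenOpens.measurableE R)) => //.
move=> _ [_ [a [b ->]] <-]; rewrite setTI.
set O := (X in measurable X).
have oO : open (O : set (X * X)).
  by move/continuousP: cm => cm; exact/cm/interval_open.
pose L (n : nat) := (fun p : X * X => m p.1 p.2) @^-1` [set t | a + n.+1%:R^-1 <= t <= b - n.+1%:R^-1].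
have cL n : closed (L n).
  apply: (closed_comp (f := fun p : X * X => m p.1 p.2)); first by move=> p _; exact: cm.
  by rewrite -set_itvcc; exact: interval_closed.
have LO n : L n `<=` O.
  move=> p; rewrite /L /O /= in_itv /= => /andP[h1 h2].
  have e0 : 0 < (n.+1%:R : R)^-1 by rewrite invr_gt0 ltr0n.
  by move: (n.+1%:R^-1) e0 h1 h2 => e e0 h1 h2; apply/andP; split; lra.
have hM (pn : nat * nat * nat) : exists M : set (borel X * borel X),
    [/\ measurable M, (K pn.1.1 `*` K pn.1.2) `&` L pn.2 `<=` M & M `<=` O].
  apply: compact_between => //.
    by apply: compact_closedI; [exact: compact_setX|exact: cL].
  by move=> p [_]; exact: LO.
have /choice[M MP] := hM.
have -> : O = \bigcup_pn M pn.
  apply/seteqP; split => [[x y] Oxy|p [pn _]]; last by have [_ _] := MP pn; exact.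
  have [i _ Kx] : (\bigcup_n K n) x by rewrite KT.
  have [j _ Ky] : (\bigcup_n K n) y by rewrite KT.
  move: (Oxy); rewrite /O /= in_itv /= => /andP[h1 h2].
  have e0 : 0 < Num.min (m x y - a) (b - m x y) by rewrite lt_min !subr_gt0 h1 h2.
  have [n _ hn] := near_infty_natSinv_lt (PosNum e0).
  have := hn n (leqnn n); rewrite /= lt_min => /andP[h3 h4].
  exists (i, j, n) => //; have [_ h _] := MP (i, j, n); apply: h; split; first by split.
  rewrite /L /=; move: (n.+1%:R^-1) h3 h4 => e h3 h4.
  by apply/andP; split; [rewrite -lerBrDl ltW|rewrite lerBrDr -lerBrDl ltW].
apply: countable_bigcupT_measurable; first exact: countableP.
by move=> pn; have [] := MP pn.
Qed.

End ProductBorel.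

Section MeasureFacts.
Context {R : realType} {X : ptopologicalType}.
Variable mu : {measure set (borel X) -> \bar R}.

Lemma sigma_compact_sigma_finite : sigma_compact X -> hausdorff_space X ->
  (forall K : set X, compact K -> (mu K < +oo)%E) -> sigma_finite setT mu.
Proof.
move=> [K [cK KT]] hX fK; exists K; first by rewrite KT.
by move=> i; split; [exact: compact_borel|exact: fK].
Qed.

Lemma weighted_meas (m : X -> X -> R) (K : X -> X -> R[i]) : jointly_measurable m ->
  (forall x y, 1 <= m x y) ->
  cmeasurable setT (fun p : borel X * borel X => weighted m K p.1 p.2) ->
  cmeasurable setT (fun p : borel X * borel X => K p.1 p.2).
Proof.
move=> mm m1 mK.
have m0 x y : 0 < m x y by exact: lt_le_trans ltr01 (m1 x y).
have mi : measurable_fun setT (fun p : borel X * borel X => (m p.1 p.2)^-1).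
  by apply: (measurable_fun_invr mm) => p; exact: m0.
have := cmeasM mK (cmeas_real mi); congr cmeasurable; apply/funext => p.
by rewrite /weighted -mulrA -real_complexM divff ?mulr1// gt_eqF.
Qed.

Let lee_maxl (a b : \bar R) : (a <= maxe a b)%E. Proof. by rewrite le_max lexx. Qed.

Let lee_maxr (a b : \bar R) : (b <= maxe a b)%E. Proof. by rewrite le_max lexx orbT. Qed.

Lemma A1_kernel_bound (m : X -> X -> R) (K : X -> X -> R[i]) : Am mu m K ->
  (forall x y, 0 <= m x y) -> kernel_bound mu m (fun x y => normc (K x y)) (Am_norm mu m K).
Proof.
move=> [_ fin] m0; rewrite /Am_norm; set e := A1_norm _ _ in fin *.
have fine_le (a : \bar R) : (0 <= a)%E -> (a <= e)%E -> (a <= (fine e)%:E)%E.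
  by case: e fin => [r| |]// _ a0 ae; have := le_trans a0 ae; rewrite leeNy_eq.
have nE x y : normc (weighted m K x y) = normc (K x y) * m x y.
  by rewrite normcM normc_ge0_real.
split.
- apply: ae_impl (ess_sup_ge mu (fun x => \int[mu]_y (normc (weighted m K x y))%:E)%E) => x hx.
  under eq_integral do rewrite -nE.
  apply: fine_le; first exact: integral_normc_ge0.
  exact: le_trans hx (lee_maxl _ _).
- apply: ae_impl (ess_sup_ge mu (fun y => \int[mu]_x (normc (weighted m K x y))%:E)%E) => y hy.
  under eq_integral do rewrite -nE.
  apply: fine_le; first by apply: integral_ge0 => x _; rewrite lee_fin normc_ge0.
  exact: le_trans hy (lee_maxr _ _).
Qed.

Context {I : countType} (U : I -> set X) (K : X -> X -> R[i]) (B : R).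
Hypothesis K_bnd : forall x y, normc (K x y) <= B.

(** Boundedness of [K] makes the supremum in [osc] a genuine upper bound and not a default value. *)
Let osc_ub x y : has_ubound [set normc (K x y - K x w) | w in Qset U y].
Proof.
exists (B + B) => _ [w _ <-]; apply: le_trans (normcB _ _) _; exact: lerD.
Qed.

Lemma osc_ge i x y w : U i y -> U i w -> normc (K x y - K x w) <= osc U K x y.
Proof. by move=> iy iw; apply: ub_le_sup => //; exists w => //; exists i. Qed.

Lemma osc_ge0 x y : Qset U y !=set0 -> 0 <= osc U K x y.
Proof.
move=> [w [i iy iw]]; apply: le_trans (osc_ge x iy iw); exact: normc_ge0.
Qed.

End MeasureFacts.

(** * Atomic decompositions and Banach frames of the coorbit spaces *)

Lemma frame_discretization
  (R : realType)
  (H : completeNormedModType R[i]) (ip : {dot H for (@Num.conj R[i])})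
  (X : ptopologicalType) (mu : {measure set (borel X) -> \bar R})
  (psi : X -> H) (m : X -> X -> R) (z : X)
  (I : countType) (U : I -> set X) (delta Cm : R) (xs : I -> X)
  (hnorm : forall f : H, `|f| ^+ 2 = ip f f)
  (hXsc : sigma_compact X) (hXh : hausdorff_space X)
  (hKfin : forall K : set X, compact K -> (mu K < +oo)%E)
  (hm : admissible_weight m)
  (hpsi : continuous_frame ip mu psi)
  (hR : Am mu m (frame_kernel ip mu psi))
  (hD : property_D ip mu psi m delta U Cm)
  (hxs : forall i, U i (xs i)) :
  let k := frame_kernel ip mu psi in
  let o := osc U k in
  exists D N, discretization mu k o m z U xs D Cm (Am_norm mu m k)
    (Am_norm mu m (fun x y => (o x y)%:C)) N.
Proof.
move=> k o; have [cm m1 msub msym _] := hm.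
have [[[mU pU _ UT [N hN]] [D D0 hDU] _] hCm Ao _] := hD.
have cov x : exists i, U i x.
  by have [i _ ix] : (\bigcup_i U i) x by [rewrite UT]; exists i.
have [M M0 hM] := frame_bounded hnorm hpsi.
have m0 x y : 0 <= m x y by exact: le_trans ler01 (m1 x y).
have mm : jointly_measurable m by exact: sigma_compact_jointly_measurable.
have [B [B0 hB]] : exists B, 0 <= B /\ forall x y, normc (k x y) <= B.
  have [_ [P hP] _] := hpsi.
  have hP2 x : normc `|psi x| ^+ 2 <= P ^+ 2.
    have h : normc `|psi x| <= P by rewrite -lecR -norm_realE.
    have P0 := le_trans (normc_ge0 `|psi x|) h.
    by rewrite !expr2 ler_pM// normc_ge0.
  exists (P ^+ 2 + M); split; first by rewrite addr_ge0// sqr_ge0.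
  by move=> x y; apply: le_trans (hM (psi y) x).2 _; rewrite lerD2r.
have o0 x y : 0 <= o x y.
  apply: (osc_ge0 hB); have [i iy] := cov y.
  by exists y; exists i.
have oE : o = (fun x y => normc (o x y)%:C).
  by apply/funext => x; apply/funext => y; rewrite normc_ge0_real.
exists D, N; split => //.
- exact: sigma_compact_sigma_finite.
- by have [mR _] := hR; exact: weighted_meas mR.
- exact: frame_kernel_sym.
- by exists B.
- by move=> x y; exact: (dual_frame_reproducing hnorm hpsi (psi y) x).
- by have [mo _] := Ao; exact: (weighted_meas mm m1 mo).1.
- by move=> i x y w iy iw; exact: (osc_ge hB x iy iw).
- move=> i; apply: le_lt_trans (_ : mu (closure (U i)) < +oo)%E.
    apply: le_measure; rewrite ?inE//; last exact: subset_closure.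
    by apply: closed_borel; exact: closed_closure.
  by apply: hKfin; rewrite -precompactE.
(* All covering sets that contain [x] meet one fixed [U j] containing [x], so the intersection
   number bounds their count. *)
- move=> x; have [j jx] := cov x; apply: card_le_trans (hN j).
  by apply: subset_card_le => i ix; exists x.
- exact: (A1_kernel_bound hR m0).
- by rewrite {1}oE; exact: (A1_kernel_bound Ao m0).
Qed.

(** The left side is [no * (2 * nk + no)], which is strictly below [delta * (2 * nk + delta)]
    because [no < delta]; the second argument of the maximum bounds the latter by 1. *)
Lemma contraction_constant (R : realType) (nk no delta C : R) : 0 <= nk -> 0 <= no ->
  no < delta -> delta * (nk + Num.max C (nk + delta)) <= 1 ->
  nk * no + no * (nk + no) < 1.
Proof.
move=> nk0 no0 no_lt hsmall; have delta0 := le_lt_trans no0 no_lt.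
have h1 : no * (2 * nk + no) <= no * (2 * nk + delta).
  by apply: ler_wpM2l => //; rewrite lerD2l ltW.
have h2 : no * (2 * nk + delta) < delta * (2 * nk + delta).
  by rewrite ltr_pM2r// ltr_wpDl// mulr_ge0.
have h3 : delta * (2 * nk + delta) <= 1.
  apply: le_trans hsmall; apply: ler_wpM2l; first exact: ltW.
  have h : nk + delta <= Num.max C (nk + delta) by rewrite le_max lexx orbT.
  lra.
by have := le_lt_trans h1 (lt_le_trans h2 h3); lra.
Qed.

Theorem theorem5p8
  (R : realType)
  (H : completeNormedModType R[i]) (ip : {dot H for (@Num.conj R[i])})
  (X : ptopologicalType) (mu : {measure set (borel X) -> \bar R})
  (psi : X -> H) (m : X -> X -> R) (z : X)
  (Y : set (X -> R[i])) (NY : (X -> R[i]) -> R)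
  (I : countType) (U : I -> set X) (delta Cm : R) (xs : I -> X)
  (hH : separable_hilbert ip)
  (hXlc : locally_compact [set: X]) (hXsc : sigma_compact X)
  (hXh : hausdorff_space X)
  (hmu : radon_measure mu) (hsupp : full_support mu)
  (hm : admissible_weight m)
  (hY1 : Y1 mu Y NY) (hY2 : Y2 mu Y NY m)
  (hpsi : continuous_frame ip mu psi)
  (hR : Am mu m (frame_kernel ip mu psi))
  (hdelta : 0 < delta)
  (hD : property_D ip mu psi m delta U Cm)
  (hsmall : let nR := Am_norm mu m (frame_kernel ip mu psi) in
     delta * (nR + Num.max (Cm * nR) (nR + delta)) <= 1)
  (hxs : forall i, U i (xs i)) :
  let v := fun x => m x z in
  let H1 := H1v ip mu psi v in
  let K1 := K1v ip mu psi v in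
  let CoY := Co ip mu psi v Y in
  let NCoY := Co_norm psi NY in
  let tCoY := tCo ip mu psi v Y in
  let NtCoY := tCo_norm ip mu psi NY in
  let Yf := Yflat Y U in
  let NYf := Yflat_norm NY U in
  let Yn := Ynat mu Y U in
  let NYn := Ynat_norm mu NY U in
  let psid := fun i => frame_op_inv ip mu psi (psi (xs i)) in
  [/\ forall i, H1 (psid i),
      atomic_decomposition CoY NCoY Yn NYn (weak_star K1)
        (fun i => embed ip K1 (psid i)),
      banach_frame tCoY NtCoY Yf NYf (fun i f => f (psid i)) &
      exists e : I -> H,
        [/\ forall i, K1 (e i),
            norm_equivalence tCoY NtCoY Yf NYf (fun i f => f (psid i)) /\
            norm_equivalence CoY NCoY Yn NYn (fun i f => f (e i)),
            forall f, CoY f ->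
              let terms := fun i => f (e i) *: embed ip K1 (psid i) in
              (finite_sequences_dense Yn NYn ->
                 unconditional_norm_sum CoY NCoY terms f) /\
              (~ finite_sequences_dense Yn NYn ->
                 unconditional_sum (weak_star K1) terms f) &
            finite_sequences_dense Yf NYf -> forall f, tCoY f ->
              unconditional_norm_sum tCoY NtCoY
                (fun i => f (psid i) *: embed ip H1 (e i)) f]].
Proof.
move=> v H1 K1 CoY NCoY tCoY NtCoY Yf NYf Yn NYn psid.
have [hnorm _] := hH; have [hKfin _ _] := hmu; have [_ m1 _ _ _] := hm.
have hip := dot_hermitian ip.
have [[[_ hpre _ _ _] _ _] _ _ no_lt] := hD.
set k := frame_kernel ip mu psi in hR hsmall *.
pose o := osc U k; pose T := frame_op_inv ip mu psi.
have [D [N S]] := frame_discretization z hnorm hXsc hXh hKfin hm hpsi hR hD hxs.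
rewrite -/k -/o in S no_lt; set nk := Am_norm mu m k in S hsmall.
set no := Am_norm mu m _ in S no_lt.
(* Some covering set contains [z]; this supplies the point of the index set on which the counting
   measure is built. *)
have [i0 _] := dz_U_cov S z.
have [Ck Ck0 hCk'] := kernel_integral_bound i0 S; have hCk := conj Ck0 hCk'.
have [iota hi] := cover_index S.
have hB := Y_function_space i0 S hCk hXsc hXh hpre hY1 hY2.
have chiB := cover_indic_Y i0 S hXsc hXh hpre hY1 hY2.
have chi_gt0 := cover_indic_gt0 i0 S hXsc hXh hpre hY1 hY2.
have chi_low := cover_indic_lower i0 S hXsc hXh hpre hY1 hY2.
have hq : nk * no + no * (nk + no) < 1.
  exact: (contraction_constant (nk_ge0 i0 S) (no_ge0 i0 S) no_lt hsmall).
have [M M0 hM] := frame_bounded hnorm hpsi.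
have bnd (f : H) (F : X -> R[i]) : (forall x, normc (F x) <= normc `|f| ^+ 2 + M) ->
    exists2 C, 0 <= C & forall x, normc (F x) <= C * v x.
  have c0 : 0 <= normc `|f| ^+ 2 + M by rewrite addr_ge0// sqr_ge0.
  move=> hF; exists (normc `|f| ^+ 2 + M) => // x; apply: le_trans (hF x) _.
  by rewrite ler_peMr//; exact: m1.
(* [W1], with atoms [psi], serves [Co Y]; [W2], with atoms [S^-1 psi], serves [tCo Y]. Symmetry of
   [S^-1] gives both the same kernel [k]. *)
pose W1 (f : H) (x : X) := ip f (T (psi x)).
pose W2 (f : H) (x : X) := ip f (psi x).
have W1_lin c f g x : W1 (c *: f + g) x = c * W1 f x + W1 g x by exact: (hf_lin hip).
have W2_lin c f g x : W2 (c *: f + g) x = c * W2 f x + W2 g x by exact: (hf_lin hip).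
have W1_rep f : reproduced mu k m z (W1 f).
  split; last exact: (dual_frame_reproducing hnorm hpsi).
    have -> : W1 f = (fun x => ip (T f) (psi x)).
      by apply/funext => x; rewrite /W1 -(frame_op_inv_sym hnorm hpsi).
    exact: (frame_cmeas hpsi).
  exact: (bnd f (W1 f) (fun x => (hM f x).2)).
have W2_rep f : reproduced mu k m z (W2 f).
  split; last exact: (frame_reproducing hnorm hpsi).
    exact: (frame_cmeas hpsi).
  exact: (bnd f (W2 f) (fun x => (hM f x).1)).
have W1_atom x y : W1 (psi y) x = k x y by [].
have W2_atom x y : W2 (T (psi y)) x = k x y by exact: (frame_op_inv_sym hnorm hpsi).
pose E := dual_atom i0 mu k xs iota.
have EP i : reproduced mu k m z (E i) /\ L1w mu v (E i).
  by have [h1 h2 _] := dual_atomP i0 S hCk hi hq i.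
(* Since [v >= 1], the function [E i] is integrable and the weak integral exists; its transform [W1]
   is [E i] because [E i] is reproduced. *)
have /choice[e he] i : exists e, forall g, ip e g = cintegral mu setT (fun y => E i y * ip (psi y) g).
  apply: (weak_integral hnorm hpsi); have [ME /(L1wP S)[mE wE]] := EP i.
  apply/cintegrableP; split => //; apply: le_lt_trans wE.
  apply: le_integral_R.
  - exact: cmeas_normc.
  - exact: (wint_meas S).
  - by move=> x; exact: normc_ge0.
  - by move=> x; rewrite ler_peMr// normc_ge0.
have W1_dual i : W1 (e i) = E i.
  by apply/funext => x; rewrite /W1 he [RHS](rp_eq (EP i).1).
(* On the side of functionals, the vectors of the theorem become syntheses: [S^-1 psi] at a node
   comes from a kernel function and [e i] from the dual atom [E i]. *)
have emb1 : (fun i => embed ip K1 (psid i)) = (fun i => synthesis mu m z W1 (k^~ (xs i))).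
  apply/funext => i; apply/funext => g; rewrite /embed.
  case: ifPn => [gK|gK]; last by rewrite /synthesis (negbTE gK).
  by rewrite (synthesis_kernel S hCk W1_rep _ (set_mem gK)) -(hf_sym hip).
have emb2 i : embed ip H1 (e i) = synthesis mu m z W2 (E i).
  apply/funext => g; rewrite /embed /synthesis; case: ifPn => // _.
  by rewrite he; congr cintegral; apply/funext => y; rewrite -(hf_sym hip).
split.
- by move=> i; exact: (atom_analyzing S hCk W2_atom (xs i)).
- rewrite emb1; exact: (coorbit_atomic_decomposition S hCk hi hB hq chiB chi_gt0 chi_low
    W1_lin W1_rep W1_atom W1_dual).
- exact: (coorbit_banach_frame i0 S hCk hi hB hq chiB chi_gt0 chi_low W2_lin W2_rep W2_atom).
exists e; split.
- by move=> i; exact: (dual_analyzing S hCk hi hq W1_dual i).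
- split.
    exact: (coorbit_sample_equivalence i0 S hCk hi hB hq chiB chi_low W2_lin W2_rep W2_atom).
  exact: (coorbit_coef_equivalence S hCk hi hB hq chiB chi_low W1_lin W1_rep W1_atom W1_dual).
- move=> f Cf terms.
  have [h1 _ h2 _] := coorbit_expansion S hCk hi hB hq chiB chi_low W1_lin W1_rep W1_atom W1_dual Cf.
  have -> : terms = (fun i => f (e i) *: synthesis mu m z W1 (k^~ (xs i))).
    by apply/funext => i; rewrite /terms -[embed _ _ _]/((fun i => embed ip K1 (psid i)) i) emb1.
  split => [fd|_].
    have := atomic_norm_sum i0 S hCk hi hB hq chiB chi_low W1_lin W1_rep W1_atom h1 fd.
    by rewrite -h2.
  have := atomic_weak_sum i0 S hCk hB chiB chi_low W1_rep h1.
  by rewrite -h2.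
- move=> fd f Cf.
  exact: (sample_norm_sum S hCk hi hB hq chiB chi_low W2_lin W2_rep W2_atom emb2 fd Cf).
Qed.
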